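(* Let $k$ be a positive integer with $k\equiv 0 \pmod 4$, and let $f(z) = 1 + \sum_{n=1}^{\infty} a(n) q^{n} \in M_{k}$ satisfy $a(n) \geq 0$ for all integers $1 \leq n \leq k^{2} (\log k + \log \log k)^{2}$. Then $a(n) > 0$ for all integers $n \geq \frac{1}{7316} k^{4} (\log k + \log \log k)^{2}$.
   Context: $M_k$ is the space of holomorphic modular forms of weight $k$ for $\mathrm{SL}_2(\mathbb{Z})$, with Fourier expansion in $q=e^{2\pi i z}$. *)

(* Defs.v *)
From Stdlib Require Import Reals ZArith.
From Coquelicot Require Import Coquelicot.
Open Scope R_scope.

Definition upper (z : C) : Prop := 0 < Im z.

(* q = e^{2 pi i z}, written out explicitly. *)
Definition qpar (z : C) : C :=
  (exp (- 2 * PI * Im z) * cos (2 * PI * Re z),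
   exp (- 2 * PI * Im z) * sin (2 * PI * Re z)).

Definition ZtoC (n : Z) : C := RtoC (IZR n).

Definition moeb (a b c d : Z) (z : C) : C :=
  Cdiv (ZtoC a * z + ZtoC b)%C (ZtoC c * z + ZtoC d)%C.

Definition holo_upper (f : C -> C) : Prop :=
  forall z : C, upper z -> ex_derive f z.

Definition weight_invariant (k : nat) (f : C -> C) : Prop :=
  forall (a b c d : Z) (z : C), (a * d - b * c = 1)%Z -> upper z ->
    f (moeb a b c d z) = (Cpow (ZtoC c * z + ZtoC d)%C k * f z)%C.

(* f has the q-expansion f(z) = sum_{n>=0} a(n) q^n on the upper half-plane
   (this encodes holomorphy at the cusp i*infinity). *)
Definition has_q_expansion (f : C -> C) (a : nat -> C) : Prop :=
  forall z : C, upper z -> is_series (fun n => (a n * Cpow (qpar z) n)%C) (f z).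

Definition modular_form_with_coeffs (k : nat) (f : C -> C) (a : nat -> C) : Prop :=
  holo_upper f /\ weight_invariant k f /\ has_q_expansion f a.

(* Main.v *)
(* Write [k = 4 q]. We compare [f] with [E4 ^ q], whose [n]-th coefficient is at least about
   [(240 * 6) ^ q n ^ (k - 1) / (k - 1)!], because that of [E4] is at least [240 n ^ 3]. The
   difference [g] is a cusp form, hence its [n]-th coefficient [b n] is [O (M n ^ (k / 2))]
   with [M] the supremum of [y ^ (k / 2) |g (x + i y)|]. On a fundamental domain the terms
   [n >= q] of [g] contribute only a small multiple of [M], so [M] is controlled by the [b n]
   with [n < q]. As the [a n] are nonnegative up to [N = k ^ 2 (log k + log log k) ^ 2], these
   are controlled by [f (i y0) = y0 ^ (- k) f (i / y0)] for [y0] of order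
   [1 / (k (log k + log log k))]: so close to the real axis [f (i / y0)] is dominated by its
   constant term, while the terms [n > N] of [f (i y0)] are negligible. Inserting the resulting
   [M] gives [|b n|] smaller than the coefficient of [E4 ^ q] from the stated threshold on.

   The modularity of [E4] follows from Lipschitz' formula
   [Sum_m (z + m) ^ (-4) = (2 pi) ^ 4 / 3! Sum_n n ^ 3 q ^ n]. The right-hand side [P] satisfies
   [P z = Q ^ (-4) Sum_(j mod Q) P ((z + j) / Q)], as averaging over roots of unity shows; let
   [Q] tend to infinity and use the pole of [P] at [0]. *)

Require Import Defs.
From Stdlib Require Import Reals ZArith Arith Lra Lia.
From Coquelicot Require Import Coquelicot.
Open Scope R_scope.

(** * Complex series *)

(** The obstacle is circularity. Let [A] be the sum of [|b n| exp (- 2 pi n y0)] over [n < q]. Then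
    [M] is bounded in terms of [A], but the bound on [A] involves [f (i y1)] with [y1 = 1 / y0],
    hence [g] and again [M]. As [|b n| <= a n + e n], with [e n] the coefficient of [E4 ^ q],
    wherever [a n >= 0], summation gives [A <= 2.02 y1 ^ k + theta A] with [theta < 1 / 2], so the
    circle closes. For [theta] to be small, [y1 ^ k exp (- 2 pi y1)] must be small; this forces [y1]
    to be of order [k (log k + log log k)], since [exp (log k + log log k) = k log k]. The constant
    7316: by Stirling's bound the final comparison is between the [q]-th power of about
    [1434 (2 pi e) ^ 4 / 7316 ^ 2], which exceeds 2, and a factor polynomial in [k] up to
    logarithms. These estimates need [k >= 12]. In weights 4 and 8 the same contraction of [M] shows
    that there are no nonzero cusp forms, so [f] is a power of [E4]. Reality of all [a n] follows
    from that of the first [q], by comparing [f] with its complex conjugate form. *)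

Fixpoint csumn (u : nat -> C) (n : nat) : C :=
  match n with 0%nat => RtoC 0 | S m => (csumn u m + u m)%C end.

Definition clim (s : nat -> C) (l : C) : Prop :=
  forall eps : R, 0 < eps ->
    exists N : nat, forall n, (N <= n)%nat -> Cmod (s n - l)%C < eps.

Definition cseries (u : nat -> C) (l : C) : Prop := clim (csumn u) l.

Lemma Cmod_sub_sym (x y : C) : Cmod (x - y)%C = Cmod (y - x)%C.
Proof. rewrite <- Cmod_opp. f_equal. ring. Qed.

(** [csumn] runs over [i < n] and is empty at [0], whereas [sum_n] and [sum_f_R0] include the index
    [n]; hence the shift by one wherever they meet. *)
Lemma csumn_sum_n (u : nat -> C) (n : nat) :
  csumn u (S n) = sum_n (u : nat -> C_NormedModule) n.
Proof.
  induction n as [|n IH].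
  - rewrite sum_O. simpl. ring.
  - rewrite sum_Sn, <- IH. reflexivity.
Qed.

Lemma is_series_cseries (u : nat -> C) (l : C) :
  @is_series C_AbsRing C_NormedModule u l <-> cseries u l.
Proof.
  split.
  - intros H eps He.
    assert (H1 := proj1 (filterlim_locally_ball_norm _ _) H (mkposreal eps He)).
    destruct H1 as [N HN]. exists (S N). intros [|n] Hn; [lia|].
    rewrite csumn_sum_n. specialize (HN n ltac:(lia)). exact HN.
  - intros H. apply (proj2 (filterlim_locally_ball_norm _ _)). intros eps.
    destruct (H eps (cond_pos eps)) as [N HN]. exists N. intros n Hn.
    specialize (HN (S n) ltac:(lia)). rewrite csumn_sum_n in HN. exact HN.
Qed.

Lemma clim_unique (s : nat -> C) (l1 l2 : C) : clim s l1 -> clim s l2 -> l1 = l2.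
Proof.
  intros H1 H2. destruct (Ceq_dec l1 l2) as [E|E]; [exact E|exfalso].
  assert (Hp : 0 < Cmod (l1 - l2)).
  { apply Cmod_gt_0. intros H. apply E. replace l1 with (l1 - l2 + l2)%C by ring. rewrite H. ring. }
  destruct (H1 (Cmod (l1 - l2) / 2)) as [N1 HN1]; [lra|].
  destruct (H2 (Cmod (l1 - l2) / 2)) as [N2 HN2]; [lra|].
  specialize (HN1 (N1 + N2)%nat ltac:(lia)). specialize (HN2 (N1 + N2)%nat ltac:(lia)).
  assert (Ht := Cmod_triangle (l1 - s (N1 + N2)%nat) (s (N1 + N2)%nat - l2)).
  replace (l1 - s (N1 + N2)%nat + (s (N1 + N2)%nat - l2))%C with (l1 - l2)%C in Ht by ring.
  rewrite (Cmod_sub_sym l1 (s _)) in Ht. lra.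
Qed.

Lemma clim_ext (s t : nat -> C) (l : C) : (forall n, s n = t n) -> clim s l -> clim t l.
Proof.
  intros E H eps He. destruct (H eps He) as [N HN]. exists N. intros n Hn.
  rewrite <- E. auto.
Qed.

Lemma clim_plus (s t : nat -> C) (l m : C) :
  clim s l -> clim t m -> clim (fun n => s n + t n)%C (l + m)%C.
Proof.
  intros H1 H2 eps He. destruct (H1 (eps / 2)) as [N1 HN1]; [lra|].
  destruct (H2 (eps / 2)) as [N2 HN2]; [lra|].
  exists (N1 + N2)%nat. intros n Hn.
  specialize (HN1 n ltac:(lia)). specialize (HN2 n ltac:(lia)).
  replace (s n + t n - (l + m))%C with ((s n - l) + (t n - m))%C by ring.
  assert (Ht := Cmod_triangle (s n - l) (t n - m)). lra.
Qed.

Lemma clim_scal (c : C) (s : nat -> C) (l : C) :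
  clim s l -> clim (fun n => c * s n)%C (c * l)%C.
Proof.
  intros H eps He. assert (Hc := Cmod_ge_0 c).
  destruct (H (eps / (Cmod c + 1))) as [N HN].
  { apply Rdiv_lt_0_compat; lra. }
  exists N. intros n Hn. specialize (HN n Hn).
  replace (c * s n - c * l)%C with (c * (s n - l))%C by ring. rewrite Cmod_mult.
  assert (E : eps = eps / (Cmod c + 1) * (Cmod c + 1)) by (field; lra).
  assert (H0 := Cmod_ge_0 (s n - l)). nra.
Qed.

Lemma clim_mult (s t : nat -> C) (l m : C) :
  clim s l -> clim t m -> clim (fun n => s n * t n)%C (l * m)%C.
Proof.
  intros H1 H2 eps He.
  assert (Hm := Cmod_ge_0 m).
  assert (Hl := Cmod_ge_0 l).
  set (d := Rmin 1 (eps / (Cmod l + Cmod m + 2))).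
  assert (Hd : 0 < d).
  { apply Rmin_case; [lra|]. apply Rdiv_lt_0_compat; lra. }
  assert (Hd1 : d <= 1) by apply Rmin_l.
  assert (Hd2 : d * (Cmod l + Cmod m + 2) <= eps).
  { assert (E : d <= eps / (Cmod l + Cmod m + 2)) by apply Rmin_r.
    apply Rmult_le_compat_r with (r := Cmod l + Cmod m + 2) in E; [|lra].
    unfold Rdiv in E. rewrite Rmult_assoc, Rinv_l in E; lra. }
  destruct (H1 d Hd) as [N1 HN1]. destruct (H2 d Hd) as [N2 HN2].
  exists (N1 + N2)%nat. intros n Hn.
  specialize (HN1 n ltac:(lia)). specialize (HN2 n ltac:(lia)).
  replace (s n * t n - l * m)%C
    with ((s n - l) * (t n - m) + ((s n - l) * m + l * (t n - m)))%C by ring.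
  eapply Rle_lt_trans; [apply Cmod_triangle|].
  eapply Rle_lt_trans; [apply Rplus_le_compat_l, Cmod_triangle|].
  rewrite !Cmod_mult.
  assert (H3 := Cmod_ge_0 (s n - l)). assert (H4 := Cmod_ge_0 (t n - m)).
  nra.
Qed.

Lemma clim_const (c : C) : clim (fun _ => c) c.
Proof.
  intros eps He. exists 0%nat. intros. replace (c - c)%C with (RtoC 0) by ring.
  rewrite Cmod_0. lra.
Qed.

Lemma clim_pow (s : nat -> C) (l : C) (p : nat) :
  clim s l -> clim (fun n => Cpow (s n) p) (Cpow l p).
Proof.
  intros H. induction p as [|p IH]; simpl.
  - apply clim_const.
  - apply clim_mult; assumption.
Qed.

Lemma clim_eventually (s t : nat -> C) (l : C) (N : nat) :
  (forall n, (N <= n)%nat -> s n = t n) -> clim s l -> clim t l.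
Proof.
  intros E H eps He. destruct (H eps He) as [N1 HN]. exists (N + N1)%nat. intros n Hn.
  rewrite <- E by lia. apply HN. lia.
Qed.

Lemma clim_Cmod_le (s : nat -> C) (l : C) (B : R) :
  clim s l -> (forall n, Cmod (s n) <= B) -> Cmod l <= B.
Proof.
  intros H Hb. apply le_epsilon. intros eps He.
  destruct (H eps He) as [N HN]. specialize (HN N (le_n _)). specialize (Hb N).
  assert (Ht := Cmod_triangle (s N) (l - s N)).
  replace (s N + (l - s N))%C with l in Ht by ring.
  rewrite Cmod_sub_sym in HN. lra.
Qed.

Lemma csumn_ext (u v : nat -> C) (n : nat) :
  (forall i, (i < n)%nat -> u i = v i) -> csumn u n = csumn v n.
Proof.
  induction n as [|n IH]; simpl; intros H; [reflexivity|].
  rewrite IH by (intros; apply H; lia). rewrite H by lia. reflexivity.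
Qed.

Lemma csumn_plus (u v : nat -> C) (n : nat) :
  csumn (fun i => u i + v i)%C n = (csumn u n + csumn v n)%C.
Proof. induction n as [|n IH]; simpl; [ring|]. rewrite IH. ring. Qed.

Lemma csumn_scal (c : C) (u : nat -> C) (n : nat) :
  csumn (fun i => c * u i)%C n = (c * csumn u n)%C.
Proof. induction n as [|n IH]; simpl; [ring|]. rewrite IH. ring. Qed.

Lemma csumn_shift (u : nat -> C) (n : nat) :
  csumn u (S n) = (u 0%nat + csumn (fun i => u (S i)) n)%C.
Proof. induction n as [|n IH]; [simpl; ring|]. simpl in *. rewrite IH. ring. Qed.

Lemma cseries_unique (u : nat -> C) (l1 l2 : C) : cseries u l1 -> cseries u l2 -> l1 = l2.
Proof. apply clim_unique. Qed.

Lemma cseries_ext (u v : nat -> C) (l : C) :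
  (forall n, u n = v n) -> cseries u l -> cseries v l.
Proof. intros E. apply clim_ext. intros n. apply csumn_ext. auto. Qed.

Lemma cseries_plus (u v : nat -> C) (l m : C) :
  cseries u l -> cseries v m -> cseries (fun n => u n + v n)%C (l + m)%C.
Proof.
  intros H1 H2. apply clim_ext with (fun n => csumn u n + csumn v n)%C.
  - intros n. rewrite csumn_plus. reflexivity.
  - apply clim_plus; assumption.
Qed.

Lemma cseries_scal (c : C) (u : nat -> C) (l : C) :
  cseries u l -> cseries (fun n => c * u n)%C (c * l)%C.
Proof.
  intros H. apply clim_ext with (fun n => c * csumn u n)%C.
  - intros n. rewrite csumn_scal. reflexivity.
  - apply clim_scal; assumption.
Qed.

Lemma cseries_minus (u v : nat -> C) (l m : C) :
  cseries u l -> cseries v m -> cseries (fun n => u n - v n)%C (l - m)%C.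
Proof.
  intros H1 H2.
  apply cseries_ext with (fun n => u n + - RtoC 1 * v n)%C.
  - intros n. ring.
  - replace (l - m)%C with (l + - RtoC 1 * m)%C by ring.
    apply cseries_plus; [|apply cseries_scal]; assumption.
Qed.

Lemma cseries_csumn_finite (u : nat -> C) (N : nat) :
  (forall n, (N <= n)%nat -> u n = RtoC 0) -> cseries u (csumn u N).
Proof.
  intros H. apply clim_eventually with (s := fun _ => csumn u N) (N := N).
  - intros n Hn. induction Hn as [|n Hn IH]; [reflexivity|].
    simpl. rewrite <- IH, H by lia. ring.
  - apply clim_const.
Qed.

Lemma cseries_shift (u : nat -> C) (l : C) :
  cseries (fun n => u (S n)) l <-> cseries u (u 0%nat + l)%C.
Proof.
  split; intros H.
  - assert (H1 : clim (fun n => csumn u (S n)) (u 0%nat + l)%C).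
    { apply clim_ext with (fun n => u 0%nat + csumn (fun i => u (S i)) n)%C.
      - intros n. rewrite csumn_shift. reflexivity.
      - apply clim_plus; [apply clim_const|exact H]. }
    intros eps He. destruct (H1 eps He) as [N HN]. exists (S N).
    intros [|n] Hn; [lia|]. apply HN. lia.
  - apply clim_ext with (fun n => - u 0%nat + csumn u (S n))%C.
    + intros n. rewrite csumn_shift. ring.
    + replace l with (- u 0%nat + (u 0%nat + l))%C by ring.
      apply clim_plus; [apply clim_const|].
      intros eps He. destruct (H eps He) as [N HN]. exists N. intros n Hn. apply HN. lia.
Qed.

Lemma Cmod_csumn_le (u : nat -> C) (v : nat -> R) (n : nat) :
  (forall i, Cmod (u i) <= v i) -> Cmod (csumn u (S n)) <= sum_f_R0 v n.
Proof.
  intros H. induction n as [|n IH].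
  - simpl. replace (RtoC 0 + u 0%nat)%C with (u 0%nat) by ring. apply H.
  - change (csumn u (S (S n))) with (csumn u (S n) + u (S n))%C.
    rewrite tech5. eapply Rle_trans; [apply Cmod_triangle|].
    specialize (H (S n)). lra.
Qed.

Lemma sum_le_Series (v : nat -> R) (n : nat) :
  (forall i, 0 <= v i) -> ex_series v -> sum_f_R0 v n <= Series v.
Proof.
  intros Hp Hv. rewrite (Series_incr_n v (S n)) by (try lia; exact Hv).
  simpl pred.
  assert (0 <= Series (fun k => v (S n + k)%nat)).
  { rewrite <- (Rmult_0_l (Series (fun _ => 0))), <- Series_scal_l.
    rewrite (Series_ext _ (fun _ => 0)) by (intros; ring).
    apply Series_le; [intros; split; [lra|apply Hp]|].
    apply ex_series_incr_n; exact Hv. }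
  lra.
Qed.

Lemma cseries_Cmod_le (u : nat -> C) (v : nat -> R) (l : C) :
  cseries u l -> ex_series v -> (forall i, Cmod (u i) <= v i) -> Cmod l <= Series v.
Proof.
  intros H Hv Hb.
  assert (Hp : forall i, 0 <= v i).
  { intros i. eapply Rle_trans; [apply Cmod_ge_0|apply Hb]. }
  apply clim_Cmod_le with (csumn u); [exact H|].
  intros [|n].
  - simpl. rewrite Cmod_0. eapply Rle_trans; [|apply (sum_le_Series v 0 Hp Hv)]. simpl. apply Hp.
  - eapply Rle_trans; [apply Cmod_csumn_le, Hb|]. apply sum_le_Series; assumption.
Qed.

Lemma cseries_dominated (u : nat -> C) (v : nat -> R) :
  ex_series v -> (forall i, Cmod (u i) <= v i) -> exists l, cseries u l.
Proof.
  intros Hv Hb.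
  assert (H : @ex_series C_AbsRing C_CompleteNormedModule u).
  { apply (@ex_series_le C_AbsRing C_CompleteNormedModule u v); [|exact Hv].
    exact Hb. }
  destruct H as [l Hl]. exists l. apply is_series_cseries. exact Hl.
Qed.

Lemma cseries_term_lim (u : nat -> C) (l : C) : cseries u l -> clim u (RtoC 0).
Proof.
  intros H.
  apply clim_ext with (fun n => csumn u (S n) + - RtoC 1 * csumn u n)%C.
  - intros n. simpl. ring.
  - replace (RtoC 0) with (l + - RtoC 1 * l)%C by ring.
    apply clim_plus; [|apply clim_scal; exact H].
    intros eps He. destruct (H eps He) as [N HN]. exists N. intros n Hn. apply HN. lia.
Qed.

Lemma clim_bounded (s : nat -> C) (l : C) :
  clim s l -> exists B, 0 < B /\ forall n, Cmod (s n) <= B.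
Proof.
  intros H. destruct (H 1 Rlt_0_1) as [N HN].
  assert (Hf : exists B, forall n, (n < N)%nat -> Cmod (s n) <= B).
  { clear HN. induction N as [|N [B HB]].
    - exists 0. intros; lia.
    - exists (Rmax B (Cmod (s N))). intros n Hn.
      destruct (Nat.eq_dec n N) as [->|]; [apply Rmax_r|].
      eapply Rle_trans; [apply HB; lia|apply Rmax_l]. }
  destruct Hf as [B HB]. exists (Rmax B (Cmod l + 1)). split.
  - eapply Rlt_le_trans; [|apply Rmax_r]. assert (H1 := Cmod_ge_0 l). lra.
  - intros n. destruct (le_lt_dec N n) as [Hn|Hn].
    + eapply Rle_trans; [|apply Rmax_r]. specialize (HN n Hn).
      assert (Ht := Cmod_triangle (s n - l) l).
      replace (s n - l + l)%C with (s n) in Ht by ring. lra.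
    + eapply Rle_trans; [apply HB, Hn|apply Rmax_l].
Qed.

Lemma ex_series_Rmult (c : R) (v : nat -> R) :
  ex_series v -> ex_series (fun n => c * v n).
Proof. exact (@ex_series_scal_l R_AbsRing R_NormedModule c v). Qed.

Lemma ex_series_Rle (u v : nat -> R) :
  (forall n, Rabs (u n) <= v n) -> ex_series v -> ex_series u.
Proof. exact (@ex_series_le R_AbsRing R_CompleteNormedModule u v). Qed.

Lemma cseries_tail_small (v : nat -> R) (eps : R) :
  ex_series v -> (forall i, 0 <= v i) -> 0 < eps ->
  exists N, Series (fun k => v (N + k)%nat) < eps.
Proof.
  intros Hv Hp He.
  assert (H := Series_correct v Hv).
  assert (H1 := proj1 (filterlim_locally _ _) H (mkposreal eps He)).
  destruct H1 as [N HN]. exists (S N).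
  specialize (HN N (le_n _)).
  rewrite (Series_incr_n v (S N)) in HN by (try lia; exact Hv).
  simpl pred in HN. rewrite sum_n_Reals in HN.
  unfold ball in HN; simpl in HN; unfold AbsRing_ball, abs, minus, plus, opp in HN; simpl in HN.
  apply Rabs_def2 in HN. simpl in HN |- *. lra.
Qed.

(* Tannery's theorem. *)
Lemma cseries_dominated_lim (u : nat -> nat -> C) (v : nat -> C) (b : nat -> R)
  (s : nat -> C) :
  ex_series b -> (forall i j, Cmod (u i j) <= b j) ->
  (forall j, clim (fun i => u i j) (v j)) ->
  (forall i, cseries (u i) (s i)) ->
  exists l, cseries v l /\ clim s l.
Proof.
  intros Hb Hu Hv Hs.
  assert (Hvb : forall j, Cmod (v j) <= b j).
  { intros j. apply clim_Cmod_le with (fun i => u i j); [apply Hv|intros; apply Hu]. }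
  assert (Hb0 : forall j, 0 <= b j).
  { intros j. eapply Rle_trans; [apply Cmod_ge_0|apply Hvb]. }
  destruct (cseries_dominated v b Hb Hvb) as [l Hl].
  exists l. split; [exact Hl|].
  intros eps He.
  destruct (cseries_tail_small b (eps / 4) Hb Hb0) as [N HN]; [lra|].
  assert (Hpart : clim (fun i => csumn (u i) N) (csumn v N)).
  { clear HN. induction N as [|N IH]; simpl; [apply clim_const|].
    apply clim_plus; [exact IH|apply Hv]. }
  destruct (Hpart (eps / 2)) as [I HI]; [lra|].
  exists I. intros i Hi. specialize (HI i Hi).
  assert (Htail : forall w m, cseries w m -> (forall j, Cmod (w j) <= b j) ->
                    Cmod (m - csumn w N) <= Series (fun k => b (N + k)%nat)).
  { intros w m Hw Hwb.
    assert (Hsh : cseries (fun k => w (N + k)%nat) (m - csumn w N)%C).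
    { clear -Hw. revert w m Hw. induction N as [|N IH]; intros w m Hw.
      - simpl. replace (m - 0)%C with m by ring. exact Hw.
      - assert (H1 := IH (fun k => w (S k)) (m - w 0%nat)%C).
        rewrite csumn_shift. replace (m - (w 0%nat + csumn (fun i => w (S i)) N))%C
          with (m - w 0%nat - csumn (fun i => w (S i)) N)%C by ring.
        apply H1. apply cseries_shift. replace (w 0%nat + (m - w 0%nat))%C with m by ring.
        exact Hw. }
    apply cseries_Cmod_le with (1 := Hsh).
    - apply ex_series_incr_n; exact Hb.
    - intros; apply Hwb. }
  assert (T1 := Htail _ _ (Hs i) (Hu i)). assert (T2 := Htail _ _ Hl Hvb).
  replace (s i - l)%C with ((s i - csumn (u i) N) + ((csumn (u i) N - csumn v N)
     + (csumn v N - l)))%C by ring.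
  eapply Rle_lt_trans; [apply Cmod_triangle|].
  eapply Rle_lt_trans; [apply Rplus_le_compat_l, Cmod_triangle|].
  rewrite (Cmod_sub_sym (csumn v N)). lra.
Qed.

Lemma csumn_cseries_exchange (u : nat -> nat -> C) (s : nat -> C) (n : nat) :
  (forall i, cseries (u i) (s i)) ->
  cseries (fun j => csumn (fun i => u i j) n) (csumn s n).
Proof.
  intros H. induction n as [|n IH]; simpl.
  - apply (cseries_csumn_finite (fun _ => RtoC 0) 0). reflexivity.
  - apply cseries_plus; [exact IH|apply H].
Qed.

(** Tannery's theorem for the partial sums over [i], whose [j]-th terms are dominated by
    [Series a * b j]. Only majorants of product form are needed below. *)
Lemma cseries_fubini (u : nat -> nat -> C) (a b : nat -> R) (s t : nat -> C) :
  ex_series a -> ex_series b -> (forall i, 0 <= a i) -> (forall j, 0 <= b j) ->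
  (forall i j, Cmod (u i j) <= a i * b j) ->
  (forall i, cseries (u i) (s i)) -> (forall j, cseries (fun i => u i j) (t j)) ->
  exists l, cseries s l /\ cseries t l.
Proof.
  intros Ha Hb Ha0 Hb0 Hu Hs Ht.
  assert (HS : 0 <= Series a).
  { eapply Rle_trans; [|apply (sum_le_Series a 0 Ha0 Ha)]. apply Ha0. }
  destruct (cseries_dominated_lim (fun n j => csumn (fun i => u i j) n) t
    (fun j => Series a * b j) (csumn s)) as [l [H1 H2]].
  - apply (ex_series_scal_l (Series a) b), Hb.
  - intros [|n] j.
    + simpl. rewrite Cmod_0. apply Rmult_le_pos; auto.
    + eapply Rle_trans.
      * apply (Cmod_csumn_le _ (fun i => a i * b j)). intros; apply Hu.
      * rewrite <- (scal_sum a n (b j)), Rmult_comm. apply Rmult_le_compat_r; [apply Hb0|].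
        apply sum_le_Series; assumption.
  - exact Ht.
  - intros n. exact (csumn_cseries_exchange u s n Hs).
  - exists l. split; assumption.
Qed.

(** * Bounds for the exponential and the nome *)

Lemma exp_sum_n (t : R) (n : nat) : exp (t * INR n) = exp t ^ n.
Proof.
  induction n as [|n IH]; [simpl; rewrite Rmult_0_r; apply exp_0|].
  rewrite S_INR, Rmult_plus_distr_l, Rmult_1_r, exp_plus, IH. simpl. ring.
Qed.

Lemma exp_lt_1 (t : R) : t < 0 -> exp t < 1.
Proof. intros H. rewrite <- exp_0. apply exp_increasing, H. Qed.

Lemma exp_le (x y : R) : x <= y -> exp x <= exp y.
Proof. intros [H| ->]; [left; apply exp_increasing, H|right; reflexivity]. Qed.

Lemma is_series_exp (t : R) :
  0 < t -> is_series (fun n => exp (- t * INR n)) (/ (1 - exp (- t))).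
Proof.
  intros Ht. apply is_series_ext with (fun n => exp (- t) ^ n).
  - intros n. symmetry. apply exp_sum_n.
  - apply is_series_geom. rewrite Rabs_pos_eq by (left; apply exp_pos).
    apply exp_lt_1. lra.
Qed.

Lemma ex_series_exp (t : R) : 0 < t -> ex_series (fun n => exp (- t * INR n)).
Proof. intros Ht. eexists. apply is_series_exp, Ht. Qed.

(** The [p]-th power of [u <= exp (u - 1)] at [u = s x / p]. Equality at [x = p / s] matters: this
    is the height at which [y ^ p exp (- 2 pi y)] is largest. *)
Lemma pow_le_exp_sharp (p : nat) (s x : R) :
  0 < s -> 0 <= x -> x ^ p <= (INR p / s) ^ p * exp (s * x - INR p).
Proof.
  intros Hs Hx. destruct p as [|p].
  - simpl. rewrite Rmult_1_l. assert (H := exp_ineq1_le (s * x - 0)). nra.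
  - assert (Hp : 0 < INR (S p)) by (apply lt_0_INR; lia).
    replace (exp (s * x - INR (S p))) with (exp (s * x / INR (S p) - 1) ^ S p).
    + rewrite <- Rpow_mult_distr. apply pow_incr. split; [exact Hx|].
      assert (H := exp_ineq1_le (s * x / INR (S p) - 1)).
      apply Rle_trans with (INR (S p) / s * (s * x / INR (S p))).
      * right. field. lra.
      * apply Rmult_le_compat_l; [|lra]. apply Rlt_le, Rdiv_lt_0_compat; lra.
    + rewrite <- exp_sum_n. f_equal. field. lra.
Qed.

Lemma pow_le_exp (p : nat) (s x : R) :
  0 < s -> 0 <= x -> x ^ p <= (INR p / s) ^ p * exp (s * x).
Proof.
  intros Hs Hx. eapply Rle_trans; [apply (pow_le_exp_sharp p s x Hs Hx)|].
  assert (Hp := pos_INR p).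
  apply Rmult_le_compat_l.
  - apply pow_le, Rmult_le_pos; [exact Hp|]. left. apply Rinv_0_lt_compat, Hs.
  - apply exp_le. lra.
Qed.

Lemma ex_series_pow_exp (p : nat) (t : R) :
  0 < t -> ex_series (fun n => INR n ^ p * exp (- t * INR n)).
Proof.
  intros Ht.
  apply ex_series_Rle with
    (fun n => (INR p / (t / 2)) ^ p * exp (- (t / 2) * INR n)).
  - intros n. rewrite Rabs_pos_eq.
    + replace (- (t / 2) * INR n) with (t / 2 * INR n + - t * INR n) by field.
      rewrite exp_plus, <- Rmult_assoc. apply Rmult_le_compat_r; [left; apply exp_pos|].
      apply pow_le_exp; [lra|apply pos_INR].
    + apply Rmult_le_pos; [apply pow_le, pos_INR|left; apply exp_pos].
  - apply ex_series_Rmult, ex_series_exp. lra.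
Qed.

Lemma Cmod_qpar (z : C) : Cmod (qpar z) = exp (- (2 * PI * Im z)).
Proof.
  unfold qpar, Cmod; simpl.
  replace (-2 * PI * Im z) with (- (2 * PI * Im z)) by ring.
  set (r := exp _). set (t := 2 * PI * Re z).
  replace (r * cos t * (r * cos t * 1) + r * sin t * (r * sin t * 1))
    with (r * r * ((sin t)² + (cos t)²)) by (unfold Rsqr; ring).
  rewrite sin2_cos2, Rmult_1_r. apply sqrt_square. left. apply exp_pos.
Qed.

Lemma Cmod_qpar_pow (z : C) (n : nat) :
  Cmod (Cpow (qpar z) n) = exp (- (2 * PI * Im z) * INR n).
Proof. rewrite Cmod_pow, Cmod_qpar. symmetry. apply exp_sum_n. Qed.

Lemma qpar_plus (z w : C) : qpar (z + w)%C = (qpar z * qpar w)%C.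
Proof.
  destruct z as [x y], w as [x' y']. unfold qpar, Cmult, Cplus; simpl.
  replace (-2 * PI * (y + y')) with (-2 * PI * y + -2 * PI * y') by ring.
  replace (2 * PI * (x + x')) with (2 * PI * x + 2 * PI * x') by ring.
  rewrite exp_plus, cos_plus, sin_plus. f_equal; ring.
Qed.

Lemma qpar_0 : qpar (RtoC 0) = RtoC 1.
Proof.
  unfold qpar, RtoC; simpl. rewrite !Rmult_0_r, exp_0, cos_0, sin_0. f_equal; ring.
Qed.

Lemma qpar_mul_nat (n : nat) (z : C) : Cpow (qpar z) n = qpar (RtoC (INR n) * z)%C.
Proof.
  induction n as [|n IH].
  - simpl. replace (0 * z)%C with (RtoC 0) by ring. symmetry. apply qpar_0.
  - rewrite Cpow_S, IH, <- qpar_plus, S_INR, RtoC_plus. f_equal. ring.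
Qed.

Lemma qpar_nat (n : nat) : qpar (RtoC (INR n)) = RtoC 1.
Proof.
  unfold qpar, RtoC; simpl. rewrite Rmult_0_r, exp_0.
  replace (2 * PI * INR n) with (0 + 2 * INR n * PI) by ring.
  rewrite cos_period, sin_period, cos_0, sin_0. f_equal; ring.
Qed.

Lemma upper_scal (r : R) (z : C) : 0 < r -> upper z -> upper (RtoC r * z)%C.
Proof. unfold upper. destruct z as [x y]; simpl. intros. nra. Qed.

Lemma Im_scal (r : R) (z : C) : Im (RtoC r * z)%C = r * Im z.
Proof. destruct z; simpl. ring. Qed.

Lemma Re_scal (r : R) (z : C) : Re (RtoC r * z)%C = r * Re z.
Proof. destruct z; simpl. ring. Qed.

(** * The sum of cubes generating function *)

(** The effect on coefficients of multiplication by [1 - q]. *)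
Definition cdiff (b : nat -> C) (n : nat) : C :=
  match n with 0%nat => b 0%nat | S m => (b (S m) - b m)%C end.

Lemma cseries_cdiff (b : nat -> C) (q s : C) :
  cseries (fun n => b n * Cpow q n)%C s ->
  cseries (fun n => cdiff b n * Cpow q n)%C ((1 - q) * s)%C.
Proof.
  intros H.
  assert (H1 := proj1 (cseries_shift (fun n => match n with 0%nat => RtoC 0
      | S m => (q * (b m * Cpow q m))%C end) (q * s)%C) (cseries_scal q _ _ H)).
  simpl in H1.
  replace ((1 - q) * s)%C with (s - (0 + q * s))%C by ring.
  eapply cseries_ext; [|exact (cseries_minus _ _ _ _ H H1)].
  intros [|n]; simpl; ring.
Qed.

Definition cubes_gf (q : C) : C := (q * (1 + 4 * q + q * q) / Cpow (1 - q) 4)%C.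

Lemma Cmod_lt_1_neq (q : C) : Cmod q < 1 -> (1 - q)%C <> 0.
Proof.
  intros H E. assert (q = RtoC 1) by (replace q with (1 - (1 - q))%C by ring; rewrite E; ring).
  subst q. rewrite Cmod_1 in H. lra.
Qed.

Lemma Cmod_qpar_lt_1 (z : C) : upper z -> Cmod (qpar z) < 1.
Proof.
  intros H. rewrite Cmod_qpar. apply exp_lt_1. unfold upper in H.
  assert (H1 := PI_RGT_0). nra.
Qed.

Lemma Cmod_RtoC_nonneg (x : R) : 0 <= x -> Cmod (RtoC x) = x.
Proof. intros H. rewrite Cmod_R. apply Rabs_pos_eq, H. Qed.

(** Differencing the cubes four times leaves [0, 1, 4, 1] and then zeros, so [(1 - q) ^ 4] times the
    sum is the polynomial [q + 4 q ^ 2 + q ^ 3]. *)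
Lemma cubes_series (z : C) :
  upper z -> cseries (fun n => RtoC (INR n ^ 3) * Cpow (qpar z) n)%C (cubes_gf (qpar z)).
Proof.
  intros Hz. assert (Hq := Cmod_lt_1_neq _ (Cmod_qpar_lt_1 z Hz)).
  destruct (cseries_dominated (fun n => RtoC (INR n ^ 3) * Cpow (qpar z) n)%C
     (fun n => INR n ^ 3 * exp (- (2 * PI * Im z) * INR n))) as [s Hs].
  - apply ex_series_pow_exp. unfold upper in Hz. assert (H1 := PI_RGT_0). nra.
  - intros n. rewrite Cmod_mult, Cmod_qpar_pow, Cmod_RtoC_nonneg by apply pow_le, pos_INR.
    apply Rle_refl.
  - replace (cubes_gf (qpar z)) with s; [exact Hs|].
    assert (H4 := cseries_cdiff _ _ _ (cseries_cdiff _ _ _ (cseries_cdiff _ _ _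
                   (cseries_cdiff _ _ _ Hs)))).
    set (q := qpar z) in *.
    assert (Hfin : forall n, (4 <= n)%nat ->
      (cdiff (cdiff (cdiff (cdiff (fun n0 => RtoC (INR n0 ^ 3))))) n * q ^ n)%C = RtoC 0).
    { intros [|[|[|[|n]]]] Hn; try lia.
      unfold cdiff. destruct n as [|n].
      - simpl. repeat rewrite ?RtoC_mult, ?RtoC_plus. ring.
      - rewrite !S_INR. repeat rewrite ?RtoC_pow, ?RtoC_plus. ring. }
    assert (E := cseries_unique _ _ _ H4 (cseries_csumn_finite _ 4 Hfin)).
    simpl in E. repeat rewrite ?RtoC_mult, ?RtoC_plus in E.
    unfold cubes_gf. apply (f_equal (fun x => x / Cpow (1 - q) 4)%C) in E.
    assert (Hq4 := Cpow_nz _ 4 Hq).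
    replace s with ((1 - q) * ((1 - q) * ((1 - q) * ((1 - q) * s))) / (1 - q) ^ 4)%C
      by (field; exact Hq).
    rewrite E. f_equal. ring.
Qed.

(** * Averaging over roots of unity *)

Lemma qpar_real (x : R) : qpar (RtoC x) = (cos (2 * PI * x), sin (2 * PI * x)).
Proof. unfold qpar, RtoC; simpl. rewrite Rmult_0_r, exp_0. f_equal; ring. Qed.

Lemma qpar_real_sym (x : R) : (qpar (RtoC x) + qpar (RtoC (- x)))%C = RtoC (2 * cos (2 * PI * x)).
Proof.
  rewrite !qpar_real. unfold Cplus, RtoC; simpl.
  replace (2 * PI * - x) with (- (2 * PI * x)) by ring.
  rewrite cos_neg, sin_neg. f_equal; ring.
Qed.

(** Telescoping: [2 sin (t / 2) cos (j t)] is a difference of sines at consecutive half-integral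
    multiples of [t]. *)
Lemma dirichlet_kernel (t : R) (m : nat) :
  (RtoC (sin (t / 2)) * (1 + csumn (fun j => RtoC (2 * cos (INR (S j) * t))) m))%C
  = RtoC (sin ((2 * INR m + 1) * (t / 2))).
Proof.
  induction m as [|m IH].
  - simpl. replace ((2 * 0 + 1) * (t / 2)) with (t / 2) by field. ring.
  - cbn [csumn]. rewrite Cplus_assoc, Cmult_plus_distr_l, IH.
    rewrite <- RtoC_mult, <- RtoC_plus. f_equal. rewrite S_INR.
    replace ((2 * (INR m + 1) + 1) * (t / 2)) with ((INR m + 1) * t + t / 2) by field.
    replace ((2 * INR m + 1) * (t / 2)) with ((INR m + 1) * t - t / 2) by field.
    rewrite sin_plus, sin_minus. ring.
Qed.

(* The sum of the [p]-th powers of the [(2 m + 1)]-th roots of unity, with the roots paired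
   symmetrically around 1. *)
Definition root_sum (m : nat) (p : Z) : C :=
  (1 + csumn (fun j => qpar (RtoC (IZR p * INR (S j) / (2 * INR m + 1)))
                     + qpar (RtoC (- (IZR p * INR (S j) / (2 * INR m + 1)))))%C m)%C.

Lemma root_sum_cos (m : nat) (p : Z) :
  root_sum m p =
  (1 + csumn (fun j => RtoC (2 * cos (INR (S j) * (2 * PI * (IZR p / (2 * INR m + 1)))))) m)%C.
Proof.
  assert (H := pos_INR m).
  unfold root_sum. f_equal. apply csumn_ext. intros j _. rewrite qpar_real_sym.
  do 3 f_equal. field. lra.
Qed.

Lemma cos_2PI_Z (x : R) (p : Z) : cos (x + 2 * IZR p * PI) = cos x.
Proof.
  assert (Hn : forall y (n : nat), cos (y + 2 * INR n * PI) = cos y) by (intros; apply cos_period).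
  destruct (Z_le_gt_dec 0 p) as [H|H].
  - rewrite <- (Z2Nat.id p H), <- INR_IZR_INZ. apply Hn.
  - rewrite <- (Hn (x + 2 * IZR p * PI) (Z.to_nat (- p))), INR_IZR_INZ, Z2Nat.id by lia.
    rewrite opp_IZR. f_equal. ring.
Qed.

(** With [r] the residue of [p] modulo [Q = 2 m + 1] and [t = 2 pi r / Q], the Dirichlet kernel has
    numerator [sin (r pi) = 0], while [sin (t / 2)] vanishes only for [r = 0]. *)
Lemma root_sum_eq (m : nat) (p : Z) :
  root_sum m p = if Z.eq_dec (p mod (2 * Z.of_nat m + 1)) 0 then RtoC (2 * INR m + 1) else RtoC 0.
Proof.
  set (Q := (2 * Z.of_nat m + 1)%Z).
  assert (HQ : IZR Q = 2 * INR m + 1).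
  { unfold Q. rewrite plus_IZR, mult_IZR, <- INR_IZR_INZ. reflexivity. }
  assert (HQ0 : 0 < IZR Q) by (rewrite HQ; assert (H := pos_INR m); lra).
  rewrite root_sum_cos, <- HQ.
  set (r := (p mod Q)%Z).
  assert (Hp : p = (Q * (p / Q) + r)%Z) by (apply Z.div_mod; unfold Q; lia).
  assert (Hr : (0 <= r < Q)%Z) by (apply Z.mod_pos_bound; unfold Q; lia).
  set (t := 2 * PI * (IZR r / IZR Q)).
  assert (E : forall j, cos (INR (S j) * (2 * PI * (IZR p / IZR Q))) = cos (INR (S j) * t)).
  { intros j. rewrite <- (cos_2PI_Z (INR (S j) * t) (Z.of_nat (S j) * (p / Q))%Z).
    f_equal. rewrite Hp at 1. unfold t. rewrite plus_IZR, !mult_IZR, <- INR_IZR_INZ. field. lra. }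
  rewrite (csumn_ext _ (fun j => RtoC (2 * cos (INR (S j) * t)))) by (intros; rewrite E; reflexivity).
  destruct (Z.eq_dec r 0) as [H0|H0].
  - rewrite HQ. clear E. induction m as [|m IH].
    + simpl. unfold RtoC, Cplus; simpl. f_equal; ring.
    + assert (Ht : t = 0). { unfold t. rewrite H0. unfold Rdiv. ring. }
      clear IH. rewrite Ht. clear.
      assert (G : forall n, csumn (fun j => RtoC (2 * cos (INR (S j) * 0))) n = RtoC (2 * INR n)).
      { induction n as [|n IH]; [simpl; f_equal; ring|].
        cbn [csumn]. rewrite IH, Rmult_0_r, cos_0, <- RtoC_plus, S_INR. f_equal. ring. }
      rewrite G, <- RtoC_plus. f_equal. ring.
  - assert (Hs : sin (t / 2) <> 0).
    { apply Rgt_not_eq. assert (HP := PI_RGT_0).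
      replace (t / 2) with (PI * (IZR r / IZR Q)) by (unfold t; field; lra).
      assert (Hr0 : 0 < IZR r / IZR Q) by (apply Rdiv_lt_0_compat; [apply IZR_lt; lia|lra]).
      assert (Hr1 : IZR r / IZR Q < 1).
      { apply Rmult_lt_reg_r with (IZR Q); [lra|]. unfold Rdiv. rewrite Rmult_assoc, Rinv_l by lra.
        rewrite Rmult_1_l, Rmult_1_r. apply IZR_lt. lia. }
      apply sin_gt_0; nra. }
    assert (Hk := dirichlet_kernel t m).
    replace ((2 * INR m + 1) * (t / 2)) with (IZR r * PI) in Hk.
    2:{ rewrite <- HQ. unfold t. field. lra. }
    rewrite (sin_eq_0_1 (IZR r * PI)) in Hk by (exists r; reflexivity).
    assert (Hs' : RtoC (sin (t / 2)) <> RtoC 0) by (intros H; apply RtoC_inj in H; tauto).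
    set (X := (1 + _)%C) in *.
    replace X with (/ RtoC (sin (t / 2)) * (RtoC (sin (t / 2)) * X))%C by (field; exact Hs').
    rewrite Hk. ring.
Qed.

Lemma clim_subseq (s : nat -> C) (l : C) (phi : nat -> nat) :
  (forall n, (n <= phi n)%nat) -> clim s l -> clim (fun n => s (phi n)) l.
Proof.
  intros Hp H eps He. destruct (H eps He) as [N HN]. exists N. intros n Hn. apply HN.
  specialize (Hp n). lia.
Qed.

Lemma cseries_multiples (u : nat -> C) (Q : nat) (l1 l2 : C) :
  (0 < Q)%nat -> (forall n, (n mod Q <> 0)%nat -> u n = RtoC 0) ->
  cseries u l1 -> cseries (fun n => u (Q * n)%nat) l2 -> l1 = l2.
Proof.
  intros HQ Hu H1 H2. apply clim_unique with (s := csumn (fun n => u (Q * n)%nat)); [|exact H2].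
  apply clim_ext with (fun n => csumn u (Q * n)).
  - induction n as [|n IH].
    + rewrite Nat.mul_0_r. reflexivity.
    + cbn [csumn]. rewrite <- IH. clear IH.
      destruct Q as [|Q]; [lia|].
      replace (S Q * S n)%nat with (S (S Q * n) + Q)%nat by lia.
      assert (G : forall r, (r <= Q)%nat -> csumn u (S (S Q * n) + r) = csumn u (S (S Q * n))).
      { induction r as [|r IH]; intros Hr; [rewrite Nat.add_0_r; reflexivity|].
        rewrite Nat.add_succ_r. cbn [csumn]. rewrite IH by lia.
        rewrite (Hu (S (S Q * n) + r)%nat).
        - cbn [csumn]. ring.
        - replace (S (S Q * n) + r)%nat with (S r + n * S Q)%nat by lia.
          rewrite Nat.Div0.mod_add. rewrite Nat.mod_small by lia. lia. }
      rewrite G by lia. reflexivity.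
  - apply clim_subseq with (phi := fun n => (Q * n)%nat); [|exact H1]. intros n. nia.
Qed.

Lemma qpar_pow_shift (z : C) (x : R) (n : nat) :
  Cpow (qpar (z + RtoC x)%C) n = (Cpow (qpar z) n * qpar (RtoC (INR n * x)))%C.
Proof. rewrite qpar_plus, Cpow_mult_l, (qpar_mul_nat n (RtoC x)), RtoC_mult. reflexivity. Qed.

(** Averaging translates against a character keeps the exponents congruent to [n0] modulo [2 m + 1].
    With [n0 = 0] this yields the distribution relation for the sum of cubes; with [n0] arbitrary
    and [m] tending to infinity it extracts a Fourier coefficient without integration. *)
Lemma cseries_root_average (b : nat -> C) (F : C -> C) (z : C) (m n0 : nat) :
  (forall w, upper w -> cseries (fun n => b n * Cpow (qpar w) n)%C (F w)) -> upper z ->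
  let x j := INR (S j) / (2 * INR m + 1) in
  cseries (fun n => b n * Cpow (qpar z) n * root_sum m (Z.of_nat n - Z.of_nat n0))%C
    (F z + csumn (fun j => qpar (RtoC (- (INR n0 * x j))) * F (z + RtoC (x j))
                         + qpar (RtoC (INR n0 * x j)) * F (z + RtoC (- x j))) m)%C.
Proof.
  intros HF Hz x.
  assert (Hup : forall r, upper (z + RtoC r)%C).
  { intros r. unfold upper in *. destruct z; simpl in *. lra. }
  assert (H := csumn_cseries_exchange _ _ m (fun j =>
    cseries_plus _ _ _ _
      (cseries_scal (qpar (RtoC (- (INR n0 * x j)))) _ _ (HF _ (Hup (x j))))
      (cseries_scal (qpar (RtoC (INR n0 * x j))) _ _ (HF _ (Hup (- x j)))))).
  cbv beta in H.
  eapply cseries_ext; [|exact (cseries_plus _ _ _ _ (HF z Hz) H)].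
  intros n. cbv beta. unfold root_sum.
  rewrite Cmult_plus_distr_l, Cmult_1_r. f_equal.
  rewrite <- csumn_scal. apply csumn_ext. intros j _.
  rewrite !qpar_pow_shift, minus_IZR, <- !INR_IZR_INZ.
  replace (RtoC ((INR n - INR n0) * INR (S j) / (2 * INR m + 1)))
    with (RtoC (INR n * x j) + RtoC (- (INR n0 * x j)))%C
    by (rewrite <- RtoC_plus; f_equal; unfold x, Rdiv; ring).
  replace (RtoC (- ((INR n - INR n0) * INR (S j) / (2 * INR m + 1))))
    with (RtoC (INR n * - x j) + RtoC (INR n0 * x j))%C
    by (rewrite <- RtoC_plus; f_equal; unfold x, Rdiv; ring).
  rewrite !qpar_plus. ring.
Qed.

(** Only exponents [Q n] survive, each with weight [Q], and [(Q n) ^ 3 Q = Q ^ 4 n ^ 3]. The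
    representatives run from [- m] to [m], so that the real parts of [(z + j) / Q] stay near
    [[-1/2, 1/2]], where [0] is the only pole to control. *)
Lemma cubes_distribution (z : C) (m : nat) :
  upper z ->
  let Q := 2 * INR m + 1 in
  (cubes_gf (qpar (RtoC (/ Q) * z)) +
   csumn (fun j => cubes_gf (qpar (RtoC (/ Q) * (z + RtoC (INR (S j)))))
                 + cubes_gf (qpar (RtoC (/ Q) * (z - RtoC (INR (S j)))))) m
   = RtoC (Q ^ 4) * cubes_gf (qpar z))%C.
Proof.
  intros Hz Q. assert (HQ : 0 < Q) by (unfold Q; assert (H := pos_INR m); lra).
  assert (Hz' : upper (RtoC (/ Q) * z)%C) by (apply upper_scal; [apply Rinv_0_lt_compat, HQ|exact Hz]).
  assert (HA := cseries_root_average _ (fun w => cubes_gf (qpar w)) _ m 0 cubes_series Hz').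
  cbv zeta beta in HA.
  assert (HQn : INR (2 * m + 1) = Q) by (unfold Q; rewrite plus_INR, mult_INR; simpl; ring).
  assert (E := fun H0 H1 => cseries_multiples _ (2 * m + 1) _ (RtoC (Q ^ 4) * cubes_gf (qpar z))%C H0 H1 HA).
  rewrite <- E.
  - f_equal. apply csumn_ext. intros j _.
    replace (RtoC (/ Q) * (z + RtoC (INR (S j))))%C
      with (RtoC (/ Q) * z + RtoC (INR (S j) / (2 * INR m + 1)))%C.
    2:{ unfold Rdiv. fold Q. rewrite RtoC_mult. ring. }
    replace (RtoC (/ Q) * (z - RtoC (INR (S j))))%C
      with (RtoC (/ Q) * z + RtoC (- (INR (S j) / (2 * INR m + 1))))%C.
    2:{ unfold Rdiv. fold Q. rewrite RtoC_opp, RtoC_mult. ring. }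
    change (INR 0) with 0. rewrite !Rmult_0_l, Ropp_0, qpar_0. rewrite !Cmult_1_l. reflexivity.
  - lia.
  - intros n Hn. rewrite root_sum_eq.
    destruct (Z.eq_dec _ 0) as [Hd|Hd]; [|ring].
    exfalso. apply Hn. rewrite Z.sub_0_r in Hd.
    apply Nat2Z.inj. rewrite Nat2Z.inj_mod, Nat2Z.inj_add, Nat2Z.inj_mul. exact Hd.
  - eapply cseries_ext; [|exact (cseries_scal (RtoC (Q ^ 4)) _ _ (cubes_series z Hz))].
    intros n. cbv beta.
    rewrite root_sum_eq. destruct (Z.eq_dec _ 0) as [Hd|Hd].
    2:{ exfalso. apply Hd. rewrite Z.sub_0_r, Nat2Z.inj_mul, Z.mul_comm.
        replace (Z.of_nat (2 * m + 1)) with (2 * Z.of_nat m + 1)%Z by lia. apply Z.mod_mul. lia. }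
    fold Q. rewrite Cpow_mult_r, (qpar_mul_nat (2 * m + 1)), HQn.
    replace (RtoC Q * (RtoC (/ Q) * z))%C with z.
    2:{ rewrite Cmult_assoc, <- RtoC_mult, Rinv_r by lra. ring. }
    rewrite mult_INR, HQn.
    replace (RtoC ((Q * INR n) ^ 3) * qpar z ^ n * RtoC Q)%C
      with (RtoC ((Q * INR n) ^ 3) * RtoC Q * qpar z ^ n)%C by ring.
    rewrite <- RtoC_mult. rewrite Cmult_assoc, <- RtoC_mult. do 2 f_equal. ring.
Qed.

(** * Telescoping series and bounds for zeta(4) *)

Lemma is_series_telescope (g : nat -> R) :
  is_lim_seq g 0 -> is_series (fun n => g n - g (S n)) (g 0%nat).
Proof.
  intros H. change (is_lim_seq (sum_n (fun n => g n - g (S n))) (g 0%nat)).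
  apply is_lim_seq_ext with (fun n => g 0%nat - g (S n)).
  - induction n as [|n IH]; [rewrite sum_O; reflexivity|].
    rewrite sum_Sn, <- IH. unfold plus; simpl. ring.
  - replace (Finite (g 0%nat)) with (Finite (g 0%nat - 0)) by (f_equal; ring).
    apply is_lim_seq_minus'; [apply is_lim_seq_const|]. apply is_lim_seq_incr_1 in H. exact H.
Qed.

Lemma is_lim_seq_inv_INR (p : nat) (c : R) : 0 <= c ->
  is_lim_seq (fun n => c * / (INR n + 1 + INR p)) 0.
Proof.
  intros Hc. replace (Finite 0) with (Rbar_mult c 0) by (simpl; f_equal; ring).
  apply is_lim_seq_scal_l.
  apply is_lim_seq_le_le_loc with (fun _ => 0) (fun n => / INR n).
  - exists 1%nat. intros n Hn. assert (0 < INR n) by (apply lt_0_INR; lia).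
    assert (H1 := pos_INR p). split.
    + left. apply Rinv_0_lt_compat. lra.
    + apply Rinv_le_contravar; lra.
  - apply is_lim_seq_const.
  - apply (is_lim_seq_inv INR p_infty); [apply is_lim_seq_INR|discriminate].
Qed.

Lemma ex_series_inv_sqr : ex_series (fun j => / INR (S j) ^ 2).
Proof.
  apply ex_series_Rle with (fun j => 2 * (/ (INR j + 1 + INR 0) - / (INR (S j) + 1 + INR 0))).
  - intros j. rewrite S_INR. simpl INR. rewrite !Rplus_0_r. assert (H := pos_INR j).
    rewrite Rabs_pos_eq.
    + replace (2 * (/ (INR j + 1) - / (INR j + 1 + 1)))
        with (2 / ((INR j + 1) * (INR j + 1 + 1))) by (field; lra).
      apply Rmult_le_reg_r with ((INR j + 1) ^ 2 * ((INR j + 1) * (INR j + 1 + 1))); [nra|].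
      unfold Rdiv. field_simplify; try lra. nra.
    + left. apply Rinv_0_lt_compat. nra.
  - apply ex_series_Rmult. eexists.
    apply (is_series_telescope (fun j => / (INR j + 1 + INR 0))).
    apply is_lim_seq_ext with (fun n => 1 * / (INR n + 1 + INR 0)).
    + intros; ring.
    + apply is_lim_seq_inv_INR; lra.
Qed.

Definition zeta4 : R := Series (fun j => / INR (S j) ^ 4).

Lemma inv_pow4_le_sqr (j : nat) : 0 <= / INR (S j) ^ 4 <= / INR (S j) ^ 2.
Proof.
  rewrite S_INR. assert (H := pos_INR j). split.
  - left. apply Rinv_0_lt_compat. apply pow_lt. lra.
  - apply Rinv_le_contravar; [apply pow_lt; lra|]. apply Rle_pow; [lra|lia].
Qed.

Lemma ex_series_inv_pow4 : ex_series (fun j => / INR (S j) ^ 4).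
Proof.
  apply ex_series_Rle with (fun j => / INR (S j) ^ 2).
  - intros j. assert (H := inv_pow4_le_sqr j). rewrite Rabs_pos_eq; lra.
  - apply ex_series_inv_sqr.
Qed.

Lemma zeta4_ge : 1 <= zeta4.
Proof.
  unfold zeta4. eapply Rle_trans; [|apply (sum_le_Series _ 0)].
  - simpl. lra.
  - intros j. apply inv_pow4_le_sqr.
  - apply ex_series_inv_pow4.
Qed.

(** Four terms are taken exactly; the rest is compared with the differences of [1 / (3 x ^ 3)],
    which telescope to [1 / 192]. *)
Lemma zeta4_le : zeta4 <= 1.084.
Proof.
  unfold zeta4. rewrite (Series_incr_n _ 4) by (try lia; apply ex_series_inv_pow4).
  simpl pred.
  assert (Hlim : is_lim_seq (fun k => / (3 * (INR k + 4) ^ 3)) 0).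
  { apply is_lim_seq_le_le with (fun _ => 0) (fun n => 1 * / (INR n + 1 + INR 3)).
    * intros n. assert (H := pos_INR n). split.
      -- left. apply Rinv_0_lt_compat. apply Rmult_lt_0_compat; [lra|apply pow_lt; lra].
      -- rewrite Rmult_1_l. replace (INR n + 1 + INR 3) with (INR n + 4) by (simpl; ring).
         apply Rinv_le_contravar; [lra|].
         assert (INR n + 4 <= (INR n + 4) ^ 3) by (rewrite <- (pow_1 (INR n + 4)) at 1; apply Rle_pow; [lra|lia]).
         lra.
    * apply is_lim_seq_const.
    * apply is_lim_seq_inv_INR; lra. }
  assert (H : Series (fun k => / INR (S (4 + k)) ^ 4) <= 1 / 192).
  { rewrite <- (is_series_unique (fun k => / (3 * (INR k + 4) ^ 3) - / (3 * (INR (S k) + 4) ^ 3)) (1 / 192)).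
    - apply Series_le.
      + intros n. split; [apply inv_pow4_le_sqr|].
        rewrite !S_INR. replace (INR (4 + n)) with (INR n + 4) by (rewrite plus_INR; simpl; ring).
        assert (H := pos_INR n). set (x := INR n + 4).
        replace (INR n + 1 + 4) with (x + 1) by (unfold x; ring).
        assert (Hx : 4 <= x) by (unfold x; lra). clearbody x.
        replace (/ (3 * x ^ 3) - / (3 * (x + 1) ^ 3)) with
          ((3 * x ^ 2 + 3 * x + 1) / (3 * x ^ 3 * (x + 1) ^ 3)) by (field; lra).
        apply Rmult_le_reg_r with ((x + 1) ^ 4 * (3 * x ^ 3)).
        { apply Rmult_lt_0_compat; [apply pow_lt; lra|]. apply Rmult_lt_0_compat; [lra|apply pow_lt; lra]. }
        replace (/ (x + 1) ^ 4 * ((x + 1) ^ 4 * (3 * x ^ 3))) with (3 * x ^ 3) by (field; lra).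
        replace ((3 * x ^ 2 + 3 * x + 1) / (3 * x ^ 3 * (x + 1) ^ 3) * ((x + 1) ^ 4 * (3 * x ^ 3)))
          with ((3 * x ^ 2 + 3 * x + 1) * (x + 1)) by (field; lra).
        nra.
      + eexists. apply (is_series_telescope (fun k => / (3 * (INR k + 4) ^ 3))).
        exact Hlim.
    - replace (1 / 192) with (/ (3 * (INR 0 + 4) ^ 3)) by (simpl; field).
      apply (is_series_telescope (fun k => / (3 * (INR k + 4) ^ 3))).
      exact Hlim. }
  simpl sum_f_R0. simpl INR in *. simpl INR. lra.
Qed.

(** * Lipschitz' formula in weight four *)

Lemma Cmod_sqr (z : C) : Cmod z ^ 2 = Re z ^ 2 + Im z ^ 2.
Proof. apply Cmod2_alt. Qed.

(** Determinant over trace of the Gram matrix of [(c, d) |-> |c z + d| ^ 2]: a positive lower bound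
    for its smaller eigenvalue. *)
Definition ellipticity (z : C) : R := Im z ^ 2 / (1 + Re z ^ 2 + Im z ^ 2).

Lemma ellipticity_pos (z : C) : upper z -> 0 < ellipticity z.
Proof. unfold upper, ellipticity. intros H. apply Rdiv_lt_0_compat; nra. Qed.

(* With [M] the Gram matrix of [(c, d) |-> |c z + d|^2], Cayley-Hamilton gives
   [(tr M) <M v, v> - (det M) |v|^2 = |M v|^2]. *)
Lemma Cmod_linear_form_ge (z : C) (c d : R) :
  ellipticity z * (c ^ 2 + d ^ 2) <= Cmod (RtoC c * z + RtoC d)%C ^ 2.
Proof.
  rewrite Cmod_sqr. unfold ellipticity. destruct z as [x y]; simpl Re; simpl Im.
  assert (Ht : 0 < 1 + x ^ 2 + y ^ 2) by nra.
  apply Rmult_le_reg_l with (1 + x ^ 2 + y ^ 2); [exact Ht|].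
  replace ((1 + x ^ 2 + y ^ 2) * (y ^ 2 / (1 + x ^ 2 + y ^ 2) * (c ^ 2 + d ^ 2)))
    with (y ^ 2 * (c ^ 2 + d ^ 2)) by (field; lra).
  assert (H1 := pow2_ge_0 ((x ^ 2 + y ^ 2) * c + x * d)).
  assert (H2 := pow2_ge_0 (x * c + d)).
  match goal with |- _ <= ?r => replace r with
    (y ^ 2 * (c ^ 2 + d ^ 2) + (((x ^ 2 + y ^ 2) * c + x * d) ^ 2 + (x * c + d) ^ 2)) by ring end.
  lra.
Qed.

Lemma Cmod_one_minus_qpar_sqr (w : C) :
  Cmod (1 - qpar w)%C ^ 2 =
  (1 - exp (- (2 * PI * Im w))) ^ 2 + 4 * exp (- (2 * PI * Im w)) * sin (PI * Re w) ^ 2.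
Proof.
  rewrite Cmod_sqr. unfold qpar, Cminus, Cplus, Copp, RtoC; simpl Re; simpl Im.
  replace (-2 * PI * Im w) with (- (2 * PI * Im w)) by ring.
  replace (2 * PI * Re w) with (2 * (PI * Re w)) by ring.
  set (r := exp _). rewrite cos_2a_sin, sin_2a.
  set (s := sin _). assert (H : cos (PI * Re w) ^ 2 = 1 - s ^ 2).
  { assert (H := sin2_cos2 (PI * Re w)). unfold Rsqr in H. unfold s. lra. }
  replace ((0 + - (r * (2 * s * cos (PI * Re w)))) ^ 2) with (4 * r ^ 2 * s ^ 2 * cos (PI * Re w) ^ 2) by ring.
  rewrite H. ring.
Qed.

Lemma PI_bounds : 3.14 < PI < 3.15.
Proof.
  assert (H := PI_2_3_7_ineq 1). unfold tg_alt, PI_2_3_7_tg, Ratan_seq in H.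
  simpl in H. lra.
Qed.

Lemma Rle_sqr_inv (x y : R) : 0 <= y -> x ^ 2 <= y ^ 2 -> x <= y.
Proof. intros H1 H2. apply Rnot_lt_le. intros H. nra. Qed.

(** In the formula for [|1 - q| ^ 2] the term [(1 - r) ^ 2] controls [Im w] and the sine term
    controls [Re w], because [u <= sin (pi u)] for [0 <= u <= 3 / 5]. The strip is wider than
    [|Re w| <= 1 / 2] to leave room for [Re z] in [(z + j) / Q]. *)
Lemma Cmod_one_minus_qpar_ge (w : C) (Y : R) :
  0 < Im w <= Y -> Rabs (Re w) <= 3 / 5 ->
  exp (- (2 * PI * Y)) * Cmod w <= Cmod (1 - qpar w)%C.
Proof.
  intros Hv Hu. assert (HP := PI_bounds).
  set (rho := exp (- (2 * PI * Y))).
  assert (Hrho : 0 < rho) by apply exp_pos.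
  assert (HvP : 0 < PI * Im w <= PI * Y) by (split; [apply Rmult_lt_0_compat|apply Rmult_le_compat_l]; lra).
  assert (Hrho1 : rho < 1) by (apply exp_lt_1; lra).
  apply Rle_sqr_inv; [apply Cmod_ge_0|].
  rewrite Rpow_mult_distr, Cmod_one_minus_qpar_sqr, Cmod_sqr.
  set (r := exp (- (2 * PI * Im w))).
  assert (Hr : rho <= r) by (apply exp_le; lra).
  assert (Hr1 : r < 1) by (apply exp_lt_1; lra).
  assert (H1 : rho * Im w <= 1 - r).
  { assert (E : 1 = r * exp (2 * PI * Im w)).
    { unfold r. rewrite <- exp_plus. replace (- (2 * PI * Im w) + 2 * PI * Im w) with 0 by ring.
      symmetry. apply exp_0. }
    assert (E2 := exp_ineq1_le (2 * PI * Im w)).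
    assert (E3 : r * (1 + 2 * PI * Im w) <= 1) by
      (apply Rle_trans with (r * exp (2 * PI * Im w)); [apply Rmult_le_compat_l; [lra|exact E2]|lra]).
    assert (Im w <= 2 * PI * Im w) by nra.
    assert (rho * Im w <= r * (2 * PI * Im w)) by (apply Rmult_le_compat; lra). lra. }
  assert (H2 : Re w ^ 2 <= sin (PI * Re w) ^ 2).
  { assert (G : forall u, 0 <= u <= 3 / 5 -> u <= sin (PI * u)).
    { intros u Hu'. assert (Ha : 3.14 * u <= PI * u <= 3.15 * u) by
        (split; apply Rmult_le_compat_r; lra).
      assert (B := proj1 (pre_sin_bound (PI * u) 0 ltac:(lra) ltac:(lra))).
      unfold sin_approx, sin_term in B. simpl in B.
      set (a := PI * u) in *. clearbody a.
      assert (Hq : a * a <= 3.6) by nra.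
      assert (a * (a * a) <= a * 3.6) by (apply Rmult_le_compat_l; lra).
      lra. }
    unfold Rabs in Hu. destruct (Rcase_abs (Re w)) as [Hn|Hn].
    - assert (B := G (- Re w) ltac:(lra)). replace (PI * - Re w) with (- (PI * Re w)) in B by ring.
      rewrite sin_neg in B. nra.
    - assert (B := G (Re w) ltac:(lra)). nra. }
  assert (H3 : 0 <= rho * Im w) by nra.
  assert ((rho * Im w) ^ 2 <= (1 - r) ^ 2) by (apply pow_incr; lra).
  assert (rho ^ 2 * Re w ^ 2 <= 4 * r * sin (PI * Re w) ^ 2).
  { assert (0 <= Re w ^ 2) by apply pow2_ge_0. assert (rho ^ 2 <= r) by nra.
    apply Rle_trans with (r * sin (PI * Re w) ^ 2).
    - apply Rmult_le_compat; nra.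
    - assert (0 <= r * sin (PI * Re w) ^ 2) by nra. lra. }
  rewrite Rpow_mult_distr in H. lra.
Qed.

Lemma Cmod_cubes_gf_le (q : C) : Cmod q < 1 -> Cmod (cubes_gf q) <= 6 / Cmod (1 - q)%C ^ 4.
Proof.
  intros Hq. assert (H1 := Cmod_lt_1_neq q Hq). unfold cubes_gf.
  rewrite Cmod_div by (apply Cpow_nz, H1). rewrite Cmod_pow.
  apply Rmult_le_compat_r.
  - left. apply Rinv_0_lt_compat, pow_lt, Cmod_gt_0, H1.
  - rewrite Cmod_mult. assert (H0 := Cmod_ge_0 q).
    assert (Cmod (1 + 4 * q + q * q) <= 6).
    { eapply Rle_trans; [apply Cmod_triangle|].
      assert (T := Cmod_triangle 1 (4 * q)). rewrite !Cmod_mult in *.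
      rewrite Cmod_1 in T. rewrite (Cmod_RtoC_nonneg 4) in T by lra. nra. }
    assert (H2 := Cmod_ge_0 (1 + 4 * q + q * q)). nra.
Qed.

Lemma Cmod_cubes_gf_qpar_le (w : C) (Y : R) :
  0 < Im w <= Y -> Rabs (Re w) <= 3 / 5 ->
  Cmod (cubes_gf (qpar w)) <= 6 / (exp (- (2 * PI * Y)) * Cmod w) ^ 4.
Proof.
  intros Hv Hu.
  assert (Hw : 0 < Cmod w).
  { apply Cmod_gt_0. intros E. rewrite E in Hv. simpl in Hv. lra. }
  eapply Rle_trans; [apply Cmod_cubes_gf_le, Cmod_qpar_lt_1; unfold upper; lra|].
  assert (Hp : 0 < exp (- (2 * PI * Y)) * Cmod w) by (apply Rmult_lt_0_compat; [apply exp_pos|exact Hw]).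
  apply Rmult_le_compat_l; [lra|]. apply Rinv_le_contravar.
  - apply pow_lt, Hp.
  - apply pow_incr. split; [lra|]. apply Cmod_one_minus_qpar_ge; assumption.
Qed.

(** * The pole of the generating function at 0, and the limit of the distribution relation *)

Lemma clim_inv (s : nat -> C) (l : C) : l <> 0 -> clim s l -> clim (fun n => / s n)%C (/ l)%C.
Proof.
  intros Hl H. assert (Hl' : 0 < Cmod l) by (apply Cmod_gt_0; exact Hl).
  intros eps He.
  destruct (H (Rmin (Cmod l / 2) (eps * Cmod l ^ 2 / 2))) as [N HN].
  { apply Rmin_case; [lra|]. apply Rdiv_lt_0_compat; [|lra]. apply Rmult_lt_0_compat; [lra|apply pow_lt, Hl']. }
  exists N. intros n Hn. specialize (HN n Hn).
  assert (H1 : Cmod (s n - l) < Cmod l / 2) by (eapply Rlt_le_trans; [exact HN|apply Rmin_l]).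
  assert (H2 : Cmod (s n - l) < eps * Cmod l ^ 2 / 2) by (eapply Rlt_le_trans; [exact HN|apply Rmin_r]).
  assert (H3 : Cmod l / 2 < Cmod (s n)).
  { assert (T := Cmod_triangle (s n) (l - s n)). replace (s n + (l - s n))%C with l in T by ring.
    rewrite (Cmod_sub_sym l) in T. lra. }
  assert (Hs : s n <> RtoC 0) by (apply Cmod_gt_0; lra).
  replace (/ s n - / l)%C with ((l - s n) / (s n * l))%C by (field; split; assumption).
  rewrite Cmod_div by (apply Cmult_neq_0; assumption).
  rewrite Cmod_mult, Cmod_sub_sym.
  apply Rmult_lt_reg_r with (Cmod (s n) * Cmod l); [apply Rmult_lt_0_compat; lra|].
  unfold Rdiv. rewrite Rmult_assoc, Rinv_l by (apply Rgt_not_eq, Rmult_lt_0_compat; lra).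
  assert (0 < eps * Cmod l) by (apply Rmult_lt_0_compat; lra). nra.
Qed.

Lemma clim_components (s : nat -> C) (l : C) :
  is_lim_seq (fun n => Re (s n)) (Re l) -> is_lim_seq (fun n => Im (s n)) (Im l) -> clim s l.
Proof.
  intros H1 H2 eps He.
  apply is_lim_seq_spec in H1. apply is_lim_seq_spec in H2.
  destruct (H1 (mkposreal (eps / 2) ltac:(lra))) as [N1 HN1].
  destruct (H2 (mkposreal (eps / 2) ltac:(lra))) as [N2 HN2].
  exists (N1 + N2)%nat. intros n Hn.
  specialize (HN1 n ltac:(lia)). specialize (HN2 n ltac:(lia)). simpl in HN1, HN2.
  assert (E : Cmod (s n - l) ^ 2 < eps ^ 2).
  { rewrite Cmod_sqr. unfold Cminus. destruct (s n) as [a b], l as [c d]; simpl in *.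
    apply Rabs_def2 in HN1. apply Rabs_def2 in HN2. nra. }
  assert (H0 := Cmod_ge_0 (s n - l)). nra.
Qed.

Lemma is_lim_seq_difference_quotient (f : R -> R) (l : R) (h : nat -> R) :
  derivable_pt_lim f 0 l -> (forall n, 0 < h n) -> is_lim_seq h 0 ->
  is_lim_seq (fun n => (f (h n) - f 0) / h n) l.
Proof.
  intros Hf Hh Hl. apply is_lim_seq_spec. intros eps.
  destruct (Hf eps (cond_pos eps)) as [d Hd].
  apply is_lim_seq_spec in Hl. destruct (Hl d) as [N HN]. exists N. intros n Hn.
  specialize (HN n Hn). rewrite Rminus_0_r in HN.
  specialize (Hd (h n) (Rgt_not_eq _ _ (Hh n)) HN). rewrite Rplus_0_l in Hd. exact Hd.
Qed.

Lemma clim_qpar_quotient (w : C) (h : nat -> R) :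
  (forall n, 0 < h n) -> is_lim_seq h 0 ->
  clim (fun n => RtoC (/ h n) * (1 - qpar (RtoC (h n) * w)))%C (RtoC (-2 * PI) * Ci * w)%C.
Proof.
  intros Hh Hl. destruct w as [x y].
  apply clim_components.
  - set (g := fun t => - (exp (- (2 * PI * y) * t) * cos (2 * PI * x * t))).
    apply is_lim_seq_ext with (fun n => (g (h n) - g 0) / h n).
    + intros n. unfold g. simpl. rewrite !Rmult_0_r, exp_0, cos_0.
      replace (-2 * PI * (h n * y + 0 * x)) with (- (2 * PI * y) * h n) by ring.
      replace (2 * PI * (h n * x - 0 * y)) with (2 * PI * x * h n) by ring.
      assert (Hn := Hh n). field. lra.
    + apply (is_lim_seq_difference_quotient g); try assumption.
      apply is_derive_Reals. unfold g. auto_derive; [trivial|].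
      simpl. rewrite !Rmult_0_r, exp_0, cos_0, sin_0. ring.
  - set (g := fun t => - (exp (- (2 * PI * y) * t) * sin (2 * PI * x * t))).
    apply is_lim_seq_ext with (fun n => (g (h n) - g 0) / h n).
    + intros n. unfold g. simpl. rewrite !Rmult_0_r, exp_0, sin_0.
      replace (-2 * PI * (h n * y + 0 * x)) with (- (2 * PI * y) * h n) by ring.
      replace (2 * PI * (h n * x - 0 * y)) with (2 * PI * x * h n) by ring.
      assert (Hn := Hh n). field. lra.
    + apply (is_lim_seq_difference_quotient g); try assumption.
      apply is_derive_Reals. unfold g. auto_derive; [trivial|].
      simpl. rewrite !Rmult_0_r, exp_0, cos_0, sin_0. ring.
Qed.

(* [(2 pi)^4 / 3!] *)
Definition kappa4 : R := 8 * PI ^ 4 / 3.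

Lemma kappa4_pos : 0 < kappa4.
Proof. unfold kappa4. assert (H := PI_RGT_0). assert (0 < PI ^ 4) by (apply pow_lt; lra). lra. Qed.

Lemma upper_neq_0 (z : C) : upper z -> z <> RtoC 0.
Proof. intros H E. rewrite E in H. unfold upper in H. simpl in H. lra. Qed.

Lemma upper_plus_real (z : C) (x : R) : upper z -> upper (z + RtoC x)%C.
Proof. unfold upper. destruct z; simpl. lra. Qed.

Lemma Ci_pow4 : (Ci * Ci * Ci * Ci = RtoC 1)%C.
Proof. unfold Ci, Cmult, RtoC; simpl. f_equal; ring. Qed.

(** The numerator of [cubes_gf] tends to 6 and [((1 - q) / h) ^ 4] to
    [(- 2 pi i w) ^ 4 = 16 pi ^ 4 w ^ 4]; [kappa4] is the ratio that makes the limit exactly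
    [w ^ (- 4)]. *)
Lemma clim_cubes_gf_rescaled (w : C) (h : nat -> R) :
  upper w -> (forall n, 0 < h n) -> is_lim_seq h 0 ->
  clim (fun n => RtoC kappa4 * RtoC (h n ^ 4) * cubes_gf (qpar (RtoC (h n) * w)))%C
    (/ Cpow w 4)%C.
Proof.
  intros Hw Hh Hl.
  assert (Hw0 := upper_neq_0 w Hw).
  assert (HP := PI_RGT_0).
  assert (HPC : RtoC PI <> RtoC 0) by (intros E; apply RtoC_inj in E; lra).
  set (L := (RtoC (-2 * PI) * Ci * w)%C).
  assert (HL4 : Cpow L 4 = (RtoC (16 * PI ^ 4) * Cpow w 4)%C).
  { unfold L. rewrite !Cpow_mult_l. replace (Cpow Ci 4) with (RtoC 1).
    - rewrite Cmult_1_r. f_equal. rewrite <- RtoC_pow. f_equal. ring.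
    - simpl. rewrite Cmult_1_r. rewrite <- Ci_pow4. ring. }
  assert (HL : L <> RtoC 0).
  { intros E. apply (Cpow_nz w 4 Hw0).
    replace (Cpow w 4) with (/ RtoC (16 * PI ^ 4) * Cpow L 4)%C.
    - rewrite E. simpl. ring.
    - rewrite HL4. field. intros E2. apply RtoC_inj in E2.
      assert (0 < PI ^ 4) by (apply pow_lt; lra). lra. }
  assert (Hq := clim_qpar_quotient w h Hh Hl). fold L in Hq.
  assert (Hq1 : clim (fun n => qpar (RtoC (h n) * w)%C) (RtoC 1)).
  { assert (Hh0 : clim (fun n => RtoC (h n)) (RtoC 0)).
    { apply clim_components; simpl; [exact Hl|apply is_lim_seq_const]. }
    apply clim_ext with (fun n => 1 - RtoC (h n) * (RtoC (/ h n) * (1 - qpar (RtoC (h n) * w))))%C.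
    - intros n. assert (Hn := Hh n). rewrite Cmult_assoc, <- RtoC_mult, Rinv_r by lra. ring.
    - assert (H := clim_plus _ _ _ _ (clim_const 1) (clim_scal (- RtoC 1) _ _ (clim_mult _ _ _ _ Hh0 Hq))).
      replace (1 + - RtoC 1 * (0 * L))%C with (RtoC 1) in H by ring.
      eapply clim_ext; [|exact H]. intros n. cbv beta. ring. }
  assert (Hnum : clim (fun n => qpar (RtoC (h n) * w) * (1 + 4 * qpar (RtoC (h n) * w)
       + qpar (RtoC (h n) * w) * qpar (RtoC (h n) * w)))%C (RtoC 6)).
  { replace (RtoC 6) with (1 * (1 + 4 * 1 + 1 * 1))%C by ring.
    apply clim_mult; [exact Hq1|]. apply clim_plus.
    - apply clim_plus; [apply clim_const|apply clim_scal, Hq1].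
    - apply clim_mult; exact Hq1. }
  assert (Hden := clim_inv _ _ (Cpow_nz L 4 HL) (clim_pow _ _ 4 Hq)).
  assert (H := clim_scal (RtoC kappa4) _ _ (clim_mult _ _ _ _ Hnum Hden)).
  replace (/ w ^ 4)%C with (RtoC kappa4 * (6 * / L ^ 4))%C.
  - eapply clim_ext; [|exact H]. intros n. cbv beta. unfold cubes_gf.
    assert (Hn := Hh n).
    assert (Hn' : RtoC (h n) <> RtoC 0) by (intros E; apply RtoC_inj in E; lra).
    assert (H1 := Cmod_lt_1_neq _ (Cmod_qpar_lt_1 _ (upper_scal (h n) w Hn Hw))).
    set (q := qpar _) in *. rewrite RtoC_pow, RtoC_inv by lra. field. tauto.
  - rewrite HL4. unfold kappa4. rewrite RtoC_div by lra. rewrite !RtoC_mult.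
    assert (H4 : RtoC (PI ^ 4) <> RtoC 0).
    { intros E. apply RtoC_inj in E. assert (0 < PI ^ 4) by (apply pow_lt; lra). lra. }
    field. repeat split; try assumption; intros E; apply RtoC_inj in E; lra.
Qed.

Lemma Cmod_shift_ge (z : C) (x : R) :
  ellipticity z * x ^ 2 <= Cmod (z + RtoC x)%C ^ 2.
Proof.
  assert (H := Cmod_linear_form_ge z 1 x). rewrite Cmult_1_l in H.
  eapply Rle_trans; [|exact H].
  apply Rmult_le_compat_l; [|nra]. unfold ellipticity.
  apply Rmult_le_pos; [nra|]. left. apply Rinv_0_lt_compat. nra.
Qed.

(** Tannery's theorem for the distribution relation multiplied by [kappa4 / Q ^ 4]: each term tends
    to some [(z + x) ^ (- 4)] and is dominated by a multiple of [x ^ (- 4)] uniformly in [Q]. *)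
Lemma lipschitz4 (z : C) :
  upper z ->
  cseries (fun j => / Cpow (z + RtoC (INR (S j))) 4 + / Cpow (z - RtoC (INR (S j))) 4)%C
    (RtoC kappa4 * cubes_gf (qpar z) - / Cpow z 4)%C.
Proof.
  intros Hz. assert (HK := kappa4_pos). assert (Hd := ellipticity_pos z Hz).
  set (d := ellipticity z) in *.
  assert (Hy : 0 < Im z) by exact Hz.
  set (rho := exp (- (2 * PI * Im z))). assert (Hrho : 0 < rho) by apply exp_pos.
  (* For [m >= N] and [|x| <= m] this gives [|Re z| + |x| <= 6 m / 5 <= 3 Q / 5], the strip of the
     pole bound. *)
  destruct (INR_unbounded (5 * Rabs (Re z))) as [N HN].
  set (m := fun i => (i + N)%nat).
  set (Q := fun i => 2 * INR (m i) + 1).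
  assert (HQ : forall i, 1 <= Q i) by (intros i; unfold Q; assert (H := pos_INR (m i)); lra).
  set (h := fun i => / Q i).
  assert (Hh : forall i, 0 < h i) by (intros i; apply Rinv_0_lt_compat; specialize (HQ i); lra).
  assert (Hhl : is_lim_seq h 0).
  { apply is_lim_seq_le_le with (fun _ => 0) (fun n => 1 * / (INR n + 1 + INR 0)).
    - intros n. split; [left; apply Hh|]. rewrite Rmult_1_l.
      apply Rinv_le_contravar; [assert (H := pos_INR n); simpl; lra|].
      unfold Q, m. rewrite plus_INR. simpl. assert (H := pos_INR N). assert (H1 := pos_INR n). lra.
    - apply is_lim_seq_const.
    - apply is_lim_seq_inv_INR. lra. }
  set (T := fun (i j : nat) => if lt_dec j (m i) then
     (RtoC kappa4 * RtoC (h i ^ 4) * cubes_gf (qpar (RtoC (h i) * (z + RtoC (INR (S j)))))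
      + RtoC kappa4 * RtoC (h i ^ 4) * cubes_gf (qpar (RtoC (h i) * (z - RtoC (INR (S j))))))%C
     else RtoC 0).
  set (B := kappa4 * (6 / (rho ^ 4 * d ^ 2))).
  assert (HB : 0 < B).
  { apply Rmult_lt_0_compat; [exact HK|]. apply Rdiv_lt_0_compat; [lra|].
    apply Rmult_lt_0_compat; apply pow_lt; lra. }
  assert (Hsub : forall x, (z - RtoC x)%C = (z + RtoC (- x))%C).
  { intros x. rewrite RtoC_opp. reflexivity. }
  (* The pole bound at [h (z + x)] produces [h ^ (- 4)], which cancels the factor [h ^ 4]; the
     ellipticity then bounds [|z + x| ^ 4] below by [d ^ 2 x ^ 4]. *)
  assert (Hterm : forall i x, 1 <= Rabs x <= INR (m i) ->
    Cmod (RtoC kappa4 * RtoC (h i ^ 4) * cubes_gf (qpar (RtoC (h i) * (z + RtoC x))))%C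
      <= B * / Rabs x ^ 4).
  { intros i x Hx. assert (Hhi := Hh i). assert (HQi := HQ i).
    assert (HhQ : h i * Q i = 1) by (unfold h; field; lra).
    rewrite !Cmod_mult, !Cmod_RtoC_nonneg by (try apply pow_le; lra).
    assert (Hb : Cmod (cubes_gf (qpar (RtoC (h i) * (z + RtoC x)))) <=
                 6 / (rho * Cmod (RtoC (h i) * (z + RtoC x))%C) ^ 4).
    { apply Cmod_cubes_gf_qpar_le.
      - rewrite Im_scal. destruct z as [a b]; simpl in *. rewrite Rplus_0_r.
        split; [apply Rmult_lt_0_compat; lra|].
        assert (h i <= 1) by nra. nra.
      - rewrite Re_scal, Rabs_mult, (Rabs_pos_eq (h i)) by lra.
        assert (Rabs (Re (z + RtoC x)%C) <= Rabs (Re z) + Rabs x).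
        { destruct z; simpl. apply Rabs_triang. }
        assert (Rabs (Re (z + RtoC x)%C) <= 3 / 5 * Q i).
        { assert (INR N <= INR (m i)) by (apply le_INR; unfold m; lia). unfold Q. lra. }
        apply Rle_trans with (h i * (3 / 5 * Q i)); [apply Rmult_le_compat_l; lra|].
        replace (h i * (3 / 5 * Q i)) with (3 / 5 * (h i * Q i)) by ring. rewrite HhQ. lra. }
    rewrite Cmod_mult, Cmod_RtoC_nonneg in Hb by lra.
    assert (Hc := Cmod_shift_ge z x). fold d in Hc.
    assert (Hx2 : Rabs x ^ 2 = x ^ 2) by (rewrite RPow_abs; apply Rabs_pos_eq, pow2_ge_0).
    set (c := Cmod (z + RtoC x)) in *.
    assert (Hc0 : 0 < c).
    { apply Cmod_gt_0, upper_neq_0, upper_plus_real, Hz. }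
    assert (Hc4 : d ^ 2 * Rabs x ^ 4 <= c ^ 4).
    { replace (d ^ 2 * Rabs x ^ 4) with ((d * Rabs x ^ 2) ^ 2) by ring.
      replace (c ^ 4) with ((c ^ 2) ^ 2) by ring. apply pow_incr. rewrite Hx2. split; [|exact Hc].
      apply Rmult_le_pos; [lra|apply pow2_ge_0]. }
    assert (Hx4 : 0 < Rabs x ^ 4) by (apply pow_lt; lra).
    assert (Hr4 : 0 < rho ^ 4) by (apply pow_lt; lra).
    assert (Hd2 : 0 < d ^ 2) by (apply pow_lt; lra).
    assert (Hh4 : 0 < h i ^ 4) by (apply pow_lt; lra).
    apply Rle_trans with (kappa4 * h i ^ 4 * (6 / (rho * (h i * c)) ^ 4)).
    { apply Rmult_le_compat_l; [apply Rmult_le_pos; lra|exact Hb]. }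
    replace (kappa4 * h i ^ 4 * (6 / (rho * (h i * c)) ^ 4)) with (kappa4 * 6 * / rho ^ 4 * / c ^ 4)
      by (field; lra).
    unfold B. replace (kappa4 * (6 / (rho ^ 4 * d ^ 2)) * / Rabs x ^ 4) with
      (kappa4 * 6 * / rho ^ 4 * / (d ^ 2 * Rabs x ^ 4)) by (field; lra).
    apply Rmult_le_compat_l.
    - apply Rmult_le_pos; [lra|]. left. apply Rinv_0_lt_compat, Hr4.
    - apply Rinv_le_contravar; [apply Rmult_lt_0_compat; assumption|exact Hc4]. }
  assert (Hrabs : forall j, Rabs (INR (S j)) = INR (S j)) by (intros; apply Rabs_pos_eq, pos_INR).
  assert (Hge1 : forall j, 1 <= INR (S j)) by (intros j; rewrite S_INR; assert (H := pos_INR j); lra).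
  destruct (cseries_dominated_lim T
    (fun j => / Cpow (z + RtoC (INR (S j))) 4 + / Cpow (z - RtoC (INR (S j))) 4)%C
    (fun j => 2 * B * / INR (S j) ^ 4)
    (fun i => RtoC kappa4 * cubes_gf (qpar z) - RtoC kappa4 * RtoC (h i ^ 4) * cubes_gf (qpar (RtoC (h i) * z)))%C)
    as [l [H1 H2]].
  - apply ex_series_Rmult, ex_series_inv_pow4.
  - intros i j. unfold T. assert (0 < INR (S j) ^ 4) by (apply pow_lt; specialize (Hge1 j); lra).
    destruct (lt_dec j (m i)) as [Hj|Hj].
    + eapply Rle_trans; [apply Cmod_triangle|].
      assert (HSj : INR (S j) <= INR (m i)) by (apply le_INR; lia).
      assert (A1 := Hterm i (INR (S j))). assert (A2 := Hterm i (- INR (S j))).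
      rewrite Rabs_Ropp in A2. rewrite Hrabs in A1, A2. rewrite Hsub.
      specialize (A1 (conj (Hge1 j) HSj)). specialize (A2 (conj (Hge1 j) HSj)). lra.
    + rewrite Cmod_0. apply Rmult_le_pos; [lra|]. left. apply Rinv_0_lt_compat. assumption.
  - intros j. apply clim_eventually with
      (s := fun i => (RtoC kappa4 * RtoC (h i ^ 4) * cubes_gf (qpar (RtoC (h i) * (z + RtoC (INR (S j)))))
      + RtoC kappa4 * RtoC (h i ^ 4) * cubes_gf (qpar (RtoC (h i) * (z - RtoC (INR (S j))))))%C) (N := S j).
    + intros i Hi. unfold T. destruct (lt_dec j (m i)) as [Hj|Hj]; [reflexivity|].
      exfalso. apply Hj. unfold m. lia.
    + apply clim_plus.
      * apply clim_cubes_gf_rescaled; [apply upper_plus_real, Hz|exact Hh|exact Hhl].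
      * apply clim_cubes_gf_rescaled; [rewrite Hsub; apply upper_plus_real, Hz|exact Hh|exact Hhl].
  - intros i.
    assert (HD := cubes_distribution z (m i) Hz). cbv zeta in HD. fold (Q i) in HD. fold (h i) in HD.
    assert (HQi := HQ i).
    replace (RtoC kappa4 * cubes_gf (qpar z) - RtoC kappa4 * RtoC (h i ^ 4) * cubes_gf (qpar (RtoC (h i) * z)))%C
      with (csumn (T i) (m i)).
    + apply cseries_csumn_finite. intros n Hn. unfold T.
      destruct (lt_dec n (m i)); [lia|reflexivity].
    + rewrite (csumn_ext _ (fun j => RtoC kappa4 * RtoC (h i ^ 4) *
        (cubes_gf (qpar (RtoC (h i) * (z + RtoC (INR (S j)))))
                 + cubes_gf (qpar (RtoC (h i) * (z - RtoC (INR (S j)))))))%C).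
      * rewrite csumn_scal.
        replace (cubes_gf (qpar z)) with (RtoC (h i ^ 4) * (RtoC (Q i ^ 4) * cubes_gf (qpar z)))%C at 1.
        -- rewrite <- HD. ring.
        -- rewrite Cmult_assoc, <- RtoC_mult. replace (h i ^ 4 * Q i ^ 4) with 1 by (unfold h; field; lra).
           ring.
      * intros j Hj. unfold T. destruct (lt_dec j (m i)); [ring|lia].
  - replace (RtoC kappa4 * cubes_gf (qpar z) - / Cpow z 4)%C with l; [exact H1|].
    apply (clim_unique _ _ _ H2).
    assert (H3 := clim_plus _ _ _ _ (clim_const (RtoC kappa4 * cubes_gf (qpar z))%C)
       (clim_scal (- RtoC 1) _ _ (clim_cubes_gf_rescaled z h Hz Hh Hhl))).
    replace (RtoC kappa4 * cubes_gf (qpar z) - / Cpow z 4)%C with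
      (RtoC kappa4 * cubes_gf (qpar z) + - RtoC 1 * / Cpow z 4)%C by ring.
    eapply clim_ext; [|exact H3]. intros n. cbv beta. ring.
Qed.

(** * The Eisenstein series of weight four *)

(** The divisor [S i] contributes the cube of the complementary divisor, as in the double series of
    [n ^ 3 q ^ ((i + 1) n)] regrouped by exponent. *)
Definition divisor_cube (N i : nat) : R :=
  if Nat.eq_dec (N mod S i) 0 then INR (N / S i) ^ 3 else 0.

Definition sigma3 (N : nat) : R :=
  match N with 0%nat => 0 | S m => sum_f_R0 (divisor_cube N) m end.

Lemma csumn_RtoC (u : nat -> R) (n : nat) :
  csumn (fun i => RtoC (u i)) (S n) = RtoC (sum_f_R0 u n).
Proof.
  induction n as [|n IH]; [simpl; ring|].
  change (csumn (fun i => RtoC (u i)) (S (S n))) with (csumn (fun i => RtoC (u i)) (S n) + RtoC (u (S n)))%C.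
  rewrite IH, tech5, RtoC_plus. reflexivity.
Qed.

Lemma divisor_cube_nonneg (N i : nat) : 0 <= divisor_cube N i.
Proof. unfold divisor_cube. destruct (Nat.eq_dec _ _); [apply pow_le, pos_INR|lra]. Qed.

(** For [N = c (i + 1)] one has [c ^ 3 <= c ^ 5 (i + 1) ^ 3]. The bound is wasteful, but it is a
    product of a summable factor in [i] and a factor in [N] that the nome absorbs, as exchanging the
    sums requires. *)
Lemma divisor_cube_le (N i : nat) : divisor_cube N i <= / INR (S i) ^ 2 * INR N ^ 5.
Proof.
  unfold divisor_cube. assert (Hi : 0 < INR (S i)) by (apply lt_0_INR; lia).
  assert (Hi2 : 0 < / INR (S i) ^ 2) by (apply Rinv_0_lt_compat, pow_lt, Hi).
  assert (HN := pos_INR N).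
  destruct (Nat.eq_dec _ _) as [H|H].
  - apply Nat.Div0.mod_divides in H. destruct H as [c Hc]. subst N.
    rewrite Nat.mul_comm, Nat.div_mul by lia. rewrite mult_INR.
    assert (Hc := pos_INR c).
    replace (/ INR (S i) ^ 2 * (INR c * INR (S i)) ^ 5) with (INR c ^ 3 * (INR c ^ 2 * INR (S i) ^ 3))
      by (field; lra).
    assert (H3 : 0 <= INR c ^ 3) by (apply pow_le, Hc).
    destruct c as [|c]; [simpl; lra|].
    assert (1 <= INR (S c)) by (rewrite S_INR; assert (H := pos_INR c); lra).
    assert (1 <= INR (S i)) by (rewrite S_INR; assert (H0 := pos_INR i); lra).
    assert (1 <= INR (S c) ^ 2) by (apply pow_R1_Rle; lra).
    assert (1 <= INR (S i) ^ 3) by (apply pow_R1_Rle; lra).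
    assert (1 <= INR (S c) ^ 2 * INR (S i) ^ 3) by nra. nra.
  - apply Rmult_le_pos; [lra|apply pow_le, HN].
Qed.

Lemma sigma3_nonneg (N : nat) : 0 <= sigma3 N.
Proof.
  destruct N as [|m]; [simpl; lra|]. unfold sigma3. apply cond_pos_sum.
  intros; apply divisor_cube_nonneg.
Qed.

Lemma sigma3_ge (N : nat) : INR N ^ 3 <= sigma3 N.
Proof.
  destruct N as [|m]; [simpl; lra|]. unfold sigma3.
  replace (INR (S m) ^ 3) with (divisor_cube (S m) 0).
  - destruct m as [|m]; [simpl; lra|].
    rewrite decomp_sum by lia. simpl pred.
    assert (0 <= sum_f_R0 (fun i => divisor_cube (S (S m)) (S i)) m).
    { apply cond_pos_sum. intros; apply divisor_cube_nonneg. }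
    lra.
  - unfold divisor_cube. destruct (Nat.eq_dec _ _) as [H|H].
    + rewrite Nat.div_1_r. reflexivity.
    + exfalso. apply H. apply Nat.mod_1_r.
Qed.

Lemma Cinv_mul (x y : C) : x <> RtoC 0 -> y <> RtoC 0 -> (/ (x * y) = / x * / y)%C.
Proof. intros. field. split; assumption. Qed.

Lemma Cinv_pow4_scal (r : R) (z : C) :
  0 < r -> z <> RtoC 0 -> (/ Cpow (RtoC r * z) 4 = / Cpow z 4 * RtoC (/ r ^ 4))%C.
Proof.
  intros Hr Hz.
  assert (Hr' : RtoC r <> RtoC 0) by (intros E; apply RtoC_inj in E; lra).
  rewrite Cpow_mult_l, RtoC_inv, RtoC_pow by (apply Rgt_not_eq, pow_lt, Hr).
  rewrite Cinv_mul by (apply Cpow_nz; assumption). ring.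
Qed.

Lemma two_pi_Im_pos (z : C) : upper z -> 0 < 2 * PI * Im z.
Proof. unfold upper. intros H. assert (HP := PI_RGT_0). nra. Qed.

Lemma lambert_cubes (z : C) :
  upper z ->
  exists l, cseries (fun i => cubes_gf (qpar (RtoC (INR (S i)) * z))) l /\
            cseries (fun N => RtoC (sigma3 N) * Cpow (qpar z) N)%C l.
Proof.
  intros Hz. assert (Ht := two_pi_Im_pos z Hz).
  set (u := fun i N => (RtoC (divisor_cube N i) * Cpow (qpar z) N)%C).
  assert (Hb : ex_series (fun N => INR N ^ 5 * exp (- (2 * PI * Im z) * INR N)))
    by (apply ex_series_pow_exp, Ht).
  assert (Hu : forall i N, Cmod (u i N) <= / INR (S i) ^ 2 * (INR N ^ 5 * exp (- (2 * PI * Im z) * INR N))).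
  { intros i N. unfold u. rewrite Cmod_mult, Cmod_qpar_pow.
    rewrite Cmod_RtoC_nonneg by apply divisor_cube_nonneg.
    rewrite <- Rmult_assoc. apply Rmult_le_compat_r; [left; apply exp_pos|apply divisor_cube_le]. }
  apply (cseries_fubini u _ _ _ _ ex_series_inv_sqr Hb).
  - intros i. left. apply Rinv_0_lt_compat, pow_lt, lt_0_INR. lia.
  - intros j. apply Rmult_le_pos; [apply pow_le, pos_INR|left; apply exp_pos].
  - exact Hu.
  - intros i.
    destruct (cseries_dominated (u i) _ (ex_series_Rmult (/ INR (S i) ^ 2) _ Hb) (Hu i)) as [l Hl].
    replace (cubes_gf (qpar (RtoC (INR (S i)) * z))) with l; [exact Hl|].
    apply (cseries_multiples (u i) (S i) l _ (Nat.lt_0_succ i)) with (2 := Hl).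
    + intros n Hn. unfold u, divisor_cube. destruct (Nat.eq_dec _ _); [contradiction|ring].
    + eapply cseries_ext; [|apply cubes_series, upper_scal; [apply lt_0_INR; lia|exact Hz]].
      intros n. unfold u, divisor_cube. cbv beta.
      rewrite (Nat.mul_comm (S i) n), Nat.Div0.mod_mul, Nat.div_mul by lia.
      destruct (Nat.eq_dec 0 0) as [_|H]; [|contradiction].
      rewrite Nat.mul_comm, Cpow_mult_r, (qpar_mul_nat (S i)). reflexivity.
  - intros N. replace (RtoC (sigma3 N) * Cpow (qpar z) N)%C with (csumn (fun i => u i N) N).
    + apply cseries_csumn_finite. intros n Hn. unfold u.
      replace (divisor_cube N n) with 0; [ring|]. unfold divisor_cube.
      destruct N as [|N].
      * rewrite Nat.Div0.div_0_l. destruct (Nat.eq_dec _ _); simpl; ring.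
      * rewrite Nat.mod_small by lia. destruct (Nat.eq_dec _ _); [lia|ring].
    + destruct N as [|N]; [simpl; ring|].
      unfold u. unfold sigma3. rewrite <- csumn_RtoC.
      rewrite Cmult_comm, <- csumn_scal. apply csumn_ext. intros; ring.
Qed.

Lemma upper_neg_inv (z : C) : upper z -> upper (- / z)%C.
Proof.
  unfold upper. destruct z as [x y]. unfold Cinv, Copp; simpl. intros H.
  assert (0 < x * (x * 1) + y * (y * 1)) by nra.
  unfold Rdiv. rewrite Ropp_mult_distr_l_reverse, Ropp_involutive.
  apply Rmult_lt_0_compat; [exact H|]. apply Rinv_0_lt_compat. assumption.
Qed.

Lemma zeta4C_series : cseries (fun j => RtoC (/ INR (S j) ^ 4)) (RtoC zeta4).
Proof.
  assert (H := Series_correct _ ex_series_inv_pow4). fold zeta4 in H.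
  assert (G : clim (fun n => csumn (fun j => RtoC (/ INR (S j) ^ 4)) (S n)) (RtoC zeta4)).
  { apply clim_ext with (fun n => RtoC (sum_f_R0 (fun j => / INR (S j) ^ 4) n)).
    - intros n. symmetry. apply csumn_RtoC.
    - apply clim_components; [|simpl; apply is_lim_seq_const].
      simpl. apply is_lim_seq_ext with (2 := H). intros n. apply sum_n_Reals. }
  intros eps He. destruct (G eps He) as [N HN]. exists (S N). intros [|n] Hn; [lia|]. apply HN. lia.
Qed.

(* Sum [/ (c z + d)^4] over the pairs with [c d <> 0], taken up to sign, by rows and by
   columns. *)
Lemma lattice_sum_symmetry (z : C) (A B : C) :
  upper z ->
  cseries (fun i => cubes_gf (qpar (RtoC (INR (S i)) * z))) A ->
  cseries (fun i => cubes_gf (qpar (RtoC (INR (S i)) * (- / z)))) B ->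
  (RtoC kappa4 * B + RtoC zeta4 = Cpow z 4 * (RtoC kappa4 * A + RtoC zeta4))%C.
Proof.
  intros Hz HA HB.
  set (w := (- / z)%C). fold w in HB. assert (Hw : upper w) by (apply upper_neg_inv, Hz).
  assert (Hz0 := upper_neq_0 z Hz). assert (Hw0 := upper_neq_0 w Hw).
  assert (Hzw : (z * w = - RtoC 1)%C) by (unfold w; field; exact Hz0).
  assert (Hd := ellipticity_pos z Hz). set (d := ellipticity z) in *.
  set (u := fun i j => (/ Cpow (RtoC (INR (S i)) * z + RtoC (INR (S j))) 4
                      + / Cpow (RtoC (INR (S i)) * z - RtoC (INR (S j))) 4)%C).
  assert (HI : forall i, 0 < INR (S i)) by (intros; apply lt_0_INR; lia).
  (* [(c ^ 2 + e ^ 2) ^ 2 >= c ^ 2 e ^ 2] turns the ellipticity bound into a majorant of product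
     form. *)
  assert (Hu0 : forall c e, 0 < c -> 0 < Rabs e ->
     Cmod (/ Cpow (RtoC c * z + RtoC e) 4)%C <= / d ^ 2 * (/ c ^ 2 * / e ^ 2)).
  { intros c e Hc He.
    assert (Hup : upper (RtoC c * z + RtoC e)%C) by (apply upper_plus_real, upper_scal; assumption).
    assert (Hn0 := upper_neq_0 _ Hup).
    rewrite Cmod_inv by (apply Cpow_nz, Hn0). rewrite Cmod_pow.
    assert (H := Cmod_linear_form_ge z c e). fold d in H.
    assert (Hd2 : 0 < d ^ 2) by (apply pow_lt, Hd).
    assert (Hc2 : 0 < c ^ 2) by (apply pow_lt, Hc).
    assert (He2 : 0 < e ^ 2).
    { rewrite <- (Rabs_pos_eq (e ^ 2)) by apply pow2_ge_0. rewrite <- RPow_abs. apply pow_lt, He. }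
    rewrite <- Rinv_mult, <- Rinv_mult. apply Rinv_le_contravar.
    - apply Rmult_lt_0_compat; [assumption|]. apply Rmult_lt_0_compat; assumption.
    - set (X := Cmod _) in *. replace (X ^ 4) with ((X ^ 2) ^ 2) by ring.
      apply Rle_trans with ((d * (c ^ 2 + e ^ 2)) ^ 2).
      + rewrite Rpow_mult_distr. apply Rmult_le_compat_l; [lra|]. nra.
      + apply pow_incr. split; [apply Rmult_le_pos; lra|exact H]. }
  assert (Hsub : forall a b, (a - RtoC b)%C = (a + RtoC (- b))%C) by (intros; rewrite RtoC_opp; reflexivity).
  assert (Hu : forall i j, Cmod (u i j) <= (2 * / d ^ 2 * / INR (S i) ^ 2) * / INR (S j) ^ 2).
  { intros i j. unfold u. eapply Rle_trans; [apply Cmod_triangle|]. rewrite Hsub.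
    assert (H1 := Hu0 (INR (S i)) (INR (S j)) (HI i)). assert (H2 := Hu0 (INR (S i)) (- INR (S j)) (HI i)).
    rewrite Rabs_Ropp in H2. rewrite Rabs_pos_eq in H1, H2 by (left; apply HI).
    specialize (H1 (HI j)). specialize (H2 (HI j)).
    replace ((- INR (S j)) ^ 2) with (INR (S j) ^ 2) in H2 by ring. lra. }
  assert (Hpos : forall i, 0 <= / INR (S i) ^ 2).
  { intros i. left. apply Rinv_0_lt_compat, pow_lt, HI. }
  destruct (cseries_fubini u (fun i => 2 * / d ^ 2 * / INR (S i) ^ 2) (fun j => / INR (S j) ^ 2)
    (fun i => RtoC kappa4 * cubes_gf (qpar (RtoC (INR (S i)) * z)) - / Cpow z 4 * RtoC (/ INR (S i) ^ 4))%C
    (fun j => / Cpow z 4 * (RtoC kappa4 * cubes_gf (qpar (RtoC (INR (S j)) * w))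
                             - / Cpow w 4 * RtoC (/ INR (S j) ^ 4)))%C) as [l [H1 H2]].
  - apply ex_series_Rmult, ex_series_inv_sqr.
  - apply ex_series_inv_sqr.
  - intros i. apply Rmult_le_pos; [|apply Hpos]. assert (0 < / d ^ 2) by apply Rinv_0_lt_compat, pow_lt, Hd. lra.
  - exact Hpos.
  - exact Hu.
  - intros i. assert (Hi := HI i).
    assert (HL := lipschitz4 _ (upper_scal (INR (S i)) z Hi Hz)).
    replace (/ Cpow z 4 * RtoC (/ INR (S i) ^ 4))%C with (/ Cpow (RtoC (INR (S i)) * z) 4)%C.
    + exact HL.
    + apply Cinv_pow4_scal; assumption.
  - intros j. assert (Hj := HI j).
    assert (HL := lipschitz4 _ (upper_scal (INR (S j)) w Hj Hw)).
    replace (/ Cpow w 4 * RtoC (/ INR (S j) ^ 4))%C with (/ Cpow (RtoC (INR (S j)) * w) 4)%C.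
    + eapply cseries_ext; [|exact (cseries_scal (/ Cpow z 4)%C _ _ HL)].
      intros i. cbv beta. unfold u.
      assert (Hi := HI i).
      assert (E1 : upper (RtoC (INR (S i)) * z + RtoC (INR (S j)))%C) by (apply upper_plus_real, upper_scal; assumption).
      assert (E2 : upper (RtoC (INR (S i)) * z - RtoC (INR (S j)))%C) by (rewrite Hsub; apply upper_plus_real, upper_scal; assumption).
      apply upper_neq_0 in E1, E2.
      set (a := RtoC (INR (S i))) in *. set (b := RtoC (INR (S j))) in *.
      (* Since [z w = -1], a column of the array for [z] is [z ^ (- 4)] times a row of the array for
         [w], with the two signs exchanged; so Lipschitz' formula also sums the columns. *)
      assert (F1 : (z * (b * w + a) = a * z - b)%C) by (replace (z * (b * w + a))%C with (b * (z * w) + a * z)%C by ring; rewrite Hzw; ring).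
      assert (F2 : (z * (b * w - a) = - (a * z + b))%C) by (replace (z * (b * w - a))%C with (b * (z * w) - a * z)%C by ring; rewrite Hzw; ring).
      assert (G1 : (b * w + a)%C <> RtoC 0) by (intros E; apply E2; rewrite <- F1, E; ring).
      assert (G2 : (b * w - a)%C <> RtoC 0).
      { intros E. apply E1. replace (a * z + b)%C with (- (z * (b * w - a)))%C by (rewrite F2; ring). rewrite E. ring. }
      rewrite Cmult_plus_distr_l.
      rewrite <- !Cinv_mul by (apply Cpow_nz; assumption). rewrite <- !Cpow_mult_l, F1, F2.
      rewrite Cplus_comm. f_equal. f_equal. simpl. ring.
    + apply Cinv_pow4_scal; assumption.
  - assert (E1 := cseries_unique _ _ _ H1 (cseries_minus _ _ _ _ (cseries_scal (RtoC kappa4) _ _ HA)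
        (cseries_scal (/ Cpow z 4)%C _ _ zeta4C_series))).
    assert (E2 := cseries_unique _ _ _ H2 (cseries_scal (/ Cpow z 4)%C _ _ (cseries_minus _ _ _ _ (cseries_scal (RtoC kappa4) _ _ HB)
        (cseries_scal (/ Cpow w 4)%C _ _ zeta4C_series)))).
    rewrite E1 in E2. clear E1 H1 H2 l.
    assert (Hw4 : (/ Cpow w 4 = Cpow z 4)%C).
    { unfold w. replace (Cpow (- / z) 4) with (/ Cpow z 4)%C by (field; exact Hz0).
      field. exact Hz0. }
    rewrite Hw4 in E2. assert (Hz4 := Cpow_nz z 4 Hz0).
    (* After multiplication by [z ^ 4], the two added terms are the contributions of the pairs with
       [c = 0] and with [d = 0]. *)
    apply (f_equal (fun x => (Cpow z 4 * x + Cpow z 4 * RtoC zeta4 + RtoC zeta4)%C)) in E2.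
    set (Z := Cpow z 4) in *.
    replace (Z * (RtoC kappa4 * A + RtoC zeta4))%C with
      (Z * (RtoC kappa4 * A - / Z * RtoC zeta4) + Z * RtoC zeta4 + RtoC zeta4)%C by (field; exact Hz4).
    rewrite E2. field. exact Hz4.
Qed.

(** * Modular forms as q-expansions with an inversion law *)

Definition qexp (b : nat -> C) (F : C -> C) : Prop :=
  forall z, upper z -> cseries (fun n => b n * Cpow (qpar z) n)%C (F z).

(** Periodicity is implicit in the q-expansion, so inversion is the only law to record. In this form
    modularity is easy to establish for [E4] and visibly stable under products and differences. *)
Definition qform (k : nat) (b : nat -> C) (F : C -> C) : Prop :=
  qexp b F /\ forall z, upper z -> F (- / z)%C = (Cpow z k * F z)%C.

(** A total sum, meaningful when the series converges; it allows [E4] to be defined as a function on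
    all of [C]. *)
Definition csum (u : nat -> C) : C :=
  (Series (fun n => Re (u n)), Series (fun n => Im (u n))).

Lemma is_lim_seq_Re (s : nat -> C) (l : C) : clim s l -> is_lim_seq (fun n => Re (s n)) (Re l).
Proof.
  intros H. apply is_lim_seq_spec. intros eps.
  destruct (H eps (cond_pos eps)) as [N HN]. exists N. intros n Hn.
  eapply Rle_lt_trans; [|apply (HN n Hn)].
  assert (G := re_le_Cmod (s n - l)%C). destruct (s n), l; exact G.
Qed.

Lemma is_lim_seq_Im (s : nat -> C) (l : C) : clim s l -> is_lim_seq (fun n => Im (s n)) (Im l).
Proof.
  intros H. apply is_lim_seq_spec. intros eps.
  destruct (H eps (cond_pos eps)) as [N HN]. exists N. intros n Hn.
  eapply Rle_lt_trans; [|apply (HN n Hn)].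
  assert (G := Rle_trans _ _ _ (Rmax_r _ _) (Rmax_Cmod (s n - l)%C)). destruct (s n), l; exact G.
Qed.

Lemma Re_csumn (u : nat -> C) (n : nat) : Re (csumn u (S n)) = sum_n (fun i => Re (u i)) n.
Proof.
  induction n as [|n IH].
  - rewrite sum_O. apply Rplus_0_l.
  - rewrite sum_Sn, <- IH. reflexivity.
Qed.

Lemma Im_csumn (u : nat -> C) (n : nat) : Im (csumn u (S n)) = sum_n (fun i => Im (u i)) n.
Proof.
  induction n as [|n IH].
  - rewrite sum_O. apply Rplus_0_l.
  - rewrite sum_Sn, <- IH. reflexivity.
Qed.

Lemma is_series_Re (u : nat -> C) (l : C) : cseries u l -> is_series (fun n => Re (u n)) (Re l).
Proof.
  intros H. change (is_lim_seq (sum_n (fun n => Re (u n))) (Re l)).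
  apply is_lim_seq_ext with (fun n => Re (csumn u (S n))); [intros; apply Re_csumn|].
  apply is_lim_seq_Re in H. apply is_lim_seq_incr_1 in H. exact H.
Qed.

Lemma is_series_Im (u : nat -> C) (l : C) : cseries u l -> is_series (fun n => Im (u n)) (Im l).
Proof.
  intros H. change (is_lim_seq (sum_n (fun n => Im (u n))) (Im l)).
  apply is_lim_seq_ext with (fun n => Im (csumn u (S n))); [intros; apply Im_csumn|].
  apply is_lim_seq_Im in H. apply is_lim_seq_incr_1 in H. exact H.
Qed.

Lemma csum_eq (u : nat -> C) (l : C) : cseries u l -> csum u = l.
Proof.
  intros H. unfold csum. rewrite (is_series_unique _ _ (is_series_Re _ _ H)).
  rewrite (is_series_unique _ _ (is_series_Im _ _ H)). destruct l; reflexivity.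
Qed.

(* This is [240], since zeta(4) = pi^4 / 90; only bounds on zeta(4) are used. *)
Definition e4_const : R := kappa4 / zeta4.

Definition e4 (n : nat) : R := match n with 0%nat => 1 | S _ => e4_const * sigma3 n end.

Definition E4 (z : C) : C := (1 + RtoC e4_const * csum (fun n => RtoC (sigma3 n) * Cpow (qpar z) n))%C.

Lemma e4_const_pos : 0 < e4_const.
Proof. apply Rdiv_lt_0_compat; [apply kappa4_pos|]. assert (H := zeta4_ge). lra. Qed.

Lemma E4_qform : qform 4 (fun n => RtoC (e4 n)) E4.
Proof.
  split.
  - intros z Hz. unfold E4. destruct (lambert_cubes z Hz) as [l [_ Hl]].
    rewrite (csum_eq _ _ Hl).
    assert (H0 := cseries_csumn_finite (fun n => match n with 0%nat => RtoC 1 | _ => RtoC 0 end) 1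
      ltac:(intros [|n] Hn; [lia|reflexivity])).
    cbn [csumn] in H0. replace (0 + 1)%C with (RtoC 1) in H0 by ring.
    eapply cseries_ext; [|exact (cseries_plus _ _ _ _ H0 (cseries_scal (RtoC e4_const) _ _ Hl))].
    intros [|n]; cbv beta; unfold e4.
    + simpl. ring.
    + rewrite RtoC_mult. ring.
  - intros z Hz. unfold E4.
    destruct (lambert_cubes z Hz) as [A [HA1 HA2]].
    destruct (lambert_cubes _ (upper_neg_inv z Hz)) as [B [HB1 HB2]].
    rewrite (csum_eq _ _ HA2), (csum_eq _ _ HB2).
    assert (H := lattice_sum_symmetry z A B Hz HA1 HB1).
    assert (Hz4 : RtoC zeta4 <> RtoC 0).
    { intros E. apply RtoC_inj in E. assert (G := zeta4_ge). lra. }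
    unfold e4_const. rewrite RtoC_div by (assert (G := zeta4_ge); lra).
    replace (1 + kappa4 / zeta4 * B)%C with (/ zeta4 * (kappa4 * B + zeta4))%C by (field; exact Hz4).
    rewrite H. field. exact Hz4.
Qed.

(** * Products of q-expansions *)

(** The terms of the convergent series at height [y] are bounded. As [y] may be arbitrarily small,
    this replaces the radius of convergence. *)
Lemma qexp_growth (b : nat -> C) (F : C -> C) (y : R) :
  qexp b F -> 0 < y -> exists B, 0 < B /\ forall n, Cmod (b n) <= B * exp (2 * PI * y * INR n).
Proof.
  intros H Hy. assert (H1 := H (0, y) Hy).
  destruct (clim_bounded _ _ (cseries_term_lim _ _ H1)) as [B [HB HBn]].
  exists B. split; [exact HB|]. intros n. specialize (HBn n).
  rewrite Cmod_mult, Cmod_qpar_pow in HBn. simpl in HBn.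
  apply Rmult_le_compat_r with (r := exp (2 * PI * y * INR n)) in HBn; [|left; apply exp_pos].
  rewrite Rmult_assoc, <- exp_plus in HBn.
  replace (- (2 * PI * y) * INR n + 2 * PI * y * INR n) with 0 in HBn by ring.
  rewrite exp_0, Rmult_1_r in HBn. exact HBn.
Qed.

Lemma cseries_delay (v : nat -> C) (l : C) (i : nat) :
  cseries v l -> cseries (fun n => if le_dec i n then v (n - i)%nat else RtoC 0) l.
Proof.
  intros H. induction i as [|i IH].
  - eapply cseries_ext; [|exact H]. intros n. simpl. rewrite Nat.sub_0_r. reflexivity.
  - replace l with ((if le_dec (S i) 0 then v (0 - S i)%nat else RtoC 0) + l)%C.
    + apply cseries_shift. eapply cseries_ext; [|exact IH].
      intros n. cbv beta. destruct (le_dec i n), (le_dec (S i) (S n)); try lia; reflexivity.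
    + destruct (le_dec (S i) 0); [lia|ring].
Qed.

Lemma qform_mult (k1 k2 : nat) (a b : nat -> R) (F G : C -> C) :
  qform k1 (fun n => RtoC (a n)) F -> qform k2 (fun n => RtoC (b n)) G ->
  qform (k1 + k2) (fun n => RtoC (sum_f_R0 (fun i => a i * b (n - i)%nat)%R n)) (fun z => F z * G z)%C.
Proof.
  intros [HF HF2] [HG HG2]. split.
  - intros z Hz. set (t := 2 * PI * Im z). assert (Ht : 0 < t) by (apply two_pi_Im_pos, Hz).
    (* Growth at a quarter of the height leaves a decay [exp (- 3 t n / 4)] for the products, which
       for [i <= n] is at most [exp (- t i / 4) exp (- t n / 2)], a majorant of product form. *)
    assert (Hy : 0 < Im z / 4) by (unfold upper in Hz; lra).
    destruct (qexp_growth _ _ _ HF Hy) as [A [HA HAn]].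
    destruct (qexp_growth _ _ _ HG Hy) as [B [HB HBn]].
    set (u := fun i n => if le_dec i n then
       (RtoC (a i) * Cpow (qpar z) i * (RtoC (b (n - i)%nat) * Cpow (qpar z) (n - i)))%C else RtoC 0).
    destruct (cseries_fubini u (fun i => exp (- (t / 4) * INR i)) (fun n => A * B * exp (- (t / 2) * INR n))
      (fun i => RtoC (a i) * Cpow (qpar z) i * G z)%C
      (fun n => RtoC (sum_f_R0 (fun i => a i * b (n - i)%nat)%R n) * Cpow (qpar z) n)%C) as [l [H1 H2]].
    + apply ex_series_exp. lra.
    + apply ex_series_Rmult, ex_series_exp. lra.
    + intros i. left. apply exp_pos.
    + intros n. apply Rmult_le_pos; [nra|left; apply exp_pos].
    + intros i n. unfold u. destruct (le_dec i n) as [Hin|Hin].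
      * rewrite !Cmod_mult, !Cmod_qpar_pow. fold t.
        specialize (HAn i). specialize (HBn (n - i)%nat).
        replace (2 * PI * (Im z / 4)) with (t / 4) in HAn, HBn by (unfold t; field).
        apply Rle_trans with ((A * exp (t / 4 * INR i) * exp (- t * INR i)) *
                              (B * exp (t / 4 * INR (n - i)) * exp (- t * INR (n - i)))).
        { assert (E1 := exp_pos (- t * INR i)). assert (E2 := exp_pos (- t * INR (n - i))).
          apply Rmult_le_compat; try (apply Rmult_le_pos; [apply Cmod_ge_0|lra]);
          apply Rmult_le_compat_r; lra. }
        replace (A * exp (t / 4 * INR i) * exp (- t * INR i) * (B * exp (t / 4 * INR (n - i)) * exp (- t * INR (n - i))))
          with (A * B * (exp (t / 4 * INR i) * exp (- t * INR i) * (exp (t / 4 * INR (n - i)) * exp (- t * INR (n - i))))) by ring.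
        replace (exp (- (t / 4) * INR i) * (A * B * exp (- (t / 2) * INR n)))
          with (A * B * (exp (- (t / 4) * INR i) * exp (- (t / 2) * INR n))) by ring.
        apply Rmult_le_compat_l; [nra|]. rewrite <- !exp_plus. apply exp_le.
        rewrite minus_INR by exact Hin. apply le_INR in Hin. assert (Hi := pos_INR i). nra.
      * rewrite Cmod_0. assert (E1 := exp_pos (- (t / 4) * INR i)).
        assert (E2 := exp_pos (- (t / 2) * INR n)).
        apply Rmult_le_pos; [lra|]. apply Rmult_le_pos; [nra|lra].
    + intros i. assert (H := cseries_delay _ _ i (HG z Hz)).
      eapply cseries_ext; [|exact (cseries_scal (RtoC (a i) * Cpow (qpar z) i)%C _ _ H)].
      intros n. unfold u. cbv beta. destruct (le_dec i n); ring.
    + intros n.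
      replace (RtoC (sum_f_R0 (fun i => a i * b (n - i)%nat)%R n) * Cpow (qpar z) n)%C
        with (csumn (fun i => u i n) (S n)).
      * apply cseries_csumn_finite. intros i Hi. unfold u. destruct (le_dec i n); [lia|reflexivity].
      * rewrite <- csumn_RtoC, Cmult_comm, <- csumn_scal. apply csumn_ext. intros i Hi.
        unfold u. destruct (le_dec i n); [|lia].
        replace (Cpow (qpar z) n) with (Cpow (qpar z) i * Cpow (qpar z) (n - i))%C
          by (rewrite <- Cpow_add_r; f_equal; lia).
        rewrite RtoC_mult. ring.
    + replace (F z * G z)%C with l; [exact H2|].
      apply (cseries_unique _ _ _ H1).
      rewrite Cmult_comm. eapply cseries_ext; [|exact (cseries_scal (G z) _ _ (HF z Hz))].
      intros n. cbv beta. ring.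
  - intros z Hz. rewrite HF2, HG2, Cpow_add_r by exact Hz. ring.
Qed.

(* [E4pow j] is the power [E4 ^ (j + 1)]. *)
Fixpoint e4pow (j : nat) : nat -> R :=
  match j with
  | 0%nat => e4
  | S j => fun n => sum_f_R0 (fun i => e4pow j i * e4 (n - i)%nat) n
  end.

Fixpoint E4pow (j : nat) : C -> C :=
  match j with 0%nat => E4 | S j => fun z => (E4pow j z * E4 z)%C end.

Lemma E4pow_qform (j : nat) : qform (4 * S j) (fun n => RtoC (e4pow j n)) (E4pow j).
Proof.
  induction j as [|j IH]; [exact E4_qform|].
  replace (4 * S (S j))%nat with (4 * S j + 4)%nat by lia.
  exact (qform_mult _ _ _ _ _ _ IH E4_qform).
Qed.

Lemma e4_nonneg (n : nat) : 0 <= e4 n.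
Proof.
  destruct n as [|n]; [simpl; lra|]. unfold e4.
  apply Rmult_le_pos; [left; apply e4_const_pos|apply sigma3_nonneg].
Qed.

Lemma e4pow_nonneg (j n : nat) : 0 <= e4pow j n.
Proof.
  revert n. induction j as [|j IH]; intros n; [apply e4_nonneg|].
  apply cond_pos_sum. intros i. apply Rmult_le_pos; [apply IH|apply e4_nonneg].
Qed.

Lemma e4pow_0 (j : nat) : e4pow j 0 = 1.
Proof. induction j as [|j IH]; [reflexivity|]. simpl. rewrite IH. ring. Qed.

(** * Lower bound for the coefficients of powers of E4 *)

(** Binomial coefficients, real-valued and zero for [k > n], so that Pascal's rule has no side
    condition. *)
Fixpoint bin (n : nat) : nat -> R :=
  match n with
  | 0%nat => fun k => match k with 0%nat => 1 | S _ => 0 end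
  | S n => fun k => match k with 0%nat => 1 | S k => bin n k + bin n (S k) end
  end.

Lemma bin_S (n k : nat) : bin (S n) (S k) = bin n k + bin n (S k).
Proof. reflexivity. Qed.

Lemma bin_0_r (n : nat) : bin n 0 = 1.
Proof. destruct n; reflexivity. Qed.

Lemma bin_nonneg (n k : nat) : 0 <= bin n k.
Proof.
  revert k. induction n as [|n IH]; intros [|k]; simpl; try lra.
  assert (H1 := IH k). assert (H2 := IH (S k)). lra.
Qed.

Lemma bin_gt (n k : nat) : (n < k)%nat -> bin n k = 0.
Proof.
  revert k. induction n as [|n IH]; intros [|k] H; try lia; [reflexivity|].
  rewrite bin_S, !IH by lia. ring.
Qed.

Lemma bin_absorb (n k : nat) : (INR k + 1) * bin n (S k) = (INR n - INR k) * bin n k.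
Proof.
  revert k. induction n as [|n IH]; intros k.
  - destruct k as [|k]; simpl bin; simpl INR; ring.
  - rewrite bin_S. destruct k as [|k].
    + rewrite !bin_0_r. assert (H := IH 0%nat). rewrite bin_0_r in H. rewrite S_INR. simpl INR in *. lra.
    + rewrite bin_S. assert (H1 := IH (S k)). assert (H2 := IH k). rewrite !S_INR in *. lra.
Qed.

Lemma bin_absorb_S (n k : nat) : (INR k + 1) * bin (S n) (S k) = (INR n + 1) * bin n k.
Proof. rewrite bin_S. assert (H := bin_absorb n k). lra. Qed.

(** The [n]-th coefficient of [E4] is bounded below by a multiple of [n ^ 3 - n = 6 bin (n + 1) 3]
    instead of [n ^ 3], because convolving shifted binomials yields a single binomial again. Case
    [b = 3] raises the power of [E4] by one; the cases 0, 1, 2 lead up to it. *)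
Definition binconv (s a b n : nat) : R :=
  sum_f_R0 (fun i => bin (i + s) a * bin (n - i + 1) b) n.

Lemma binconv_0 (s a n : nat) : (s <= a)%nat -> binconv s a 0 n = bin (n + s + 1) (a + 1).
Proof.
  intros Hs. unfold binconv. induction n as [|n IH].
  - simpl sum_f_R0. rewrite !Nat.add_1_r. simpl Nat.add.
    rewrite bin_S, (bin_gt s (S a)) by lia. ring.
  - rewrite tech5, bin_0_r.
    rewrite (sum_eq _ (fun i => bin (i + s) a * bin (n - i + 1) 0)).
    + rewrite IH. rewrite !Nat.add_1_r. simpl Nat.add. rewrite (bin_S (S (n + s))). ring.
    + intros i Hi. rewrite !bin_0_r. reflexivity.
Qed.

(** Pascal's rule in the second factor. The boundary term is nonzero only for [b = 0], which
    explains the extra summand in the step from 0 to 1. *)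
Lemma binconv_S (s a b n : nat) :
  binconv s a (S b) (S n) = binconv s a (S b) n + binconv s a b n + bin (S n + s) a * bin 1 (S b).
Proof.
  unfold binconv. rewrite tech5. rewrite Nat.sub_diag. f_equal.
  rewrite <- plus_sum. apply sum_eq. intros i Hi.
  replace (S n - i + 1)%nat with (S (n - i + 1)) by lia. rewrite bin_S. ring.
Qed.

Lemma binconv_1 (s a n : nat) : (s <= a)%nat -> binconv s a 1 n = bin (n + s + 2) (a + 2).
Proof.
  intros Hs. induction n as [|n IH].
  - unfold binconv. simpl sum_f_R0. replace (0 + s + 2)%nat with (S (S s)) by lia.
    replace (a + 2)%nat with (S (S a)) by lia.
    rewrite !bin_S. rewrite (bin_gt s (S a)), (bin_gt s (S (S a))) by lia. simpl. ring.
  - rewrite binconv_S, IH, binconv_0 by exact Hs.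
    replace (S n + s + 2)%nat with (S (n + s + 2)) by lia.
    replace (a + 2)%nat with (S (a + 1)) by lia. rewrite (bin_S (n + s + 2)).
    assert (E : bin (n + s + 2) (a + 1) = bin (n + s + 1) a + bin (n + s + 1) (a + 1)).
    { replace (n + s + 2)%nat with (S (n + s + 1)) by lia. rewrite !(Nat.add_1_r a). apply bin_S. }
    rewrite E. replace (S n + s)%nat with (n + s + 1)%nat by lia.
    simpl (bin 1 1). ring.
Qed.

Lemma binconv_2 (s a n : nat) : (s <= a)%nat -> binconv s a 2 n = bin (n + s + 2) (a + 3).
Proof.
  intros Hs. induction n as [|n IH].
  - unfold binconv. simpl sum_f_R0. rewrite (bin_gt (0 + s + 2)) by lia. simpl. ring.
  - rewrite binconv_S, IH, binconv_1 by exact Hs.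
    replace (S n + s + 2)%nat with (S (n + s + 2)) by lia.
    replace (a + 3)%nat with (S (a + 2)) by lia. rewrite (bin_S (n + s + 2)). simpl (bin 1 2). ring.
Qed.

Lemma binconv_3 (s a n : nat) : (s <= a)%nat -> binconv s a 3 n = bin (n + s + 2) (a + 4).
Proof.
  intros Hs. induction n as [|n IH].
  - unfold binconv. simpl sum_f_R0. rewrite (bin_gt (0 + s + 2)) by lia. simpl. ring.
  - rewrite binconv_S, IH, binconv_2 by exact Hs.
    replace (S n + s + 2)%nat with (S (n + s + 2)) by lia.
    replace (a + 4)%nat with (S (a + 3)) by lia. rewrite (bin_S (n + s + 2)). simpl (bin 1 3). ring.
Qed.

Lemma bin_3 (n : nat) : 6 * bin (n + 1) 3 = INR n ^ 3 - INR n.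
Proof.
  rewrite Nat.add_1_r.
  assert (H1 := bin_absorb_S n 2). assert (H2 := bin_absorb n 1). assert (H3 := bin_absorb n 0).
  rewrite bin_0_r in H3. simpl INR in *. replace (6 * bin (S n) 3) with (2 * ((1 + 1 + 1) * bin (S n) 3)) by ring.
  nra.
Qed.

Lemma e4_ge (n : nat) : 6 * e4_const * bin (n + 1) 3 <= e4 n.
Proof.
  assert (Hc := e4_const_pos).
  replace (6 * e4_const * bin (n + 1) 3) with (e4_const * (6 * bin (n + 1) 3)) by ring.
  rewrite bin_3. destruct n as [|n]; [simpl; lra|]. unfold e4.
  apply Rmult_le_compat_l; [lra|]. assert (H := sigma3_ge (S n)). assert (H1 := pos_INR (S n)). lra.
Qed.

Lemma e4pow_ge (j n : nat) :
  (6 * e4_const) ^ S j * bin (n + (2 * j + 1)) (4 * j + 3) <= e4pow j n.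
Proof.
  assert (Hc := e4_const_pos).
  revert n. induction j as [|j IH]; intros n.
  - simpl pow. rewrite Rmult_1_r. apply e4_ge.
  - simpl e4pow.
    replace (n + (2 * S j + 1))%nat with (n + (2 * j + 1) + 2)%nat by lia.
    replace (4 * S j + 3)%nat with (4 * j + 3 + 4)%nat by lia.
    rewrite <- binconv_3 by lia. unfold binconv.
    rewrite scal_sum. apply sum_Rle. intros i Hi.
    apply Rle_trans with (((6 * e4_const) ^ S j * bin (i + (2 * j + 1)) (4 * j + 3)) *
                          (6 * e4_const * bin (n - i + 1) 3)).
    + right. simpl. ring.
    + apply Rmult_le_compat.
      * apply Rmult_le_pos; [apply pow_le; lra|apply bin_nonneg].
      * apply Rmult_le_pos; [lra|apply bin_nonneg].
      * apply IH.
      * apply e4_ge.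
Qed.

(** The product of the [2 h + 1] consecutive factors from [x - h] to [x + h], paired around the
    middle. Pairing removes the odd-order terms, so the loss against [x ^ (2 h + 1)] is only of
    relative order [h ^ 3 / x ^ 2]. *)
Fixpoint centered_prod (x : R) (h : nat) : R :=
  match h with 0%nat => x | S h => centered_prod x h * (x ^ 2 - (INR h + 1) ^ 2) end.

Lemma bin_centered_prod (n h : nat) :
  bin (n + h) (2 * h + 1) * INR (fact (2 * h + 1)) = centered_prod (INR n) h.
Proof.
  induction h as [|h IH].
  - assert (H := bin_absorb n 0). rewrite bin_0_r in H. simpl INR in H.
    rewrite Nat.add_0_r. simpl. lra.
  - replace (n + S h)%nat with (S (n + h)) by lia.
    replace (2 * S h + 1)%nat with (S (S (2 * h + 1))) by lia.
    cbn [centered_prod]. rewrite <- IH. rewrite !fact_simpl, !mult_INR.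
    assert (H1 := bin_absorb_S (n + h) (S (2 * h + 1))).
    assert (H2 := bin_absorb (n + h) (2 * h + 1)).
    rewrite !S_INR in *.
    replace (INR (2 * h + 1)) with (2 * INR h + 1) in * by (rewrite plus_INR, mult_INR; simpl; ring).
    rewrite plus_INR in *.
    set (b1 := bin (S (n + h)) (S (S (2 * h + 1)))) in *.
    set (b2 := bin (n + h) (S (2 * h + 1))) in *. set (b3 := bin (n + h) (2 * h + 1)) in *.
    set (f := INR (fact (2 * h + 1))).
    replace (b1 * ((2 * INR h + 1 + 1 + 1) * ((2 * INR h + 1 + 1) * f)))
      with (((2 * INR h + 1 + 1 + 1) * b1) * (2 * INR h + 1 + 1) * f) by ring.
    rewrite H1. replace ((INR n + INR h + 1) * b2 * (2 * INR h + 1 + 1) * f)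
      with ((INR n + INR h + 1) * ((2 * INR h + 1 + 1) * b2) * f) by ring.
    rewrite H2. ring.
Qed.

(** Weierstrass' inequality: the product of the [1 - i ^ 2 / x ^ 2] is at least one minus the sum of
    the [i ^ 2 / x ^ 2], and the squares up to [h] add up to [h (h + 1) (2 h + 1) / 6]. *)
Lemma centered_prod_ge (x : R) (h : nat) :
  INR h <= x -> 0 < x ->
  x ^ (2 * h + 1) * (1 - INR h * (INR h + 1) * (2 * INR h + 1) / (6 * x ^ 2)) <= centered_prod x h.
Proof.
  intros Hh Hx. induction h as [|h IH].
  - simpl. right. field. lra.
  - rewrite S_INR in Hh. cbn [centered_prod]. assert (H0 := pos_INR h).
    apply Rle_trans with (x ^ (2 * h + 1) * (1 - INR h * (INR h + 1) * (2 * INR h + 1) / (6 * x ^ 2)) * (x ^ 2 - (INR h + 1) ^ 2)).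
    + replace (2 * S h + 1)%nat with (2 * h + 1 + 2)%nat by lia. rewrite pow_add, S_INR.
      rewrite !Rmult_assoc. apply Rmult_le_compat_l; [apply pow_le; lra|].
      set (p := INR h * ((INR h + 1) * (2 * INR h + 1)) / (6 * x ^ 2)).
      replace (INR h * ((INR h + 1) * ((2 * INR h + 1) / (6 * x ^ 2)))) with p by (unfold p; field; lra).
      assert (Hp : 0 <= p).
      { unfold p. apply Rmult_le_pos; [apply Rmult_le_pos; nra|]. left. apply Rinv_0_lt_compat. nra. }
      apply Rle_trans with (x ^ 2 * (1 - p) - (INR h + 1) ^ 2); [|nra].
      right. unfold p. field. lra.
    + apply Rmult_le_compat_r; [nra|]. apply IH. lra.
Qed.

(** For [h = 2 j + 1] the sum of squares is at most [k ^ 3 / 24], where [k = 4 (j + 1)]. The first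
    hypothesis thus makes the correction at most one half, whence the factor 2. *)
Lemma e4pow_main_term (j n : nat) :
  INR (4 * S j) ^ 3 / 12 <= INR n ^ 2 -> (2 * j + 1 <= n)%nat ->
  (6 * e4_const) ^ S j * INR n ^ (4 * j + 3) <= 2 * INR (fact (4 * j + 3)) * e4pow j n.
Proof.
  intros Hn Hjn. assert (Hc := e4_const_pos).
  assert (H := e4pow_ge j n).
  assert (Hb := bin_centered_prod n (2 * j + 1)).
  replace (2 * (2 * j + 1) + 1)%nat with (4 * j + 3)%nat in Hb by lia.
  assert (Hn0 : 0 < INR n) by (apply lt_0_INR; lia).
  assert (Hp := centered_prod_ge (INR n) (2 * j + 1) (le_INR _ _ Hjn) Hn0).
  replace (2 * (2 * j + 1) + 1)%nat with (4 * j + 3)%nat in Hp by lia.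
  rewrite <- Hb in Hp.
  assert (Hf : 0 < INR (fact (4 * j + 3))) by apply INR_fact_lt_0.
  assert (Hpow : 0 < INR n ^ (4 * j + 3)) by (apply pow_lt, Hn0).
  assert (Hhalf : 1 / 2 <= 1 - INR (2 * j + 1) * (INR (2 * j + 1) + 1) * (2 * INR (2 * j + 1) + 1) / (6 * INR n ^ 2)).
  { replace (INR (2 * j + 1)) with (2 * INR j + 1) by (rewrite plus_INR, mult_INR; simpl; ring).
    replace (INR (4 * S j)) with (4 * (INR j + 1)) in Hn by (rewrite mult_INR, (S_INR j); simpl; ring).
    assert (H0 := pos_INR j). assert (H00 := pow2_ge_0 (INR j)).
    assert (Hn2 : 0 < INR n ^ 2) by (apply pow_lt, Hn0).
    assert ((2 * INR j + 1) * (2 * INR j + 1 + 1) * (2 * (2 * INR j + 1) + 1) / (6 * INR n ^ 2) <= 1 / 2); [|lra].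
    apply Rmult_le_reg_r with (6 * INR n ^ 2); [lra|].
    set (y := INR n ^ 2) in *. clearbody y.
    unfold Rdiv at 1. rewrite Rmult_assoc, Rinv_l by lra. set (c := INR j) in *. clearbody c.
    ring_simplify. ring_simplify in Hn. lra. }
  assert (Hm : INR n ^ (4 * j + 3) * (1 / 2) <= bin (n + (2 * j + 1)) (4 * j + 3) * INR (fact (4 * j + 3))).
  { eapply Rle_trans; [|exact Hp]. apply Rmult_le_compat_l; lra. }
  assert (HcS : 0 < (6 * e4_const) ^ S j) by (apply pow_lt; lra).
  apply Rle_trans with (2 * INR (fact (4 * j + 3)) * ((6 * e4_const) ^ S j * bin (n + (2 * j + 1)) (4 * j + 3))).
  - apply Rmult_le_compat_l with (r := 2 * (6 * e4_const) ^ S j) in Hm; [|lra]. lra.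
  - apply Rmult_le_compat_l; [lra|exact H].
Qed.

(** The true value is 1440; the loss comes from [3.14] and [1.084], and the margin in [beta] absorbs
    it. *)
Lemma e4_const_ge : 1434 <= 6 * e4_const.
Proof.
  unfold e4_const, kappa4. assert (HP := PI_bounds). assert (H1 := zeta4_ge). assert (H2 := zeta4_le).
  assert (H4 : 3.14 ^ 4 <= PI ^ 4) by (apply pow_incr; lra).
  apply Rmult_le_reg_r with zeta4; [lra|].
  replace (6 * (8 * PI ^ 4 / 3 / zeta4) * zeta4) with (16 * PI ^ 4) by (field; lra).
  lra.
Qed.

(** * Numerical bounds for the exponential *)

Lemma exp_ge_taylor (x : R) (n : nat) :
  0 <= x -> sum_f_R0 (fun i => / INR (fact i) * x ^ i) n <= exp x.
Proof.
  intros Hx. unfold exp. destruct (exist_exp x) as [l Hl]. simpl.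
  apply sum_incr; [exact Hl|]. intros i. apply Rmult_le_pos; [|apply pow_le, Hx].
  left. apply Rinv_0_lt_compat, INR_fact_lt_0.
Qed.

(** The function [2 + x - (2 - x) exp x] vanishes at 0 and has derivative [1 - (1 - x) exp x],
    nonnegative because [1 - x <= exp (- x)]. *)
Lemma exp_le_pade (t : R) : 0 <= t < 2 -> exp t <= (2 + t) / (2 - t).
Proof.
  intros Ht. destruct (Req_dec t 0) as [->|H0]; [rewrite exp_0; lra|].
  destruct (MVT_gen (fun x => 2 + x - (2 - x) * exp x) 0 t (fun x => 1 - (1 - x) * exp x)) as [c [Hc E]].
  - intros x _. auto_derive; [trivial|]. ring.
  - intros x _. apply derivable_continuous_pt. exists (1 - (1 - x) * exp x).
    apply is_derive_Reals. auto_derive; [trivial|]. ring.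
  - rewrite Rmin_left, Rmax_right in Hc by lra. rewrite exp_0 in E.
    assert (H1 := exp_ineq1_le (- c)). assert (H2 := exp_pos c).
    assert (H3 : (1 - c) * exp c <= 1).
    { apply Rle_trans with (exp (- c) * exp c); [apply Rmult_le_compat_r; lra|].
      rewrite <- exp_plus. replace (- c + c) with 0 by ring. rewrite exp_0. lra. }
    apply Rmult_le_reg_r with (2 - t); [lra|]. unfold Rdiv. rewrite Rmult_assoc, Rinv_l by lra. nra.
Qed.

Lemma exp_neg_le (x y : R) : 0 < y -> y <= exp x -> exp (- x) <= / y.
Proof. intros Hy H. rewrite exp_Ropp. apply Rinv_le_contravar; assumption. Qed.

(** * Cusp forms *)

Lemma qpar_shift_nat (z : C) (n : nat) : qpar (z + RtoC (INR n))%C = qpar z.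
Proof. rewrite qpar_plus, qpar_nat. ring. Qed.

Lemma qexp_shift (b : nat -> C) (F : C -> C) (z w : C) :
  qexp b F -> upper z -> upper w -> qpar z = qpar w -> F z = F w.
Proof.
  intros H Hz Hw E. apply (cseries_unique _ _ _ (H z Hz)). rewrite E. apply H, Hw.
Qed.

Lemma qpar_shift_Z (z : C) (n : Z) : qpar (z + RtoC (IZR n))%C = qpar z.
Proof.
  destruct (Z_le_gt_dec 0 n) as [H|H].
  - rewrite <- (Z2Nat.id n H), <- INR_IZR_INZ. apply qpar_shift_nat.
  - rewrite <- (qpar_shift_nat _ (Z.to_nat (- n))). f_equal.
    rewrite INR_IZR_INZ, Z2Nat.id, opp_IZR, RtoC_opp by lia. ring.
Qed.

Lemma nearest_integer (x : R) : exists n : Z, Rabs (x + IZR n) <= 1 / 2.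
Proof.
  exists (1 - up (x + 1 / 2))%Z. destruct (archimed (x + 1 / 2)) as [H1 H2].
  rewrite minus_IZR. apply Rabs_le. lra.
Qed.

Lemma Im_neg_inv (z : C) : upper z -> Im (- / z)%C = Im z / Cmod z ^ 2.
Proof.
  intros H. rewrite Cmod_sqr. destruct z as [x y]. unfold upper in H. simpl in *. field. nra.
Qed.

(** Gauss reduction as an induction principle. Once [|Re w| <= 1 / 2], a height below [0.86] forces
    [|w| ^ 2 <= 0.99], so inversion raises the height by a factor of at least [100 / 99]. *)
Lemma height_reduction (P : C -> Prop) :
  (forall z n, upper z -> P (z + RtoC (IZR n))%C -> P z) ->
  (forall z, upper z -> P (- / z)%C -> P z) ->
  (forall z, upper z -> 86 / 100 <= Im z -> P z) ->
  forall z, upper z -> P z.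
Proof.
  intros HT HS HF.
  assert (G : forall N z, upper z -> 86 / 100 <= Im z * (100 / 99) ^ N -> P z).
  { induction N as [|N IH]; intros z Hz Hy.
    - apply HF; [exact Hz|]. simpl in Hy. lra.
    - destruct (nearest_integer (Re z)) as [n Hn]. apply (HT z n Hz).
      set (w := (z + RtoC (IZR n))%C) in *.
      assert (Hw : upper w) by (apply upper_plus_real, Hz).
      assert (Hx : Re w = Re z + IZR n) by (unfold w; destruct z; reflexivity).
      assert (Hiw : Im w = Im z) by (unfold w; destruct z; simpl; ring).
      destruct (Rle_lt_dec (86 / 100) (Im w)) as [H|H]; [apply HF; assumption|].
      apply HS; [exact Hw|]. apply IH; [apply upper_neg_inv, Hw|].
      rewrite Im_neg_inv by exact Hw.
      rewrite <- Hx in Hn. assert (Hx2 : Re w ^ 2 <= 1 / 4).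
      { assert (A := Rle_abs (Re w)). assert (B := Rle_abs (- Re w)). rewrite Rabs_Ropp in B. nra. }
      assert (Hy0 : 0 < Im w) by exact Hw.
      assert (Hc : 0 < Cmod w ^ 2 <= 99 / 100) by (rewrite Cmod_sqr; nra).
      eapply Rle_trans; [exact Hy|]. rewrite Hiw. simpl pow.
      rewrite <- Rmult_assoc. apply Rmult_le_compat_r; [apply pow_le; lra|].
      unfold Rdiv at 2. apply Rmult_le_compat_l; [lra|].
      replace (100 / 99) with (/ (99 / 100)) by field. apply Rinv_le_contravar; lra. }
  intros z Hz.
  assert (Hy : 0 < Im z) by exact Hz.
  destruct (INR_unbounded (99 / Im z)) as [N HN].
  (* Bernoulli's inequality: [(100 / 99) ^ N >= 1 + N / 99] bounds the number of steps. *)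
  apply (G N z Hz). assert (HB := poly N (1 / 99) ltac:(lra)).
  replace (1 + 1 / 99) with (100 / 99) in HB by field.
  apply Rle_trans with (Im z * (1 + INR N * (1 / 99))); [|apply Rmult_le_compat_l; lra].
  apply Rmult_lt_compat_r with (r := Im z) in HN; [|exact Hy].
  unfold Rdiv in HN at 1. rewrite Rmult_assoc, Rinv_l in HN by lra. nra.
Qed.

(** * The invariant size of a form, and Hecke's bound *)

Definition height_bound (p : nat) (g : C -> C) (M : R) : Prop :=
  forall z, upper z -> Im z ^ p * Cmod (g z) <= M.

(** With [p] half the weight, [y ^ p |g|] is invariant under translation and inversion, so Gauss
    reduction applies to it. *)
Lemma height_bound_reduce (p : nat) (b : nat -> C) (g : C -> C) (M : R) :
  qform (2 * p) b g ->
  (forall z, upper z -> 86 / 100 <= Im z -> Im z ^ p * Cmod (g z) <= M) ->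
  height_bound p g M.
Proof.
  intros [Hq HS] HF. unfold height_bound. apply height_reduction; [| |exact HF].
  - intros z n Hz H.
    rewrite (qexp_shift b g z (z + RtoC (IZR n))%C Hq Hz (upper_plus_real _ _ Hz)).
    + replace (Im z) with (Im (z + RtoC (IZR n))%C) by (destruct z; simpl; ring). exact H.
    + symmetry. apply qpar_shift_Z.
  - intros z Hz H. rewrite Im_neg_inv, HS, Cmod_mult, Cmod_pow in H by exact Hz.
    assert (Hc : 0 < Cmod z) by (apply Cmod_gt_0, upper_neq_0, Hz).
    replace (Im z ^ p * Cmod (g z)) with ((Im z / Cmod z ^ 2) ^ p * (Cmod z ^ (2 * p) * Cmod (g z))); [exact H|].
    unfold Rdiv. rewrite Rpow_mult_distr, pow_inv, pow_mult. field. apply pow_nonzero, pow_nonzero. lra.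
Qed.

Lemma Cmod_csumn_const (u : nat -> C) (B : R) (m : nat) :
  (forall i, Cmod (u i) <= B) -> Cmod (csumn u m) <= INR m * B.
Proof.
  intros H. induction m as [|m IH].
  - simpl. rewrite Cmod_0. lra.
  - cbn [csumn]. eapply Rle_trans; [apply Cmod_triangle|]. rewrite S_INR. specialize (H m). lra.
Qed.

Lemma Cmod_qpar_real (x : R) : Cmod (qpar (RtoC x)) = 1.
Proof. rewrite Cmod_qpar. simpl. rewrite Rmult_0_r, Ropp_0. apply exp_0. Qed.

Lemma Cmod_root_sum_le (m : nat) (p : Z) : Cmod (root_sum m p) <= 2 * INR m + 1.
Proof.
  rewrite root_sum_eq. assert (H := pos_INR m). destruct (Z.eq_dec _ _).
  - rewrite Cmod_RtoC_nonneg; lra.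
  - rewrite Cmod_0. lra.
Qed.

(** A substitute for the Fourier integral over a period: the averages over [2 m + 1] translates are
    bounded by [K], and as [m] grows Tannery's theorem leaves only the exponent [n]. *)
Lemma hecke_bound (b : nat -> C) (g : C -> C) (y K : R) (n : nat) :
  qexp b g -> 0 < y -> (forall x, Cmod (g (x, y)) <= K) ->
  Cmod (b n) * exp (- (2 * PI * y) * INR n) <= K.
Proof.
  intros Hg Hy HS. set (z := (0, y) : C). assert (Hz : upper z) by exact Hy.
  set (Q := fun m => 2 * INR m + 1).
  assert (HQ : forall m, 0 < Q m) by (intros m; unfold Q; assert (H := pos_INR m); lra).
  assert (HavT := fun m => cseries_scal (RtoC (/ Q m)) _ _ (cseries_root_average b g z m n Hg Hz)).
  cbv zeta in HavT.
  destruct (qexp_growth b g (y / 2) Hg ltac:(lra)) as [B [HB HBn]].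
  set (u := fun m i => (RtoC (/ Q m) * (b i * Cpow (qpar z) i * root_sum m (Z.of_nat i - Z.of_nat n)))%C).
  set (v := fun i => if Nat.eq_dec i n then (b i * Cpow (qpar z) i)%C else RtoC 0).
  assert (Hu : forall m i, Cmod (u m i) <= B * exp (- (PI * y) * INR i)).
  { intros m i. unfold u. rewrite !Cmod_mult, Cmod_qpar_pow.
    rewrite Cmod_RtoC_nonneg by (left; apply Rinv_0_lt_compat, HQ).
    assert (Hr := Cmod_root_sum_le m (Z.of_nat i - Z.of_nat n)). fold (Q m) in Hr.
    assert (HQm := HQ m). assert (Hi := HBn i).
    assert (E := exp_pos (- (2 * PI * Im z) * INR i)).
    apply Rle_trans with (/ Q m * (B * exp (2 * PI * (y / 2) * INR i) * exp (- (2 * PI * Im z) * INR i) * Q m)).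
    + apply Rmult_le_compat_l; [left; apply Rinv_0_lt_compat, HQm|].
      apply Rmult_le_compat; [apply Rmult_le_pos; [apply Cmod_ge_0|lra]|apply Cmod_ge_0| |exact Hr].
      apply Rmult_le_compat_r; [lra|exact Hi].
    + right. rewrite !Rmult_assoc. rewrite <- (Rmult_assoc (exp _) (exp _)), <- exp_plus.
      simpl Im. replace (2 * (PI * (y / 2 * INR i)) + - (2 * (PI * y)) * INR i) with (- (PI * (y * INR i))) by field.
      replace (- (PI * y) * INR i) with (- (PI * (y * INR i))) by ring.
      field. lra. }
  assert (Hv : forall i, clim (fun m => u m i) (v i)).
  { intros i. unfold u, v. destruct (Nat.eq_dec i n) as [->|Hin].
    + apply clim_ext with (fun _ => b n * Cpow (qpar z) n)%C; [|apply clim_const].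
      intros m. rewrite root_sum_eq. rewrite Z.sub_diag, Z.mod_0_l by lia.
      destruct (Z.eq_dec 0 0) as [_|H]; [|contradiction]. fold (Q m). assert (HQm := HQ m).
      replace (RtoC (/ Q m) * (b n * Cpow (qpar z) n * RtoC (Q m)))%C
        with (RtoC (/ Q m) * RtoC (Q m) * (b n * Cpow (qpar z) n))%C by ring.
      rewrite <- RtoC_mult, Rinv_l by lra. ring.
    (* From here on [2 m + 1] exceeds [|i - n|], so [i] and [n] are congruent only if equal. *)
    + apply clim_eventually with (s := fun _ => RtoC 0) (N := (i + n)%nat); [|apply clim_const].
      intros m Hm. rewrite root_sum_eq.
      destruct (Z.eq_dec _ 0) as [H|H]; [|ring].
      exfalso. apply Z.mod_divide in H; [|lia]. destruct H as [c Hc].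
      assert (c = 0 \/ c <= -1 \/ 1 <= c)%Z by lia. nia. }
  destruct (cseries_dominated_lim u v _ _
    (ex_series_Rmult B _ (ex_series_exp (PI * y) ltac:(assert (HP := PI_RGT_0); nra))) Hu Hv HavT) as [l [H1 H2]].
  assert (El : l = (b n * Cpow (qpar z) n)%C).
    { apply (cseries_unique _ _ _ H1).
      assert (Hf : forall i, (S n <= i)%nat -> (if Nat.eq_dec i n then b i * Cpow (qpar z) i else RtoC 0)%C = RtoC 0).
      { intros i Hi. destruct (Nat.eq_dec i n); [lia|reflexivity]. }
      replace (b n * Cpow (qpar z) n)%C with
        (csumn (fun i => if Nat.eq_dec i n then b i * Cpow (qpar z) i else RtoC 0)%C (S n)).
      - apply cseries_csumn_finite. exact Hf.
      - cbn [csumn]. destruct (Nat.eq_dec n n); [|contradiction].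
        assert (G : forall r, (r <= n)%nat -> csumn (fun i => if Nat.eq_dec i n then b i * Cpow (qpar z) i else RtoC 0)%C r = RtoC 0).
        { induction r as [|r IH]; intros Hr; [reflexivity|]. cbn [csumn]. rewrite IH by lia.
          destruct (Nat.eq_dec r n); [lia|ring]. }
        rewrite G by lia. ring. }
    assert (Hl : Cmod l <= K).
    { apply (clim_Cmod_le _ _ _ H2). intros m. assert (HQm := HQ m).
      rewrite Cmod_mult, Cmod_RtoC_nonneg by (left; apply Rinv_0_lt_compat, HQm).
      apply Rmult_le_reg_l with (Q m); [exact HQm|]. rewrite <- Rmult_assoc, Rinv_r, Rmult_1_l by lra.
      eapply Rle_trans; [apply Cmod_triangle|].
      assert (Hx : forall x, Cmod (g (z + RtoC x)%C) <= K).
      { intros x. replace (z + RtoC x)%C with ((x, y) : C); [apply HS|].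
        unfold z, RtoC, Cplus; simpl. f_equal; ring. }
      eapply Rle_trans; [apply Rplus_le_compat; [apply HS|apply Cmod_csumn_const with (B := 2 * K)]|].
      - intros i. eapply Rle_trans; [apply Cmod_triangle|]. rewrite !Cmod_mult, !Cmod_qpar_real.
        match goal with |- 1 * Cmod (g (z + RtoC ?a)%C) + 1 * Cmod (g (z + RtoC ?c)%C) <= _ =>
          assert (A1 := Hx a); assert (A2 := Hx c) end. lra.
      - unfold Q. lra. }
    rewrite El, Cmod_mult, Cmod_qpar_pow in Hl. exact Hl.
Qed.

(** The height stays free because each use has its own: half the current height for tails, three
    quarters of it in weight 8, and the minimising one for the final estimate of [b n]. *)
Lemma height_bound_hecke (p : nat) (b : nat -> C) (g : C -> C) (M y : R) (n : nat) :
  qexp b g -> height_bound p g M -> 0 < y ->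
  Cmod (b n) * y ^ p <= M * exp (2 * PI * y * INR n).
Proof.
  intros Hg HM Hy. assert (Hyp : 0 < y ^ p) by (apply pow_lt, Hy).
  assert (H := hecke_bound b g y (M / y ^ p) n Hg Hy).
  assert (HS : forall x, Cmod (g (x, y)) <= M / y ^ p).
  { intros x. assert (Hx := HM (x, y) Hy). simpl Im in Hx.
    apply Rmult_le_reg_l with (y ^ p); [exact Hyp|].
    replace (y ^ p * (M / y ^ p)) with M by (field; lra). exact Hx. }
  specialize (H HS).
  apply Rmult_le_compat_r with (r := exp (2 * PI * y * INR n) * y ^ p) in H.
  - rewrite <- Rmult_assoc, (Rmult_assoc (Cmod (b n))), <- exp_plus in H.
    replace (- (2 * PI * y) * INR n + 2 * PI * y * INR n) with 0 in H by ring.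
    rewrite exp_0, Rmult_1_r in H.
    replace (M / y ^ p * (exp (2 * PI * y * INR n) * y ^ p)) with (M * exp (2 * PI * y * INR n)) in H by (field; lra).
    exact H.
  - apply Rmult_le_pos; [left; apply exp_pos|lra].
Qed.

Lemma height_bound_nonneg (p : nat) (g : C -> C) (M : R) : height_bound p g M -> 0 <= M.
Proof.
  intros H. specialize (H Ci). simpl in H. rewrite pow1 in H.
  assert (H1 := Cmod_ge_0 (g Ci)). unfold upper in H. simpl in H. specialize (H Rlt_0_1). lra.
Qed.

Definition head_sum (b : nat -> C) (j : nat) (y : R) : R :=
  sum_f_R0 (fun n => Cmod (b n) * exp (- (2 * PI * y) * INR n)) j.

(* The terms of index [> j] are bounded by Hecke's estimate at height [Im z / 2], whence the
   factor [2 ^ p]. *)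
Lemma qexp_split (p : nat) (b : nat -> C) (g : C -> C) (M : R) (j : nat) (z : C) :
  qexp b g -> height_bound p g M -> upper z ->
  Im z ^ p * Cmod (g z) <= Im z ^ p * head_sum b j (Im z)
     + M * 2 ^ p * exp (- (PI * Im z) * INR (S j)) / (1 - exp (- (PI * Im z))).
Proof.
  intros Hg HM Hz. set (y := Im z). assert (Hy : 0 < y) by exact Hz.
  assert (Hyp : 0 < y ^ p) by (apply pow_lt, Hy).
  assert (HP := PI_RGT_0). assert (Hpy : 0 < PI * y) by nra.
  assert (HM0 := height_bound_nonneg p g M HM).
  assert (H2p : 0 < 2 ^ p) by (apply pow_lt; lra).
  set (c := M * 2 ^ p / y ^ p).
  assert (Hc : 0 <= c).
  { unfold c. apply Rmult_le_pos; [nra|]. left. apply Rinv_0_lt_compat, Hyp. }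
  set (v := fun n => if le_dec n j then Cmod (b n) * exp (- (2 * PI * y) * INR n)
                     else c * exp (- (PI * y) * INR n)).
  assert (Htail : forall k, v (S j + k)%nat = c * exp (- (PI * y) * INR (S j)) * exp (- (PI * y) * INR k)).
  { intros k. unfold v. destruct (le_dec (S j + k) j); [lia|].
    rewrite plus_INR, Rmult_plus_distr_l, exp_plus. ring. }
  assert (Hex : ex_series v).
  { apply (ex_series_incr_n v (S j)).
    eapply ex_series_ext; [intros k; symmetry; apply Htail|]. apply ex_series_Rmult, ex_series_exp, Hpy. }
  assert (H := cseries_Cmod_le _ v _ (Hg z Hz) Hex).
  assert (Hb : forall i, Cmod (b i * Cpow (qpar z) i)%C <= v i).
  { intros i. rewrite Cmod_mult, Cmod_qpar_pow. fold y. unfold v. destruct (le_dec i j); [lra|].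
    assert (Hh := height_bound_hecke p b g M (y / 2) i Hg HM ltac:(lra)).
    unfold Rdiv in Hh at 1. rewrite Rpow_mult_distr, pow_inv in Hh.
    apply Rmult_le_reg_r with (y ^ p * / 2 ^ p).
    { apply Rmult_lt_0_compat; [exact Hyp|apply Rinv_0_lt_compat, H2p]. }
    unfold c. replace (M * 2 ^ p / y ^ p * exp (- (PI * y) * INR i) * (y ^ p * / 2 ^ p))
      with (M * exp (- (PI * y) * INR i)) by (field; lra).
    replace (- (PI * y) * INR i) with (2 * PI * (y / 2) * INR i + - (2 * PI * y) * INR i) by field.
    rewrite exp_plus. assert (E := exp_pos (- (2 * PI * y) * INR i)).
    apply Rmult_le_compat_r with (r := exp (- (2 * PI * y) * INR i)) in Hh; [|lra]. lra. }
  specialize (H Hb).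
  rewrite (Series_incr_n v (S j)) in H by (try lia; exact Hex). simpl pred in H.
  rewrite (Series_ext _ _ Htail), Series_scal_l, (is_series_unique _ _ (is_series_exp _ Hpy)) in H.
  replace (sum_f_R0 v j) with (head_sum b j y) in H.
  - apply Rmult_le_compat_l with (r := y ^ p) in H; [|lra].
    eapply Rle_trans; [exact H|]. right. unfold c.
    assert (exp (- (PI * y)) < 1) by (apply exp_lt_1; lra). field. lra.
  - unfold head_sum. apply sum_eq. intros i Hi. unfold v. destruct (le_dec i j); [reflexivity|lia].
Qed.

(* [28 / 100] bounds [4 exp (- pi y)], and [93 / 100] is below [1 - exp (- pi y)], for
   [y >= 86 / 100]; this height is just below the corner [sqrt 3 / 2] of the fundamental
   domain, so that Gauss reduction gains a fixed factor at each step. *)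
Definition tau (j : nat) : R := (28 / 100) ^ S j / (93 / 100).

Lemma exp_neg_pi_height_le (y : R) : 86 / 100 <= y -> exp (- (PI * y)) <= 7 / 100.
Proof.
  intros Hy. assert (HP := PI_bounds). replace (7 / 100) with (/ (100 / 7)) by field.
  apply exp_neg_le; [lra|].
  apply Rle_trans with (exp 2.7); [|apply exp_le; nra].
  eapply Rle_trans; [|apply (exp_ge_taylor 2.7 7); lra]. simpl. lra.
Qed.

(** Above height [0.86] the tail costs at most [tau j * M], and reduction carries the bound to the
    whole half-plane. For the least [M] this becomes [M <= A + tau j * M]. *)
Lemma height_bound_contract (j : nat) (b : nat -> C) (g : C -> C) (M A : R) :
  qform (4 * S j) b g -> height_bound (2 * S j) g M ->
  (forall y, 86 / 100 <= y -> y ^ (2 * S j) * head_sum b j y <= A) ->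
  height_bound (2 * S j) g (A + tau j * M).
Proof.
  intros Hg HM HA. assert (HM0 := height_bound_nonneg _ _ _ HM).
  apply (height_bound_reduce _ b); [replace (2 * (2 * S j))%nat with (4 * S j)%nat by lia; exact Hg|].
  intros z Hz Hy. eapply Rle_trans; [apply (qexp_split (2 * S j) b g M j z (proj1 Hg) HM Hz)|].
  apply Rplus_le_compat; [apply HA, Hy|].
  assert (E := exp_neg_pi_height_le _ Hy). assert (E0 := exp_pos (- (PI * Im z))).
  rewrite exp_sum_n. set (e := exp _) in *. rewrite pow_mult.
  replace (M * (2 ^ 2) ^ S j * e ^ S j / (1 - e)) with (M * ((4 * e) ^ S j / (1 - e)))
    by (rewrite Rpow_mult_distr; replace (2 ^ 2) with 4 by ring; field; lra).
  rewrite (Rmult_comm (tau j)). apply Rmult_le_compat_l; [exact HM0|].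
  unfold tau. apply Rmult_le_compat.
  - apply pow_le. lra.
  - left. apply Rinv_0_lt_compat. lra.
  - apply pow_incr. lra.
  - apply Rinv_le_contravar; lra.
Qed.

(** Vanishing of [b 0] is essential: every remaining term decays at least as fast as the first power
    of the nome. *)
Lemma head_sum_growth (b : nat -> C) (j : nat) (y y0 : R) :
  b 0%nat = RtoC 0 -> y0 <= y ->
  head_sum b j y <= head_sum b j y0 * exp (- (2 * PI * (y - y0))).
Proof.
  intros Hb Hy. unfold head_sum. rewrite (Rmult_comm (sum_f_R0 _ _)), scal_sum. apply sum_Rle. intros n _.
  destruct n as [|n]; [rewrite Hb, Cmod_0; lra|].
  rewrite (Rmult_assoc (Cmod _)). apply Rmult_le_compat_l; [apply Cmod_ge_0|].
  rewrite <- exp_plus. apply exp_le. rewrite S_INR.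
  assert (HP := PI_RGT_0). assert (Hn := pos_INR n).
  assert (0 <= 2 * PI * (y - y0) * INR n) by (apply Rmult_le_pos; [nra|lra]). lra.
Qed.

Lemma pow_exp_le (p : nat) (y : R) :
  0 <= y -> y ^ p * exp (- (2 * PI * y)) <= (INR p / (2 * PI)) ^ p * exp (- INR p).
Proof.
  intros Hy. assert (HP := PI_RGT_0). assert (H := pow_le_exp_sharp p (2 * PI) y ltac:(lra) Hy).
  apply Rmult_le_compat_r with (r := exp (- (2 * PI * y))) in H; [|left; apply exp_pos].
  rewrite (Rmult_assoc ((INR p / (2 * PI)) ^ p)), <- exp_plus in H.
  replace (2 * PI * y - INR p + - (2 * PI * y)) with (- INR p) in H by ring.
  exact H.
Qed.

(** * Suprema of cusp forms and vanishing criteria *)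

Lemma height_bound_exists (j : nat) (b : nat -> C) (g : C -> C) :
  qform (4 * S j) b g -> b 0%nat = RtoC 0 -> exists M, height_bound (2 * S j) g M.
Proof.
  intros Hg Hb. assert (HP := PI_bounds).
  destruct (qexp_growth b g (1 / 4) (proj1 Hg) ltac:(lra)) as [B [HB HBn]].
  set (p := (2 * S j)%nat).
  set (S1 := Series (fun n => B * exp (- (PI / 2) * INR n))).
  exists (exp (2 * PI * (1 / 2)) * S1 * ((INR p / (2 * PI)) ^ p * exp (- INR p))).
  apply (height_bound_reduce _ b); [unfold p; replace (2 * (2 * S j))%nat with (4 * S j)%nat by lia; exact Hg|].
  intros z Hz Hy. set (y := Im z) in *.
  assert (Hex : ex_series (fun n => B * exp (- (PI / 2) * INR n))).
  { apply ex_series_Rmult, ex_series_exp. lra. }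
  assert (H := cseries_Cmod_le _ (fun n => exp (- (2 * PI * (y - 1 / 2))) * (B * exp (- (PI / 2) * INR n))) _
     (proj1 Hg z Hz) (ex_series_Rmult _ _ Hex)).
  rewrite Series_scal_l in H. fold S1 in H.
  assert (HH : forall i, Cmod (b i * Cpow (qpar z) i)%C <= exp (- (2 * PI * (y - 1 / 2))) * (B * exp (- (PI / 2) * INR i))).
  { intros i. destruct i as [|i].
    - rewrite Hb, Cmult_0_l, Cmod_0. apply Rmult_le_pos; [left; apply exp_pos|].
      apply Rmult_le_pos; [lra|left; apply exp_pos].
    - rewrite Cmod_mult, Cmod_qpar_pow. fold y.
      apply Rle_trans with (B * exp (2 * PI * (1 / 4) * INR (S i)) * exp (- (2 * PI * y) * INR (S i))).
      + apply Rmult_le_compat_r; [left; apply exp_pos|apply HBn].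
      + rewrite (Rmult_assoc B), (Rmult_comm (exp (- (2 * PI * (y - 1 / 2))))), (Rmult_assoc B).
        apply Rmult_le_compat_l; [lra|]. rewrite <- !exp_plus. apply exp_le.
        rewrite S_INR. assert (Hi := pos_INR i).
        assert (0 <= PI * INR i * (y - 1 / 2)) by (apply Rmult_le_pos; [apply Rmult_le_pos|]; lra). lra. }
  specialize (H HH).
  assert (HS1 : 0 <= S1).
  { eapply Rle_trans; [|apply (sum_le_Series _ 0)]; [|intros i; apply Rmult_le_pos; [lra|left; apply exp_pos]|exact Hex].
    simpl. apply Rmult_le_pos; [lra|left; apply exp_pos]. }
  apply Rmult_le_compat_l with (r := y ^ p) in H; [|apply pow_le; lra].
  eapply Rle_trans; [exact H|].
  replace (- (2 * PI * (y - 1 / 2))) with (2 * PI * (1 / 2) + - (2 * PI * y)) by ring.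
  rewrite exp_plus.
  replace (y ^ p * (exp (2 * PI * (1 / 2)) * exp (- (2 * PI * y)) * S1))
    with (exp (2 * PI * (1 / 2)) * S1 * (y ^ p * exp (- (2 * PI * y)))) by ring.
  apply Rmult_le_compat_l; [|apply pow_exp_le; lra].
  apply Rmult_le_pos; [left; apply exp_pos|exact HS1].
Qed.

(** Minimality is what allows a contracted bound to be compared with [M] itself. *)
Lemma height_bound_sup (j : nat) (b : nat -> C) (g : C -> C) :
  qform (4 * S j) b g -> b 0%nat = RtoC 0 ->
  exists M, height_bound (2 * S j) g M /\ forall M', height_bound (2 * S j) g M' -> M <= M'.
Proof.
  intros Hg Hb. destruct (height_bound_exists j b g Hg Hb) as [M0 HM0].
  set (E := fun x => exists z, upper z /\ x = Im z ^ (2 * S j) * Cmod (g z)).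
  destruct (completeness E) as [M [HM1 HM2]].
  - exists M0. intros x [z [Hz ->]]. apply HM0, Hz.
  - exists (Im Ci ^ (2 * S j) * Cmod (g Ci)). exists Ci. split; [exact Rlt_0_1|reflexivity].
  - exists M. split.
    + intros z Hz. apply HM1. exists z. split; [exact Hz|reflexivity].
    + intros M' HM'. apply HM2. intros x [z [Hz ->]]. apply HM', Hz.
Qed.

Lemma tau_le (j : nat) : 0 < tau j <= 31 / 100.
Proof.
  unfold tau. assert (H : 0 < (28 / 100) ^ S j <= 28 / 100).
  { split; [apply pow_lt; lra|]. simpl. assert ((28 / 100) ^ j <= 1).
    { rewrite <- (pow1 j). apply pow_incr. lra. } lra. }
  lra.
Qed.

Lemma tau_decr (i j : nat) : (i <= j)%nat -> tau j <= tau i.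
Proof.
  intros H. induction H as [|j H IH]; [lra|].
  assert (T := tau_le j). unfold tau in *. cbn [pow] in *. lra.
Qed.

Lemma height_bound_0 (j : nat) (b : nat -> C) (g : C -> C) (n : nat) :
  qexp b g -> height_bound (2 * S j) g 0 -> b n = RtoC 0.
Proof.
  intros Hg H. assert (Hh := height_bound_hecke _ b g 0 1 n Hg H ltac:(lra)).
  rewrite pow1 in Hh. apply Cmod_eq_0. assert (H0 := Cmod_ge_0 (b n)). lra.
Qed.

(* In weight [k] this uses the vanishing of [k / 4] coefficients; the valence formula would
   need only about [k / 12]. *)
Lemma cusp_form_vanish (j : nat) (b : nat -> C) (g : C -> C) :
  qform (4 * S j) b g -> (forall n, (n <= j)%nat -> b n = RtoC 0) -> forall n, b n = RtoC 0.
Proof.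
  intros Hg Hb. assert (Hb0 := Hb 0%nat (Nat.le_0_l _)).
  destruct (height_bound_sup j b g Hg Hb0) as [M [HM Hmin]].
  assert (HM0 := height_bound_nonneg _ _ _ HM).
  assert (H := height_bound_contract j b g M 0 Hg HM).
  assert (HT := tau_le j).
  assert (Hhead : forall y, head_sum b j y = 0).
  { intros y. unfold head_sum. rewrite (sum_eq _ (fun _ => 0)).
    - rewrite sum_cte. ring.
    - intros i Hi. rewrite Hb by exact Hi. rewrite Cmod_0. ring. }
  assert (H1 := Hmin _ (H ltac:(intros y _; rewrite Hhead; lra))).
  assert (M = 0) by nra. subst M.
  intros n. apply (height_bound_0 j b g n (proj1 Hg) HM).
Qed.

(** Here [b 1] is not known to vanish. Hecke's bound at height [3 y / 4] gives it a share of at most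
    [(4 / 3) ^ 4 exp (- 1.35) M <= 0.83 M]; together with [tau 1 <= 0.09] this is still a
    contraction. *)
Lemma cusp_form_weight_8 (b : nat -> C) (g : C -> C) :
  qform 8 b g -> b 0%nat = RtoC 0 -> forall n, b n = RtoC 0.
Proof.
  intros Hg Hb0.
  destruct (height_bound_sup 1 b g Hg Hb0) as [M [HM Hmin]].
  assert (HM0 := height_bound_nonneg _ _ _ HM). assert (HP := PI_bounds).
  assert (H := height_bound_contract 1 b g M (83 / 100 * M) Hg HM).
  assert (HA : forall y, 86 / 100 <= y -> y ^ (2 * 2) * head_sum b 1 y <= 83 / 100 * M).
  { intros y Hy. unfold head_sum. simpl sum_f_R0. rewrite Hb0, Cmod_0, Rmult_0_l, Rplus_0_l.
    assert (Hh := height_bound_hecke _ b g M (3 / 4 * y) 1 (proj1 Hg) HM ltac:(lra)).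
    rewrite Rmult_1_r in Hh |- *.
    assert (E : exp (2 * PI * (3 / 4 * y)) * exp (- (2 * PI * y)) <= 26 / 100).
    { rewrite <- exp_plus. apply Rle_trans with (exp (- (1.35))); [apply exp_le; nra|].
      replace (26 / 100) with (/ (100 / 26)) by field. apply exp_neg_le; [lra|].
      eapply Rle_trans; [|apply (exp_ge_taylor 1.35 6); lra]. simpl. lra. }
    apply Rmult_le_compat_r with (r := exp (- (2 * PI * y))) in Hh; [|left; apply exp_pos].
    assert (M * (exp (2 * PI * (3 / 4 * y)) * exp (- (2 * PI * y))) <= M * (26 / 100))
      by (apply Rmult_le_compat_l; assumption).
    change (2 * 2)%nat with 4%nat in *. rewrite Rpow_mult_distr in Hh.
    set (e := exp (- (2 * PI * y))) in *. set (X := Cmod (b 1%nat)) in *. set (Y := y ^ 4) in *.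
    assert (X * ((3 / 4) ^ 4 * Y) * e <= M * (26 / 100)) by lra.
    replace (Y * (X * e)) with (256 / 81 * (X * ((3 / 4) ^ 4 * Y) * e)) by field. lra. }
  assert (H1 := Hmin _ (H HA)).
  assert (tau 1 <= 9 / 100) by (unfold tau; simpl; lra).
  assert (M = 0) by nra. subst M.
  intros n. apply (height_bound_0 1 b g n (proj1 Hg) HM).
Qed.

(** * Numerical estimates *)

Lemma ln_le_exp (x y : R) : 0 < x -> x <= exp y -> ln x <= y.
Proof. intros Hx H. rewrite <- (ln_exp y). apply ln_le; assumption. Qed.

Lemma ln_ge_exp (x y : R) : exp y <= x -> y <= ln x.
Proof. intros H. rewrite <- (ln_exp y). apply ln_le; [apply exp_pos|assumption]. Qed.

Lemma exp_le_pade_pow (t : R) (m : nat) :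
  0 <= t < 2 -> exp (t * INR m) <= ((2 + t) / (2 - t)) ^ m.
Proof.
  intros Ht. rewrite exp_sum_n. apply pow_incr. split; [left; apply exp_pos|apply exp_le_pade, Ht].
Qed.

Lemma exp_ge_taylor_pow (t : R) (m : nat) :
  0 <= t -> (1 + t + t ^ 2 / 2 + t ^ 3 / 6 + t ^ 4 / 24) ^ m <= exp (t * INR m).
Proof.
  intros Ht. rewrite exp_sum_n. apply pow_incr. split.
  - assert (0 <= t ^ 2) by (apply pow_le, Ht). assert (0 <= t ^ 3) by (apply pow_le, Ht).
    assert (0 <= t ^ 4) by (apply pow_le, Ht). lra.
  - eapply Rle_trans; [|apply (exp_ge_taylor t 4), Ht]. simpl. lra.
Qed.

Lemma exp_ge_by_taylor (x t b : R) (m : nat) :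
  x = t * INR m -> 0 <= t -> b <= (1 + t + t ^ 2 / 2 + t ^ 3 / 6 + t ^ 4 / 24) ^ m -> b <= exp x.
Proof. intros -> Ht H. eapply Rle_trans; [exact H|apply exp_ge_taylor_pow, Ht]. Qed.

Lemma ln_tangent (x c : R) : 0 < x -> 0 < c -> ln x <= x / c - 1 + ln c.
Proof.
  intros Hx Hc. replace x with (x / c * c) at 1 by (field; lra).
  rewrite ln_mult; [|apply Rdiv_lt_0_compat; assumption|exact Hc].
  assert (H : ln (x / c) <= x / c - 1); [|lra].
  apply ln_le_exp; [apply Rdiv_lt_0_compat; assumption|].
  assert (H := exp_ineq1_le (x / c - 1)). lra.
Qed.

Definition loglog (x : R) : R := ln x + ln (ln x).

Lemma loglog_le (x c d : R) : 1 < x -> 0 < c -> x <= exp c -> c <= exp d -> loglog x <= c + d.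
Proof.
  intros Hx Hc H1 H2. unfold loglog.
  assert (L1 : ln x <= c) by (apply ln_le_exp; lra).
  assert (L0 : 0 < ln x) by (rewrite <- ln_1; apply ln_increasing; lra).
  assert (L2 : ln (ln x) <= d) by (apply ln_le_exp; lra). lra.
Qed.

Lemma ln_ge_12 (x : R) : 12 <= x -> 2.47 <= ln x.
Proof.
  intros Hx. apply ln_ge_exp. eapply Rle_trans; [|exact Hx].
  replace 2.47 with (0.247 * INR 10) by (simpl; lra).
  eapply Rle_trans; [apply exp_le_pade_pow; lra|]. lra.
Qed.

Lemma loglog_ge_12 (x : R) : 12 <= x -> 3.37 <= loglog x.
Proof.
  intros Hx. assert (H := ln_ge_12 x Hx). unfold loglog.
  assert (0.9 <= ln (ln x)); [|lra].
  apply ln_ge_exp. eapply Rle_trans; [|exact H].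
  replace 0.9 with (0.225 * INR 4) by (simpl; lra).
  eapply Rle_trans; [apply exp_le_pade_pow; lra|]. lra.
Qed.

Lemma exp_1_ge : 2.718 <= exp 1.
Proof. eapply Rle_trans; [|apply (exp_ge_taylor 1 6); lra]. simpl. lra. Qed.

(** The tangent to [ln] at 10, with [ln 10 <= 5 / 2], produces exactly the additive constant
    [3 / 2]. *)
Lemma loglog_sub_le (x : R) : 12 <= x -> loglog x - 3 / 2 <= 11 / 10 * ln x.
Proof.
  intros Hx. assert (H := ln_ge_12 x Hx). unfold loglog.
  assert (T := ln_tangent (ln x) 10 ltac:(lra) ltac:(lra)).
  assert (ln 10 <= 5 / 2); [|lra].
  apply ln_le_exp; [lra|]. apply (exp_ge_by_taylor (5 / 2) ((5 / 2) / 4) _ 4); [simpl; lra|lra|lra].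
Qed.

Lemma exp_loglog (x : R) : 1 < x -> exp (loglog x) = x * ln x.
Proof.
  intros Hx. assert (0 < ln x) by (rewrite <- ln_1; apply ln_increasing; lra).
  unfold loglog. rewrite exp_plus, !exp_ln by lra. reflexivity.
Qed.

(** Stirling's bound in the form suited to [(k - 1)!]; the induction step is
    [e <= (1 + 1 / m) ^ (m + 1)] with [m = n + 1]. *)
Lemma fact_le_exp (n : nat) :
  INR (fact n) <= exp 1 * (INR (S n) / exp 1) ^ S n.
Proof.
  assert (He := exp_pos 1).
  induction n as [|n IH].
  - simpl. right. field. lra.
  - rewrite fact_simpl, mult_INR.
    assert (Hn : 0 < INR (S n)) by (apply lt_0_INR; lia).
    set (m := INR (S n)) in *. rewrite (S_INR (S n)). fold m.
    apply Rle_trans with (m * (exp 1 * (m / exp 1) ^ S n)); [apply Rmult_le_compat_l; lra|].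
    assert (Hk : exp 1 <= ((m + 1) / m) ^ S (S n)).
    { assert (E := exp_ineq1_le (- / (m + 1))).
      assert (E1 : m / (m + 1) <= exp (- / (m + 1))).
      { replace (m / (m + 1)) with (1 + - / (m + 1)) by (field; lra). exact E. }
      rewrite exp_Ropp in E1.
      assert (E2 : exp (/ (m + 1)) <= (m + 1) / m).
      { replace ((m + 1) / m) with (/ (m / (m + 1))) by (field; lra).
        rewrite <- (Rinv_inv (exp _)). apply Rinv_le_contravar; [apply Rdiv_lt_0_compat; lra|exact E1]. }
      replace (exp 1) with (exp (/ (m + 1)) ^ S (S n)).
      - apply pow_incr. split; [left; apply exp_pos|exact E2].
      - rewrite <- exp_sum_n. f_equal. rewrite (S_INR (S n)). fold m. field. lra. }
    assert (Hme : 0 < (m / exp 1) ^ S n) by (apply pow_lt, Rdiv_lt_0_compat; lra).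
    replace (exp 1 * ((m + 1) / exp 1) ^ S (S n))
      with (m * (m / exp 1) ^ S n * ((m + 1) / m) ^ S (S n)).
    + apply Rle_trans with (m * (m / exp 1) ^ S n * exp 1).
      * right. ring.
      * apply Rmult_le_compat_l; [apply Rmult_le_pos; lra|exact Hk].
    + replace ((m + 1) / exp 1) with ((m / exp 1) * ((m + 1) / m)) by (field; lra).
      rewrite (Rpow_mult_distr (m / exp 1)). rewrite <- (tech_pow_Rmult (m / exp 1) (S n)). field. lra.
Qed.

(* A lower bound for [1434 (2 pi e)^4 / 7316^2]. *)
Definition beta : R := 2.27.

(* [4.8] exceeds [50 e 4^4 / 7316]. *)
Lemma main_numeric_aux (q : nat) (l : R) :
  (3 <= q)%nat -> l = loglog (4 * INR q) ->
  4.8 * INR q ^ 4 * l ^ 2 < (beta * (l / (l - 3 / 2)) ^ 4) ^ q.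
Proof.
  intros Hq Hl.
  assert (Hq3 : 3 <= INR q) by (replace 3 with (INR 3) by (simpl; lra); apply le_INR; lia).
  assert (Hl0 : 3.37 <= l) by (rewrite Hl; apply loglog_ge_12; lra).
  (* As [c / (c - 3 / 2)] decreases, upper bounds [c] for [l] suffice on both sides of the
     inequality. *)
  assert (Hmon : forall c, l <= c -> beta * (c / (c - 3 / 2)) ^ 4 <= beta * (l / (l - 3 / 2)) ^ 4).
  { intros c Hc. apply Rmult_le_compat_l; [unfold beta; lra|]. apply pow_incr. split.
    - left. apply Rdiv_lt_0_compat; lra.
    - apply Rmult_le_reg_r with ((c - 3 / 2) * (l - 3 / 2)); [nra|].
      replace (c / (c - 3 / 2) * ((c - 3 / 2) * (l - 3 / 2))) with (c * (l - 3 / 2)) by (field; lra).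
      replace (l / (l - 3 / 2) * ((c - 3 / 2) * (l - 3 / 2))) with (l * (c - 3 / 2)) by (field; lra).
      nra. }
  assert (Hcase : forall c B, l <= c -> 0 <= B -> B <= beta * (c / (c - 3 / 2)) ^ 4 ->
     4.8 * INR q ^ 4 * c ^ 2 < B ^ q -> 4.8 * INR q ^ 4 * l ^ 2 < (beta * (l / (l - 3 / 2)) ^ 4) ^ q).
  { intros c B Hc HB HB2 H. eapply Rle_lt_trans; [|eapply Rlt_le_trans; [exact H|]].
    - apply Rmult_le_compat_l; [|apply pow_incr; lra].
      apply Rmult_le_pos; [lra|apply pow_le; lra].
    - apply pow_incr. split; [exact HB|]. eapply Rle_trans; [exact HB2|apply Hmon, Hc]. }
  assert (Hlc : forall c d Q, INR q <= Q -> 4 * Q <= exp c -> 0 < c -> c <= exp d -> l <= c + d).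
  { intros c d Q H1 H2 H3 H4. rewrite Hl. apply loglog_le; lra. }
  assert (Hin : forall Q, (q <= Q)%nat -> INR q <= INR Q) by (intros; apply le_INR; assumption).
  (* The base shrinks as [q] grows while the polynomial factor matters less: 22.8 for 3, 16.9 for 4,
     12 up to 6, 7 up to 24; beyond that [beta] alone suffices. *)
  destruct (le_lt_dec q 3) as [H3|H3].
  { replace q with 3%nat in * by lia. simpl INR in *.
    apply (Hcase 3.42 22.8).
    - replace 3.42 with (2.49 + 0.93) by lra. apply (Hlc _ _ 3); [lra| |lra|].
      + apply (exp_ge_by_taylor 2.49 (2.49 / 6) _ 6); [simpl; lra|lra|lra].
      + apply (exp_ge_by_taylor 0.93 (0.93 / 4) _ 4); [simpl; lra|lra|lra].
    - lra.
    - unfold beta. lra.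
    - lra. }
  destruct (le_lt_dec q 4) as [H4|H4].
  { replace q with 4%nat in * by lia. simpl INR in *.
    apply (Hcase 3.80 16.9).
    - replace 3.80 with (2.775 + 1.025) by lra. apply (Hlc _ _ 4); [lra| |lra|].
      + apply (exp_ge_by_taylor 2.775 (2.775 / 8) _ 8); [simpl; lra|lra|lra].
      + apply (exp_ge_by_taylor 1.025 (1.025 / 4) _ 4); [simpl; lra|lra|lra].
    - lra.
    - unfold beta. lra.
    - lra. }
  destruct (le_lt_dec q 6) as [H6|H6].
  { assert (HQ := Hin 6%nat H6). simpl INR in HQ.
    apply (Hcase 4.4 12).
    - replace 4.4 with (3.2 + 1.2) by lra. apply (Hlc _ _ 6); [lra| |lra|].
      + apply (exp_ge_by_taylor 3.2 (3.2 / 6) _ 6); [simpl; lra|lra|lra].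
      + apply (exp_ge_by_taylor 1.2 (1.2 / 4) _ 4); [simpl; lra|lra|lra].
    - lra.
    - unfold beta. lra.
    - assert (q = 5%nat \/ q = 6%nat) as [-> | ->] by lia; simpl; lra. }
  destruct (le_lt_dec q 24) as [H24|H24].
  { assert (HQ := Hin 24%nat H24). replace (INR 24) with 24 in HQ by (simpl; lra).
    apply (Hcase 6.1 7).
    - replace 6.1 with (4.57 + 1.53) by lra. apply (Hlc _ _ 24); [lra| |lra|].
      + apply (exp_ge_by_taylor 4.57 (4.57 / 10) _ 10); [simpl; lra|lra|lra].
      + apply (exp_ge_by_taylor 1.53 (1.53 / 4) _ 4); [simpl; lra|lra|lra].
    - lra.
    - unfold beta. lra.
    - clear -H6. replace (6.1 ^ 2) with 37.21 by lra.
      induction H6 as [|q H6 IH]; [simpl; lra|].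
      rewrite S_INR. simpl pow at 2. assert (7 <= INR q) by (replace 7 with (INR 7) by (simpl; lra); apply le_INR; lia).
      assert ((INR q + 1) ^ 4 <= 7 * INR q ^ 4); [|simpl pow in *; lra].
      replace 7 with (1.6 ^ 4 + (7 - 1.6 ^ 4)) by lra.
      assert ((INR q + 1) ^ 4 <= (1.6 * INR q) ^ 4) by (apply pow_incr; lra).
      rewrite Rpow_mult_distr in H0. assert (0 < INR q ^ 4) by (apply pow_lt; lra). lra. }
  assert (Hq24 : 25 <= INR q) by (replace 25 with (INR 25) by (simpl; lra); apply le_INR; lia).
  (* Tangents to [ln] at [96 = 4 * 24] and at [4.5], close to [ln 96], make the bound linear in [q],
     so that a multiple of [q ^ 6] is left against [beta ^ q]. *)
  assert (HLq : l <= INR q / 3.9).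
  { rewrite Hl. unfold loglog.
    assert (T1 := ln_tangent (4 * INR q) 96 ltac:(lra) ltac:(lra)).
    assert (L96 : ln 96 <= 4.57).
    { apply ln_le_exp; [lra|]. apply (exp_ge_by_taylor 4.57 (4.57 / 10) _ 10); [simpl; lra|lra|lra]. }
    assert (Hu : 0 < ln (4 * INR q)) by (assert (H := ln_ge_12 (4 * INR q) ltac:(lra)); lra).
    assert (T2 := ln_tangent (ln (4 * INR q)) 4.5 Hu ltac:(lra)).
    assert (L45 : ln 4.5 <= 1.51).
    { apply ln_le_exp; [lra|]. apply (exp_ge_by_taylor 1.51 (1.51 / 4) _ 4); [simpl; lra|lra|lra]. }
    lra. }
  apply Rlt_le_trans with (beta ^ q).
  - apply Rle_lt_trans with (4.8 * INR q ^ 4 * (INR q / 3.9) ^ 2).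
    + apply Rmult_le_compat_l; [apply Rmult_le_pos; [lra|apply pow_le; lra]|apply pow_incr; lra].
    + apply Rle_lt_trans with (0.316 * INR q ^ 6).
      * replace (4.8 * INR q ^ 4 * (INR q / 3.9) ^ 2) with (4.8 / 3.9 ^ 2 * INR q ^ 6) by (field; lra).
        apply Rmult_le_compat_r; [apply pow_le; lra|lra].
      * clear -H24. unfold beta. induction H24 as [|q H IH]; [simpl; lra|].
        assert (24 <= INR q) by (replace 24 with (INR 24) by (simpl; lra); apply le_INR; lia).
        rewrite S_INR. simpl pow at 2.
        assert ((INR q + 1) ^ 6 <= 2.27 * INR q ^ 6); [|lra].
        assert (E : (INR q + 1) ^ 6 <= (1.1 * INR q) ^ 6) by (apply pow_incr; lra).
        rewrite Rpow_mult_distr in E. assert (0 < INR q ^ 6) by (apply pow_lt; lra). lra.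
  - apply pow_incr. split; [unfold beta; lra|].
    assert (1 <= (l / (l - 3 / 2)) ^ 4); [|unfold beta; lra].
    apply pow_R1_Rle. apply Rmult_le_reg_r with (l - 3 / 2); [lra|].
    replace (l / (l - 3 / 2) * (l - 3 / 2)) with l by (field; lra). lra.
Qed.

Lemma exp_1_le : exp 1 <= 2.733.
Proof.
  replace 1 with (1 / 4 * INR 4) by (simpl; lra).
  eapply Rle_trans; [apply exp_le_pade_pow; lra|]. lra.
Qed.

(** Multiplied by the threshold [x0], the right-hand side at [x = x0] is [(c x0 ^ 2) ^ q], and
    Stirling's bound makes the left-hand side [50 e x0 D ^ q]. In [c x0 ^ 2 / D] all powers of [K]
    cancel, which dictates the shape of the threshold; the leftover [x0] is what [main_numeric_aux]
    absorbs. *)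
Lemma main_numeric (j : nat) (c x : R) :
  (2 <= j)%nat -> 1434 <= c ->
  let K := 4 * INR (S j) in
  / 7316 * K ^ 4 * loglog K ^ 2 <= x ->
  50 * INR (fact (4 * j + 3)) * (K * (loglog K - 3 / 2) / (2 * PI)) ^ (4 * S j)
    < c ^ S j * x ^ (2 * j + 1).
Proof.
  intros Hj Hc K Hx.
  assert (Hq : 3 <= INR (S j)) by (replace 3 with (INR 3) by (simpl; lra); apply le_INR; lia).
  assert (Hl := loglog_ge_12 K ltac:(unfold K; lra)).
  assert (Hmain := main_numeric_aux (S j) (loglog K) ltac:(lia) eq_refl).
  set (l := loglog K) in *. set (v := l - 3 / 2) in *.
  assert (Hv : 1.87 <= v) by (unfold v; lra).
  assert (HK : 12 <= K) by (unfold K; lra).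
  set (x0 := / 7316 * K ^ 4 * l ^ 2) in *.
  assert (HK4 : 0 < K ^ 4) by (apply pow_lt; lra).
  assert (Hl2 : 0 < l ^ 2) by (apply pow_lt; lra).
  assert (Hx0 : 0 < x0) by (unfold x0; apply Rmult_lt_0_compat; [lra|exact Hl2]).
  assert (He1 := exp_1_le). assert (He2 := exp_1_ge). set (e := exp 1) in *.
  assert (HP := PI_bounds).
  assert (Hf : INR (fact (4 * j + 3)) <= e * (K / e) ^ (4 * S j)).
  { eapply Rle_trans; [apply fact_le_exp|]. fold e. replace (S (4 * j + 3)) with (4 * S j)%nat by lia.
    right. do 3 f_equal. unfold K. rewrite mult_INR. simpl. ring. }
  assert (HKe : 0 < K / e) by (apply Rdiv_lt_0_compat; lra).
  assert (HKv : 0 < K * v / (2 * PI)) by (apply Rdiv_lt_0_compat; nra).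
  set (D := (K / e * (K * v / (2 * PI))) ^ 4).
  assert (HD : 0 < D) by (apply pow_lt, Rmult_lt_0_compat; assumption).
  apply Rle_lt_trans with (50 * e * D ^ S j).
  { unfold D. rewrite <- pow_mult, Rpow_mult_distr.
    rewrite <- Rmult_assoc. apply Rmult_le_compat_r; [apply pow_le; lra|]. lra. }
  apply Rlt_le_trans with (c ^ S j * x0 ^ (2 * j + 1)).
  2:{ apply Rmult_le_compat_l; [apply pow_le; lra|]. apply pow_incr. lra. }
  apply Rmult_lt_reg_r with x0; [exact Hx0|].
  replace (c ^ S j * x0 ^ (2 * j + 1) * x0) with ((c * x0 ^ 2) ^ S j).
  2:{ rewrite Rpow_mult_distr, <- pow_mult. replace (2 * S j)%nat with (2 * j + 1 + 1)%nat by lia.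
      rewrite (pow_add x0 (2 * j + 1) 1), pow_1. ring. }
  replace (c * x0 ^ 2) with (D * (c * x0 ^ 2 / D)) by (field; lra).
  rewrite (Rpow_mult_distr D).
  assert (HW : beta * (l / v) ^ 4 <= c * x0 ^ 2 / D).
  { replace (c * x0 ^ 2 / D) with (c * (2 * PI * e) ^ 4 / 7316 ^ 2 * (l / v) ^ 4).
    2:{ unfold D, x0. field. repeat split; lra. }
    apply Rmult_le_compat_r; [apply pow_le; left; apply Rdiv_lt_0_compat; lra|].
    assert (H1 : (2 * 3.14 * 2.718) ^ 4 <= (2 * PI * e) ^ 4) by (apply pow_incr; nra).
    apply Rle_trans with (1434 * (2 * 3.14 * 2.718) ^ 4 / 7316 ^ 2); [unfold beta; lra|].
    apply Rmult_le_compat_r; [lra|]. apply Rmult_le_compat; lra. }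
  assert (HWq : (beta * (l / v) ^ 4) ^ S j <= (c * x0 ^ 2 / D) ^ S j).
  { apply pow_incr. split; [|exact HW]. apply Rmult_le_pos; [unfold beta; lra|].
    apply pow_le. left. apply Rdiv_lt_0_compat; lra. }
  assert (HDq : 0 < D ^ S j) by (apply pow_lt, HD).
  assert (H50 : 50 * e * x0 <= 4.8 * INR (S j) ^ 4 * l ^ 2).
  { unfold x0, K. replace (50 * e * (/ 7316 * (4 * INR (S j)) ^ 4 * l ^ 2))
      with (50 * e * 256 / 7316 * (INR (S j) ^ 4 * l ^ 2)) by field.
    rewrite (Rmult_assoc 4.8).
    apply Rmult_le_compat_r; [apply Rmult_le_pos; [apply pow_le; lra|lra]|]. lra. }
  replace (50 * e * D ^ S j * x0) with (D ^ S j * (50 * e * x0)) by ring.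
  apply Rmult_lt_compat_l; [exact HDq|]. lra.
Qed.

(** * Size of powers of E4 high in the upper half-plane *)

Lemma sigma3_le (N : nat) : sigma3 N <= INR N ^ 4.
Proof.
  destruct N as [|m]; [simpl; lra|]. unfold sigma3.
  apply Rle_trans with (sum_f_R0 (fun _ => INR (S m) ^ 3) m).
  - apply sum_Rle. intros i _. unfold divisor_cube. destruct (Nat.eq_dec _ _).
    + apply pow_incr. split; [apply pos_INR|]. apply le_INR. apply Nat.Div0.div_le_upper_bound. nia.
    + apply pow_le, pos_INR.
  - rewrite sum_cte. right. ring.
Qed.

Lemma e4_const_le : e4_const <= 263.
Proof.
  unfold e4_const, kappa4. assert (HP := PI_bounds). assert (H1 := zeta4_ge).
  assert (H4 : PI ^ 4 <= 3.15 ^ 4) by (apply pow_incr; lra).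
  apply Rmult_le_reg_r with zeta4; [lra|].
  replace (8 * PI ^ 4 / 3 / zeta4 * zeta4) with (8 * PI ^ 4 / 3) by (field; lra).
  lra.
Qed.

Lemma Cmod_E4_le (z : C) : 1 <= Im z -> Cmod (E4 z) <= 1 + 1000 * exp (- (2 * PI * (Im z - 1))).
Proof.
  intros Hy. assert (HP := PI_bounds). assert (Hz : upper z) by (unfold upper; lra).
  assert (H := proj1 E4_qform z Hz).
  replace (E4 z) with (RtoC (e4 0) * Cpow (qpar z) 0 + (E4 z - 1))%C in H |- * by (simpl; ring).
  apply (cseries_shift (fun n => RtoC (e4 n) * Cpow (qpar z) n)%C) in H.
  set (d := exp (- (2 * PI * (Im z - 1)))). assert (Hd : 0 < d) by apply exp_pos.
  (* [5.28 = 2 * 3.14 - 1]: the decay per term at height 1, less the growth in [n ^ 4 <= 256 exp n].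
     The constant [67400] rounds up [263 * 256]. *)
  assert (Ht : exists t, t = 5.28) by (eexists; reflexivity). destruct Ht as [t Ht].
  set (r := exp (- t)).
  assert (Hr : 0 < r <= 1 / 100).
  { split; [apply exp_pos|]. unfold r. replace (1 / 100) with (/ 100) by field. apply exp_neg_le; [lra|].
    rewrite Ht. apply (exp_ge_by_taylor 5.28 (5.28 / 8) 100 8); [simpl; lra|lra|lra]. }
  assert (Hb : forall n, Cmod (RtoC (e4 (S n)) * Cpow (qpar z) (S n))%C <= d * 67400 * r * exp (- t * INR n)).
  { intros n. rewrite Cmod_mult, Cmod_qpar_pow, Cmod_RtoC_nonneg by apply e4_nonneg.
    assert (Hs : e4 (S n) <= 67400 * exp (INR (S n))).
    { unfold e4. assert (A := sigma3_le (S n)). assert (B := pow_le_exp 4 1 (INR (S n)) ltac:(lra) (pos_INR _)).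
      rewrite Rmult_1_l in B. replace ((INR 4 / 1) ^ 4) with 256 in B by (simpl; field).
      assert (Ec := e4_const_le). assert (Ec0 := e4_const_pos). assert (S0 := sigma3_nonneg (S n)).
      assert (E0 := exp_pos (INR (S n))).
      apply Rle_trans with (263 * (256 * exp (INR (S n)))); [apply Rmult_le_compat; lra|lra]. }
    apply Rle_trans with (67400 * exp (INR (S n)) * exp (- (2 * PI * Im z) * INR (S n))).
    - apply Rmult_le_compat_r; [left; apply exp_pos|exact Hs].
    - replace (d * 67400 * r * exp (- t * INR n)) with (67400 * (d * (r * exp (- t * INR n)))) by ring.
      rewrite (Rmult_assoc 67400). apply Rmult_le_compat_l; [lra|]. unfold d, r. rewrite <- !exp_plus.
      apply exp_le. rewrite S_INR, Ht. assert (Hn := pos_INR n).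
      assert (0 <= PI * (Im z - 1) * INR n) by (apply Rmult_le_pos; [apply Rmult_le_pos|]; lra).
      assert (3.14 * INR n <= PI * INR n) by (apply Rmult_le_compat_r; lra). lra. }
  assert (Hl := cseries_Cmod_le _ _ _ H (ex_series_Rmult _ _ (ex_series_exp t ltac:(lra))) Hb).
  rewrite Series_scal_l, (is_series_unique _ _ (is_series_exp t ltac:(lra))) in Hl. fold r in Hl.
  eapply Rle_trans; [apply Cmod_triangle|]. apply Rplus_le_compat.
  - simpl. rewrite Cmult_1_r, Cmod_1. lra.
  - eapply Rle_trans; [exact Hl|].
    apply Rmult_le_reg_r with (1 - r); [lra|]. rewrite Rmult_assoc, Rinv_l by lra.
    assert (d * (67400 * r) <= d * (1000 * (1 - r))) by (apply Rmult_le_compat_l; lra). lra.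
Qed.

Lemma Cmod_E4pow (j : nat) (z : C) : Cmod (E4pow j z) = Cmod (E4 z) ^ S j.
Proof.
  induction j as [|j IH]; [simpl; ring|].
  cbn [E4pow]. rewrite Cmod_mult, IH. simpl. ring.
Qed.

(** [7.48 = 4 * 1.87] comes from [2 pi y1 = K v] with [v >= 1.87]. The proof bounds the power by
    [exp (d q)], with [d q <= 0.005]. *)
Lemma Cmod_E4pow_le (j : nat) (z : C) :
  (2 <= j)%nat -> 7.48 * INR (S j) <= 2 * PI * Im z -> Cmod (E4pow j z) <= 1.01.
Proof.
  intros Hj Hy. assert (HP := PI_bounds).
  assert (Hq : 3 <= INR (S j)) by (replace 3 with (INR 3) by (simpl; lra); apply le_INR; lia).
  set (q := INR (S j)) in *.
  assert (Hy1 : 1 <= Im z).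
  { apply Rmult_le_reg_l with (2 * PI); lra. }
  rewrite Cmod_E4pow. set (d := 1000 * exp (- (2 * PI * (Im z - 1)))).
  assert (Hd : 0 < d) by (unfold d; assert (E := exp_pos (- (2 * PI * (Im z - 1)))); lra).
  apply Rle_trans with (exp d ^ S j).
  { apply pow_incr. split; [apply Cmod_ge_0|]. eapply Rle_trans; [apply Cmod_E4_le, Hy1|]. apply exp_ineq1_le. }
  rewrite <- exp_sum_n. fold q.
  assert (Hdq : d * q <= 0.005).
  { unfold d. rewrite Rmult_assoc.
    apply Rle_trans with (1000 * (exp (6.3 - 7.48 * q) * exp q)).
    - apply Rmult_le_compat_l; [lra|]. apply Rmult_le_compat; [left; apply exp_pos|lra|apply exp_le; lra|].
      assert (H := exp_ineq1_le q). lra.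
    - rewrite <- exp_plus. apply Rle_trans with (1000 * exp (- (13))).
      + apply Rmult_le_compat_l; [lra|]. apply exp_le. lra.
      + assert (exp (- (13)) <= / 200000); [|lra].
        apply exp_neg_le; [lra|]. apply (exp_ge_by_taylor 13 (13 / 13) 200000 13); [simpl; lra|lra|lra]. }
  apply Rle_trans with (exp 0.005); [apply exp_le, Hdq|].
  eapply Rle_trans; [apply exp_le_pade; lra|]. lra.
Qed.

(** * The contraction constants of the main argument *)

(* The height [y1] is chosen so that [y1 ^ K exp (- 2 pi y1)] is exponentially small
   (lemma [theta1_le]): the shift [3/2] has to stay below [ln (2 pi)]. *)
Lemma y1_facts (j : nat) :
  (2 <= j)%nat ->
  let K := 4 * INR (S j) in
  let v := loglog K - 3 / 2 in
  let y1 := K * v / (2 * PI) in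
  12 <= K /\ 1.87 <= v /\ 3.37 <= loglog K /\ 2 * PI * y1 = K * v /\ 22.44 <= K * v /\ 3.5 <= y1.
Proof.
  intros Hj K v y1.
  assert (Hq : 3 <= INR (S j)) by (replace 3 with (INR 3) by (simpl; lra); apply le_INR; lia).
  assert (HK : 12 <= K) by (unfold K; lra).
  assert (Hl := loglog_ge_12 K HK). assert (HP := PI_bounds).
  assert (Hv : 1.87 <= v) by (unfold v; lra).
  assert (E : 2 * PI * y1 = K * v) by (unfold y1; field; lra).
  assert (HKv : 22.44 <= K * v) by nra.
  repeat split; try assumption.
  apply Rmult_le_reg_l with (2 * PI); [lra|]. rewrite E. lra.
Qed.

Lemma exp_y0_le (y1 : R) : 22.44 <= 2 * PI * y1 -> exp (2 * PI * / y1) <= 6.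
Proof.
  intros H. assert (HP := PI_bounds).
  assert (Hy : 3.5 <= y1) by (apply Rmult_le_reg_l with (2 * PI); lra).
  assert (E : 2 * PI * / y1 <= 0.2223 * INR 8).
  { apply Rmult_le_reg_r with y1; [lra|]. rewrite Rmult_assoc, Rinv_l, Rmult_1_r by lra.
    apply Rmult_le_reg_l with (2 * PI); [lra|].
    replace (2 * PI * (0.2223 * INR 8 * y1)) with (0.2223 * INR 8 * (2 * PI * y1)) by ring.
    apply Rle_trans with (0.2223 * INR 8 * 22.44); [|apply Rmult_le_compat_l; simpl; lra].
    simpl. nra. }
  eapply Rle_trans; [apply exp_le, E|]. eapply Rle_trans; [apply exp_le_pade_pow; lra|]. lra.
Qed.

(** The share of [A] from the head of [g] at [i y1]. As [exp (loglog K) = K ln K], the product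
    [y1 exp (- v)] equals [exp (3 / 2) v / (2 pi ln K) <= 0.8], and its [K]-th power, [K >= 12],
    outweighs the factor 6. *)
Lemma theta1_le (j : nat) :
  (2 <= j)%nat ->
  let K := 4 * INR (S j) in
  let y1 := K * (loglog K - 3 / 2) / (2 * PI) in
  y1 ^ (4 * S j) * exp (- (2 * PI * (y1 - / y1))) <= 0.42.
Proof.
  intros Hj K y1. destruct (y1_facts j Hj) as (HK & Hv & Hl & E & HKv & Hy).
  fold K in HK, Hv, Hl, E, HKv, Hy. fold y1 in E, Hy.
  set (l := loglog K) in *. set (v := l - 3 / 2) in *.
  assert (HP := PI_bounds).
  assert (He := exp_y0_le y1 ltac:(lra)).
  replace (- (2 * PI * (y1 - / y1))) with (- (2 * PI * y1) + 2 * PI * / y1) by ring.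
  rewrite exp_plus, E.
  assert (HKn : K = INR (4 * S j)) by (rewrite mult_INR; unfold K; simpl; ring).
  assert (Ev : exp (- (K * v)) = exp (- v) ^ (4 * S j)).
  { rewrite <- exp_sum_n, <- HKn. f_equal. ring. }
  rewrite Ev, <- Rmult_assoc, <- Rpow_mult_distr.
  assert (Hln := ln_ge_12 K HK).
  assert (Hb : 0 <= y1 * exp (- v) <= 0.8).
  { split; [apply Rmult_le_pos; [lra|left; apply exp_pos]|].
    replace (- v) with (3 / 2 + - l) by (unfold v; ring). rewrite exp_plus, exp_Ropp.
    assert (Hel : exp l = K * ln K) by (apply exp_loglog; lra). rewrite Hel.
    assert (H15 : exp (3 / 2) <= 4.52).
    { replace (3 / 2) with (1 / 4 * INR 6) by (simpl; lra).
      eapply Rle_trans; [apply exp_le_pade_pow; lra|]. lra. }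
    assert (Hvl := loglog_sub_le K HK). fold l in Hvl. fold v in Hvl.
    replace (y1 * (exp (3 / 2) * / (K * ln K))) with (exp (3 / 2) * v / (2 * PI * ln K)) by (unfold y1; field; lra).
    apply Rmult_le_reg_r with (2 * PI * ln K); [nra|].
    unfold Rdiv at 1. rewrite Rmult_assoc, Rinv_l, Rmult_1_r by nra.
    apply Rle_trans with (4.52 * (11 / 10 * ln K)).
    - apply Rmult_le_compat; [left; apply exp_pos|lra|exact H15|exact Hvl].
    - nra. }
  apply Rle_trans with (0.8 ^ (4 * S j) * 6).
  - apply Rmult_le_compat; [apply pow_le; lra|left; apply exp_pos|apply pow_incr; exact Hb|exact He].
  - replace (4 * S j)%nat with (12 + (4 * S j - 12))%nat by lia. rewrite pow_add.
    assert (0 < 0.8 ^ (4 * S j - 12) <= 1).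
    { split; [apply pow_lt; lra|]. rewrite <- (pow1 (4 * S j - 12)). apply pow_incr. lra. }
    assert (0.8 ^ 12 <= 0.07) by lra. nra.
Qed.

(** The share from the tail of [g] at [i y1], after [M] is replaced by its bound in terms of [A].
    The [p]-th powers combine into [w ^ p] with [w = 4 s ^ 2 exp (- s - 1) / (pi ^ 2 v)],
    [s = pi y1 / 2], and [s ^ 2 exp (- s) <= 4]. *)
Lemma theta2_le (j : nat) :
  (2 <= j)%nat ->
  let K := 4 * INR (S j) in
  let y1 := K * (loglog K - 3 / 2) / (2 * PI) in
  let p := (2 * S j)%nat in
  (2 * y1) ^ p * exp (- (PI * y1) * INR (S j)) / (1 - exp (- (PI * y1)))
    * (exp (2 * PI * / y1) * ((INR p / (2 * PI)) ^ p * exp (- INR p))) <= 0.02.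
Proof.
  intros Hj K y1 p. destruct (y1_facts j Hj) as (HK & Hv & Hl & E & HKv & Hy).
  fold K in HK, Hv, Hl, E, HKv, Hy. fold y1 in E, Hy.
  set (l := loglog K) in *. set (v := l - 3 / 2) in *.
  assert (HP := PI_bounds).
  assert (He := exp_y0_le y1 ltac:(lra)).
  assert (Hpn : INR p = 2 * INR (S j)) by (unfold p; rewrite mult_INR; simpl; ring).
  set (P := INR p) in *.
  assert (HKP : K = 2 * P) by (unfold K; lra).
  set (s := PI * y1 / 2).
  assert (Hs : s = P * v / 2) by (unfold s, y1; rewrite HKP; field; lra).
  assert (E1 : exp (- (PI * y1) * INR (S j)) = exp (- s) ^ p).
  { rewrite <- exp_sum_n. fold P. f_equal. unfold s. rewrite Hpn. field. }
  assert (E2 : exp (- P) = exp (- 1) ^ p).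
  { rewrite <- exp_sum_n. fold P. f_equal. ring. }
  rewrite E1, E2.
  set (w := 2 * y1 * exp (- s) * (P / (2 * PI)) * exp (- 1)).
  assert (Hw : 0 <= w <= 1 / 3).
  { assert (A1 := exp_pos (- s)). assert (A2 := exp_pos (- 1)).
    assert (HPv : 0 < P) by lra.
    split.
    - unfold w. assert (0 < P / (2 * PI)) by (apply Rdiv_lt_0_compat; lra).
      apply Rmult_le_pos; [apply Rmult_le_pos; [apply Rmult_le_pos|]|]; lra.
    - assert (B := pow_le_exp 2 1 s ltac:(lra) ltac:(rewrite Hs; nra)).
      rewrite Rmult_1_l in B. replace ((INR 2 / 1) ^ 2) with 4 in B by (simpl; field).
      assert (B2 : s ^ 2 * exp (- s) <= 4).
      { apply Rle_trans with (4 * exp s * exp (- s)); [apply Rmult_le_compat_r; lra|].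
        rewrite Rmult_assoc, <- exp_plus. replace (s + - s) with 0 by ring. rewrite exp_0. lra. }
      assert (Ee : exp (- 1) <= / 2.718) by (apply exp_neg_le; [lra|apply exp_1_ge]).
      replace w with (4 * (s ^ 2 * exp (- s)) * exp (- 1) / (PI ^ 2 * v)).
      + apply Rmult_le_reg_r with (PI ^ 2 * v); [nra|].
        unfold Rdiv at 1. rewrite Rmult_assoc, Rinv_l, Rmult_1_r by nra.
        apply Rle_trans with (4 * 4 * / 2.718); [apply Rmult_le_compat; [nra|lra|lra|exact Ee]|].
        assert (9.85 <= PI ^ 2) by nra. nra.
      + unfold w. replace y1 with (P * v / PI) by (unfold y1; rewrite HKP; field; lra).
        rewrite Hs. field. lra. }
  assert (Ha : exp (- (PI * y1)) <= / 2).
  { apply exp_neg_le; [lra|]. assert (B := exp_ineq1_le (PI * y1)). nra. }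
  replace ((2 * y1) ^ p * exp (- s) ^ p / (1 - exp (- (PI * y1))) *
    (exp (2 * PI * / y1) * ((P / (2 * PI)) ^ p * exp (- 1) ^ p)))
    with (w ^ p * (/ (1 - exp (- (PI * y1))) * exp (2 * PI * / y1)))
    by (unfold w; rewrite !Rpow_mult_distr; unfold Rdiv; ring).
  apply Rle_trans with ((1 / 3) ^ 6 * (2 * 6)).
  - apply Rmult_le_compat.
    + apply pow_le. lra.
    + apply Rmult_le_pos; [left; apply Rinv_0_lt_compat; lra|left; apply exp_pos].
    + apply Rle_trans with ((1 / 3) ^ p); [apply pow_incr, Hw|].
      unfold p. replace (2 * S j)%nat with (6 + (2 * S j - 6))%nat by lia. rewrite pow_add.
      assert (0 < (1 / 3) ^ (2 * S j - 6) <= 1).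
      { split; [apply pow_lt; lra|]. apply Rle_trans with (1 ^ (2 * S j - 6)); [apply pow_incr; lra|rewrite pow1; lra]. }
      assert (0 < (1 / 3) ^ 6) by (apply pow_lt; lra). nra.
    + apply Rmult_le_compat; [left; apply Rinv_0_lt_compat; lra|left; apply exp_pos| |exact He].
      replace 2 with (/ / 2) by field. apply Rinv_le_contravar; lra.
  - lra.
Qed.

Lemma inv_one_minus_exp_le (t : R) : 0 < t -> / (1 - exp (- t)) <= 1 + / t.
Proof.
  intros Ht. assert (H := exp_neg_le t (1 + t) ltac:(lra) (exp_ineq1_le t)).
  assert (E : / (1 + t) = 1 - t / (1 + t)) by (field; lra).
  assert (H1 : 0 < t / (1 + t)) by (apply Rdiv_lt_0_compat; lra).
  replace (1 + / t) with (/ (t / (1 + t))) by (field; lra).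
  apply Rinv_le_contravar; lra.
Qed.

(** The share from the terms of [f (i y0)] beyond the range of known signs, whose length enters
    here: the exponent is at least [19 P l], as [2 pi ^ 2 >= 19], against growth of at most
    [exp (5 P l)] from the other factors, up to the constant 6. *)
Lemma theta3_le (j : nat) :
  (2 <= j)%nat ->
  let K := 4 * INR (S j) in
  let y1 := K * (loglog K - 3 / 2) / (2 * PI) in
  let p := (2 * S j)%nat in
  (2 * y1) ^ p * exp (- (PI * / y1 / 2) * (K ^ 2 * loglog K ^ 2)) / (1 - exp (- (PI * / y1 / 2)))
    * (exp (2 * PI * / y1) * ((INR p / (2 * PI)) ^ p * exp (- INR p))) <= 0.03.
Proof.
  intros Hj K y1 p. destruct (y1_facts j Hj) as (HK & Hv & Hl & E & HKv & Hy).
  fold K in HK, Hv, Hl, E, HKv, Hy. fold y1 in E, Hy.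
  set (l := loglog K) in *. set (v := l - 3 / 2) in *.
  assert (Hvl : v <= l) by (unfold v; lra).
  assert (HP := PI_bounds).
  assert (He := exp_y0_le y1 ltac:(lra)).
  assert (Hpn : INR p = 2 * INR (S j)) by (unfold p; rewrite mult_INR; simpl; ring).
  set (P := INR p) in *.
  assert (HKP : K = 2 * P) by (unfold K; lra).
  assert (HPl : 20.2 <= P * l) by nra.
  set (t := PI * / y1 / 2). assert (Ht : 0 < t).
  { unfold t. assert (0 < / y1) by (apply Rinv_0_lt_compat; lra). nra. }
  assert (Hinv : / (1 - exp (- t)) <= exp (2 * (P * l))).
  { eapply Rle_trans; [apply inv_one_minus_exp_le, Ht|].
    eapply Rle_trans; [|apply exp_ineq1_le].
    apply Rplus_le_compat_l. unfold t.
    replace (/ (PI * / y1 / 2)) with (K * v / PI ^ 2) by (unfold y1; field; lra).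
    apply Rmult_le_reg_r with (PI ^ 2); [nra|]. unfold Rdiv. rewrite Rmult_assoc, Rinv_l, Rmult_1_r by nra.
    rewrite HKP. assert (P * v <= P * l) by (apply Rmult_le_compat_l; lra).
    assert (1 <= PI ^ 2) by nra. nra. }
  assert (Hdec : - t * (K ^ 2 * l ^ 2) <= - (19 * (P * l))).
  { assert (H : 19 * (P * l) <= t * (K ^ 2 * l ^ 2)); [|lra].
    replace (t * (K ^ 2 * l ^ 2)) with (PI ^ 2 * (2 * (P * l)) * (l / v))
      by (unfold t, y1; rewrite HKP; field; lra).
    assert (1 <= l / v).
    { apply Rmult_le_reg_r with v; [lra|]. unfold Rdiv. rewrite Rmult_assoc, Rinv_l; lra. }
    assert (9.5 <= PI ^ 2) by nra.
    apply Rle_trans with (PI ^ 2 * (2 * (P * l)) * 1); [nra|].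
    apply Rmult_le_compat_l; nra. }
  assert (Hbase : (2 * y1) ^ p * ((P / (2 * PI)) ^ p * exp (- P)) <= exp (3 * (P * l))).
  { apply Rle_trans with ((2 * y1 * (P / (2 * PI))) ^ p).
    - rewrite (Rpow_mult_distr (2 * y1)), <- Rmult_assoc.
      assert (exp (- P) <= 1) by (left; apply exp_lt_1; lra).
      rewrite <- (Rmult_1_r ((2 * y1) ^ p * (P / (2 * PI)) ^ p)) at 2.
      apply Rmult_le_compat_l; [|assumption].
      apply Rmult_le_pos; apply pow_le; [lra|]. apply Rmult_le_pos; [lra|left; apply Rinv_0_lt_compat; lra].
    - replace (3 * (P * l)) with (3 * l * INR p) by (fold P; ring). rewrite exp_sum_n.
      apply pow_incr. split.
      { apply Rmult_le_pos; [lra|]. apply Rmult_le_pos; [lra|left; apply Rinv_0_lt_compat; lra]. }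
      replace (2 * y1 * (P / (2 * PI))) with (P * P * v / PI ^ 2) by (unfold y1; rewrite HKP; field; lra).
      replace (3 * l) with (l + (l + l)) by ring. rewrite !exp_plus.
      assert (Hel : exp l = K * ln K) by (apply exp_loglog; lra).
      assert (Hln := ln_ge_12 K HK).
      assert (HPe : P <= exp l) by (rewrite Hel; nra).
      assert (Hve : v <= exp l) by (assert (B := exp_ineq1_le l); lra).
      apply Rle_trans with (P * P * v).
      + apply Rmult_le_reg_r with (PI ^ 2); [nra|]. unfold Rdiv. rewrite Rmult_assoc, Rinv_l, Rmult_1_r by nra.
        assert (0 <= P * P * v) by nra. assert (1 <= PI ^ 2) by nra. nra.
      + rewrite Rmult_assoc. apply Rmult_le_compat; [lra|nra|exact HPe|].
        apply Rmult_le_compat; lra. }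
  replace ((2 * y1) ^ p * exp (- t * (K ^ 2 * l ^ 2)) / (1 - exp (- t))
    * (exp (2 * PI * / y1) * ((P / (2 * PI)) ^ p * exp (- P))))
    with ((2 * y1) ^ p * ((P / (2 * PI)) ^ p * exp (- P)) * (exp (- t * (K ^ 2 * l ^ 2)) * (/ (1 - exp (- t)) * exp (2 * PI * / y1))))
    by (unfold Rdiv; ring).
  assert (Het : exp (- t) < 1) by (apply exp_lt_1; lra).
  apply Rle_trans with (exp (3 * (P * l)) * (exp (- (19 * (P * l))) * (exp (2 * (P * l)) * 6))).
  - apply Rmult_le_compat.
    + apply Rmult_le_pos; [apply pow_le; lra|]. apply Rmult_le_pos; [|left; apply exp_pos].
      apply pow_le. apply Rmult_le_pos; [lra|left; apply Rinv_0_lt_compat; lra].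
    + apply Rmult_le_pos; [left; apply exp_pos|]. apply Rmult_le_pos; [|left; apply exp_pos].
      left. apply Rinv_0_lt_compat. lra.
    + exact Hbase.
    + apply Rmult_le_compat; [left; apply exp_pos| |apply exp_le, Hdec|].
      * apply Rmult_le_pos; [|left; apply exp_pos]. left. apply Rinv_0_lt_compat. lra.
      * apply Rmult_le_compat; [|left; apply exp_pos|exact Hinv|exact He].
        left. apply Rinv_0_lt_compat. lra.
  - set (m := P * l) in *. clearbody m. rewrite <- !Rmult_assoc, <- !exp_plus.
    assert (B := exp_neg_le (14 * m) (1 + 14 * m) ltac:(lra) (exp_ineq1_le _)).
    replace (3 * m + - (19 * m) + 2 * m) with (- (14 * m)) by ring.
    assert (C : / (1 + 14 * m) <= / 200) by (apply Rinv_le_contravar; lra). lra.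
Qed.

(** * Positivity of the coefficients *)

Lemma qform_minus (k : nat) (a b : nat -> C) (F G : C -> C) :
  qform k a F -> qform k b G -> qform k (fun n => a n - b n)%C (fun z => F z - G z)%C.
Proof.
  intros [HF HF2] [HG HG2]. split.
  - intros z Hz. eapply cseries_ext; [|exact (cseries_minus _ _ _ _ (HF z Hz) (HG z Hz))].
    intros n. cbv beta. ring.
  - intros z Hz. rewrite HF2, HG2 by exact Hz. ring.
Qed.

Lemma head_sum_nonneg (b : nat -> C) (j : nat) (y : R) : 0 <= head_sum b j y.
Proof.
  apply cond_pos_sum. intros n. apply Rmult_le_pos; [apply Cmod_ge_0|left; apply exp_pos].
Qed.

(** The head at every height above [0.86] is dominated by the head at [y0], and
    [y ^ p exp (- 2 pi y)] by its maximum. The factor [1.03] covers [1 / (1 - tau 2)]. *)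
Lemma height_sup_le (j : nat) (b : nat -> C) (g : C -> C) (M y0 : R) :
  (2 <= j)%nat -> qform (4 * S j) b g -> b 0%nat = RtoC 0 ->
  height_bound (2 * S j) g M -> (forall M', height_bound (2 * S j) g M' -> M <= M') ->
  0 <= y0 <= 86 / 100 ->
  M <= 1.03 * (head_sum b j y0 * (exp (2 * PI * y0) *
         ((INR (2 * S j) / (2 * PI)) ^ (2 * S j) * exp (- INR (2 * S j))))).
Proof.
  intros Hj Hg Hb HM Hmin Hy0.
  set (A := head_sum b j y0 * _). assert (HM0 := height_bound_nonneg _ _ _ HM).
  assert (H : height_bound (2 * S j) g (A + tau j * M)).
  { apply (height_bound_contract j b g M A Hg HM). intros y Hy.
    assert (Hy' : y0 <= y) by lra.
    assert (G := head_sum_growth b j y y0 Hb Hy').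
    apply Rmult_le_compat_l with (r := y ^ (2 * S j)) in G; [|apply pow_le; lra].
    eapply Rle_trans; [exact G|].
    replace (- (2 * PI * (y - y0))) with (2 * PI * y0 + - (2 * PI * y)) by ring. rewrite exp_plus.
    replace (y ^ (2 * S j) * (head_sum b j y0 * (exp (2 * PI * y0) * exp (- (2 * PI * y)))))
      with (head_sum b j y0 * (exp (2 * PI * y0) * (y ^ (2 * S j) * exp (- (2 * PI * y))))) by ring.
    apply Rmult_le_compat_l; [apply head_sum_nonneg|].
    apply Rmult_le_compat_l; [left; apply exp_pos|]. apply pow_exp_le. lra. }
  assert (H1 := Hmin _ H).
  assert (T := tau_decr 2 j Hj). assert (T2 : tau 2 <= 0.024) by (unfold tau; simpl; lra).
  assert (tau j * M <= 0.024 * M) by (apply Rmult_le_compat_r; lra). lra.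
Qed.

Lemma qpar_imag (y : R) : qpar (0, y) = RtoC (exp (- (2 * PI * y))).
Proof.
  unfold qpar, RtoC; simpl. rewrite Rmult_0_r, cos_0, sin_0. f_equal; [|ring].
  rewrite Rmult_1_r. f_equal. ring.
Qed.

Lemma qpar_imag_pow (y : R) (n : nat) : Cpow (qpar (0, y)) n = RtoC (exp (- (2 * PI * y) * INR n)).
Proof. rewrite qpar_imag, <- RtoC_pow, <- exp_sum_n. reflexivity. Qed.

Lemma Re_mult_RtoC (c : C) (r : R) : Re (c * RtoC r)%C = Re c * r.
Proof. destruct c; simpl. ring. Qed.

Lemma neg_inv_imag (y : R) : 0 < y -> (- / ((0, y) : C))%C = (0, / y).
Proof.
  intros Hy. unfold Cinv, Copp; simpl. f_equal; field; lra.
Qed.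

Lemma Cpow_imag_4 (y : R) (q : nat) : Cpow (0, y) (4 * q) = RtoC (y ^ (4 * q)).
Proof.
  rewrite Cpow_mult_r, pow_mult, RtoC_pow. f_equal.
  unfold RtoC, Cpow, Cmult; simpl. f_equal; ring.
Qed.

Lemma qform_imag (q : nat) (b : nat -> C) (F : C -> C) (y : R) :
  qform (4 * q) b F -> 0 < y -> Re (F (0, / y)) = y ^ (4 * q) * Re (F (0, y)).
Proof.
  intros [_ H] Hy. assert (H1 := H (0, y) Hy).
  rewrite neg_inv_imag, Cpow_imag_4 in H1 by exact Hy. rewrite H1. apply Re_scal.
Qed.

(** The closing of the circle: with [A] the left-hand side and [Y = y1 ^ k], the three shares give
    [A <= 2.02 Y + (0.42 + 0.0206 + 0.0309) A]. *)
Lemma initial_coefficients_bound (j : nat) (a : nat -> C) (f : C -> C) (M : R) :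
  (2 <= j)%nat -> qform (4 * S j) a f -> a 0%nat = RtoC 1 ->
  let K := 4 * INR (S j) in
  (forall n : nat, (1 <= n)%nat -> INR n <= K ^ 2 * loglog K ^ 2 -> Im (a n) = 0 /\ 0 <= Re (a n)) ->
  let b := fun n => (a n - RtoC (e4pow j n))%C in
  let g := fun z => (f z - E4pow j z)%C in
  let y1 := K * (loglog K - 3 / 2) / (2 * PI) in
  height_bound (2 * S j) g M -> (forall M', height_bound (2 * S j) g M' -> M <= M') ->
  head_sum b j (/ y1) <= 4 * y1 ^ (4 * S j).
Proof.
  intros Hj Hf Ha0 K Ha b g y1 HM Hmin.
  destruct (y1_facts j Hj) as (HK & Hv & Hl & E & HKv & Hy).
  fold K in HK, Hv, Hl, E, HKv, Hy. fold y1 in E, Hy.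
  assert (HP := PI_bounds).
  assert (HG := E4pow_qform j).
  assert (Hg : qform (4 * S j) b g) by exact (qform_minus _ _ _ _ _ Hf HG).
  assert (Hb0 : b 0%nat = RtoC 0) by (unfold b; rewrite Ha0, e4pow_0; ring).
  set (y0 := / y1). assert (Hy0 : 0 < y0 <= 0.3).
  { unfold y0. split; [apply Rinv_0_lt_compat; lra|].
    replace 0.3 with (/ (/ 0.3)) by (rewrite Rinv_inv; reflexivity). apply Rinv_le_contravar; lra. }
  assert (Hy10 : / y0 = y1) by (unfold y0; apply Rinv_inv).
  set (N := K ^ 2 * loglog K ^ 2) in *.
  set (p := (2 * S j)%nat) in *.
  set (A := head_sum b j y0). assert (HA : 0 <= A) by apply head_sum_nonneg.
  set (X := exp (2 * PI * y0) * ((INR p / (2 * PI)) ^ p * exp (- INR p))).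
  assert (HX : 0 < X).
  { apply Rmult_lt_0_compat; [apply exp_pos|]. apply Rmult_lt_0_compat; [|apply exp_pos].
    apply pow_lt. apply Rdiv_lt_0_compat; [apply lt_0_INR; unfold p; lia|lra]. }
  assert (HMA : M <= 1.03 * (A * X)).
  { apply (height_sup_le j b g M y0 Hj Hg Hb0 HM Hmin). lra. }
  assert (HM0 := height_bound_nonneg _ _ _ HM).
  assert (T1 := theta1_le j Hj). assert (T2 := theta2_le j Hj). assert (T3 := theta3_le j Hj).
  cbv zeta in T1, T2, T3. fold K in T1, T2, T3. fold y1 in T1, T2, T3. fold y0 in T1, T2, T3.
  fold p in T2, T3. fold X in T2, T3. fold N in T3.
  set (t := PI * y0 / 2) in *. assert (Ht : 0 < t) by (unfold t; nra).
  set (D2 := (2 * y1) ^ p * exp (- (PI * y1) * INR (S j)) / (1 - exp (- (PI * y1)))) in *.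
  set (D3 := (2 * y1) ^ p * exp (- t * N) / (1 - exp (- t))) in *.
  (* Hecke's bound at height [y0 / 2] controls the terms [n > N], where nothing is known about
     the sign of [a n]. *)
  set (c := M * (2 * y1) ^ p * exp (- t * N)).
  assert (H2y : 0 < (2 * y1) ^ p) by (apply pow_lt; lra).
  assert (Hc : 0 <= c).
  { unfold c. apply Rmult_le_pos; [apply Rmult_le_pos; lra|left; apply exp_pos]. }
  set (z0 := (0, y0) : C). assert (Hz0 : upper z0) by (unfold upper, z0; simpl; lra).
  set (E0 := fun n => exp (- (2 * PI * y0) * INR n)).
  assert (HE0 : forall n, 0 < E0 n) by (intros; apply exp_pos).
  (* Where [a n >= 0] the first two summands dominate [|b n|]; the third makes [w] nonnegative also
     beyond [N]. Hence the head is at most the full sum, which is known in closed form. *)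
  set (w := fun n => Re (a n) * E0 n + e4pow j n * E0 n + c * exp (- t * INR n)).
  assert (Hws : is_series w (Re (f z0) + Re (E4pow j z0) + c * / (1 - exp (- t)))).
  { assert (S1 := is_series_Re _ _ (proj1 Hf z0 Hz0)). assert (S2 := is_series_Re _ _ (proj1 HG z0 Hz0)).
    assert (S3 := @is_series_scal_l R_AbsRing R_NormedModule c _ _ (is_series_exp t Ht)).
    assert (S4 := is_series_plus _ _ _ _ (is_series_plus _ _ _ _ S1 S2) S3).
    eapply is_series_ext; [|exact S4]. intros n. unfold w, E0, z0.
    rewrite !qpar_imag_pow, !Re_mult_RtoC. reflexivity. }
  assert (Htail : forall n, N < INR n -> Cmod (b n) * E0 n <= c * exp (- t * INR n)).
  { intros n Hn.
    assert (Hh := height_bound_hecke p b g M (y0 / 2) n (proj1 Hg) HM ltac:(lra)).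
    assert (E1 : (y0 / 2) ^ p * (2 * y1) ^ p = 1).
    { rewrite <- Rpow_mult_distr. replace (y0 / 2 * (2 * y1)) with 1 by (unfold y0; field; lra). apply pow1. }
    apply Rmult_le_compat_r with (r := (2 * y1) ^ p * E0 n) in Hh.
    2:{ apply Rmult_le_pos; [lra|left; apply HE0]. }
    replace (Cmod (b n) * (y0 / 2) ^ p * ((2 * y1) ^ p * E0 n))
      with (Cmod (b n) * E0 n * ((y0 / 2) ^ p * (2 * y1) ^ p)) in Hh by ring.
    rewrite E1, Rmult_1_r in Hh. eapply Rle_trans; [exact Hh|].
    unfold c. replace (M * exp (2 * PI * (y0 / 2) * INR n) * ((2 * y1) ^ p * E0 n))
      with (M * (2 * y1) ^ p * (exp (2 * PI * (y0 / 2) * INR n) * E0 n)) by ring.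
    rewrite (Rmult_assoc (M * (2 * y1) ^ p)). apply Rmult_le_compat_l; [apply Rmult_le_pos; lra|].
    unfold E0. rewrite <- !exp_plus. apply exp_le.
    replace (2 * PI * (y0 / 2) * INR n) with (2 * t * INR n) by (unfold t; field).
    replace (- (2 * PI * y0) * INR n) with (- (4 * t * INR n)) by (unfold t; field).
    assert (t * N <= t * INR n) by (apply Rmult_le_compat_l; lra). lra. }
  assert (Hjn : INR j <= N).
  { assert (HKj : K = 4 * (INR j + 1)) by (unfold K; rewrite S_INR; ring).
    assert (H0 := pos_INR j). assert (Hl2 : 1 <= loglog K ^ 2) by nra.
    assert (HK2 : K <= K ^ 2) by nra. unfold N. nra. }
  assert (Hw : forall n, 0 <= w n /\ ((n <= j)%nat -> Cmod (b n) * E0 n <= w n)).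
  { intros n. assert (HEn := HE0 n). assert (He := e4pow_nonneg j n).
    assert (Hcn : 0 <= c * exp (- t * INR n)) by (apply Rmult_le_pos; [exact Hc|left; apply exp_pos]).
    unfold w. destruct n as [|n].
    - rewrite Hb0, Ha0, e4pow_0, Cmod_0. simpl Re. split; [lra|intros _; lra].
    - destruct (Rle_lt_dec (INR (S n)) N) as [Hn|Hn].
      + destruct (Ha (S n) ltac:(lia) Hn) as [Hi Hr].
        assert (0 <= (Re (a (S n)) + e4pow j (S n)) * E0 (S n)) by (apply Rmult_le_pos; lra).
        split; [lra|intros _].
        assert (Cmod (b (S n)) <= Re (a (S n)) + e4pow j (S n)).
        { unfold b. replace (a (S n)) with (RtoC (Re (a (S n)))).
          - rewrite <- RtoC_minus, Cmod_R. simpl Re. apply Rabs_le. lra.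
          - destruct (a (S n)) as [r i]. simpl in *. subst i. reflexivity. }
        assert (Cmod (b (S n)) * E0 (S n) <= (Re (a (S n)) + e4pow j (S n)) * E0 (S n))
          by (apply Rmult_le_compat_r; lra). lra.
      + assert (Ht' := Htail (S n) Hn). split.
        * assert (Hre : - Cmod (b (S n)) <= Re (a (S n)) - e4pow j (S n)).
          { assert (G := re_le_Cmod (b (S n))). unfold b at 1 in G.
            destruct (a (S n)) as [r i]. simpl in *.
            apply Rabs_le_between in G. lra. }
          assert (- Cmod (b (S n)) * E0 (S n) <= (Re (a (S n)) - e4pow j (S n)) * E0 (S n))
            by (apply Rmult_le_compat_r; lra).
          assert (0 <= e4pow j (S n) * E0 (S n)) by (apply Rmult_le_pos; lra). lra.
        * intros Hle. apply le_INR in Hle. lra. }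
  assert (HAw : A <= Re (f z0) + Re (E4pow j z0) + c * / (1 - exp (- t))).
  { rewrite <- (is_series_unique _ _ Hws).
    apply Rle_trans with (sum_f_R0 w j).
    - unfold A, head_sum. apply sum_Rle. intros n Hn. apply Hw, Hn.
    - apply sum_le_Series; [intros n; apply Hw|]. eexists; exact Hws. }
  (* [f (i y0) = y1 ^ k f (i y1)], and both forms are close to [1] at height [y1]. *)
  set (z1 := (0, y1) : C). assert (Hz1 : upper z1) by (unfold upper, z1; simpl; lra).
  assert (HY : 0 < y1 ^ (4 * S j)) by (apply pow_lt; lra).
  assert (HfY : Re (f z0) = y1 ^ (4 * S j) * Re (f z1)) by exact (qform_imag (S j) a f y1 Hf ltac:(lra)).
  assert (HGY : Re (E4pow j z0) = y1 ^ (4 * S j) * Re (E4pow j z1)) by exact (qform_imag (S j) _ _ y1 HG ltac:(lra)).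
  assert (HG1 : Cmod (E4pow j z1) <= 1.01).
  { apply Cmod_E4pow_le; [exact Hj|]. simpl Im. rewrite E. unfold K.
    assert (H0 := pos_INR (S j)).
    assert (1.87 * (4 * INR (S j)) <= (loglog (4 * INR (S j)) - 3 / 2) * (4 * INR (S j)))
      by (apply Rmult_le_compat_r; [lra|exact Hv]). lra. }
  assert (Hfz : Re (f z1) <= Cmod (E4pow j z1) + Cmod (g z1)).
  { assert (R1 := re_le_Cmod (f z1)). assert (R2 := Rle_abs (Re (f z1))).
    assert (R3 := Cmod_triangle (E4pow j z1) (g z1)).
    replace (E4pow j z1 + g z1)%C with (f z1) in R3 by (unfold g; ring). lra. }
  assert (HGz : Re (E4pow j z1) <= Cmod (E4pow j z1)).
  { assert (R1 := re_le_Cmod (E4pow j z1)). assert (R2 := Rle_abs (Re (E4pow j z1))). lra. }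
  assert (Hg1 : y1 ^ (4 * S j) * Cmod (g z1) <= 0.42 * A + M * D2).
  { assert (Hs := qexp_split p b g M j z1 (proj1 Hg) HM Hz1). simpl Im in Hs.
    assert (Hgr := head_sum_growth b j y1 y0 Hb0 ltac:(lra)). fold A in Hgr.
    assert (Hyp : 0 < y1 ^ p) by (apply pow_lt; lra).
    assert (E4p : y1 ^ (4 * S j) = y1 ^ p * y1 ^ p) by (rewrite <- pow_add; f_equal; unfold p; lia).
    apply Rmult_le_compat_l with (r := y1 ^ p) in Hs; [|lra].
    rewrite <- Rmult_assoc, <- E4p in Hs. eapply Rle_trans; [exact Hs|].
    rewrite Rmult_plus_distr_l. apply Rplus_le_compat.
    - rewrite <- Rmult_assoc, <- E4p.
      apply Rle_trans with (y1 ^ (4 * S j) * (A * exp (- (2 * PI * (y1 - y0))))).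
      + apply Rmult_le_compat_l; [lra|exact Hgr].
      + replace (y1 ^ (4 * S j) * (A * exp (- (2 * PI * (y1 - y0)))))
          with (y1 ^ (4 * S j) * exp (- (2 * PI * (y1 - y0))) * A) by ring.
        apply Rmult_le_compat_r; [exact HA|exact T1].
    - right. unfold D2. rewrite (Rpow_mult_distr 2 y1). unfold Rdiv. ring. }
  assert (HD2 : M * D2 <= 0.0206 * A).
  { assert (HD : 0 <= D2).
    { unfold D2. apply Rmult_le_pos; [apply Rmult_le_pos; [lra|left; apply exp_pos]|].
      left. apply Rinv_0_lt_compat. assert (exp (- (PI * y1)) < 1) by (apply exp_lt_1; nra). lra. }
    apply Rle_trans with (1.03 * (A * X) * D2); [apply Rmult_le_compat_r; lra|].
    replace (1.03 * (A * X) * D2) with (1.03 * A * (D2 * X)) by ring.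
    apply Rle_trans with (1.03 * A * 0.02); [apply Rmult_le_compat_l; lra|lra]. }
  assert (HD3 : c * / (1 - exp (- t)) <= 0.0309 * A).
  { replace (c * / (1 - exp (- t))) with (M * D3) by (unfold c, D3, Rdiv; ring).
    assert (HD : 0 <= D3).
    { unfold D3. apply Rmult_le_pos; [apply Rmult_le_pos; [lra|left; apply exp_pos]|].
      left. apply Rinv_0_lt_compat. assert (exp (- t) < 1) by (apply exp_lt_1; lra). lra. }
    apply Rle_trans with (1.03 * (A * X) * D3); [apply Rmult_le_compat_r; lra|].
    replace (1.03 * (A * X) * D3) with (1.03 * A * (D3 * X)) by ring.
    apply Rle_trans with (1.03 * A * 0.03); [apply Rmult_le_compat_l; lra|lra]. }
  rewrite HfY, HGY in HAw. fold A.
  set (Y := y1 ^ (4 * S j)) in *.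
  assert (Y * Re (f z1) <= Y * (1.01 + Cmod (g z1))) by (apply Rmult_le_compat_l; lra).
  assert (Y * Re (E4pow j z1) <= Y * 1.01) by (apply Rmult_le_compat_l; lra).
  lra.
Qed.

(** At the minimising height the factors depending on [p] in Hecke's bound and in the bound for [M]
    cancel, leaving [|b n| <= 25 y1 ^ k n ^ (k / 2)], where 25 rounds up [1.03 * 4 * 6]. The factor
    2 of [e4pow_main_term] makes it the 50 of [main_numeric]. *)
Lemma coefficients_positive (j : nat) (a : nat -> C) (f : C -> C) :
  (2 <= j)%nat -> qform (4 * S j) a f -> a 0%nat = RtoC 1 ->
  let K := 4 * INR (S j) in
  (forall n : nat, (1 <= n)%nat -> INR n <= K ^ 2 * loglog K ^ 2 -> Im (a n) = 0 /\ 0 <= Re (a n)) ->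
  forall n : nat, / 7316 * K ^ 4 * loglog K ^ 2 <= INR n -> 0 < Re (a n).
Proof.
  intros Hj Hf Ha0 K Ha n Hn.
  destruct (y1_facts j Hj) as (HK & Hv & Hl & E & HKv & Hy).
  assert (HP := PI_bounds).
  assert (HG := E4pow_qform j).
  set (b := fun n => (a n - RtoC (e4pow j n))%C).
  set (g := fun z => (f z - E4pow j z)%C).
  assert (Hg : qform (4 * S j) b g) by exact (qform_minus _ _ _ _ _ Hf HG).
  assert (Hb0 : b 0%nat = RtoC 0) by (unfold b; rewrite Ha0, e4pow_0; ring).
  destruct (height_bound_sup j b g Hg Hb0) as [M [HM Hmin]].
  assert (HA := initial_coefficients_bound j a f M Hj Hf Ha0 Ha HM Hmin).
  fold b g in HA. cbv zeta in HA. fold K in HK, Hv, Hl, E, HKv, Hy, HA.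
  set (y1 := K * (loglog K - 3 / 2) / (2 * PI)) in *.
  set (y0 := / y1) in *.
  assert (Hy0 : 0 < y0 <= 0.3).
  { unfold y0. split; [apply Rinv_0_lt_compat; lra|].
    replace 0.3 with (/ (/ 0.3)) by (rewrite Rinv_inv; reflexivity). apply Rinv_le_contravar; lra. }
  assert (HMA := height_sup_le j b g M y0 Hj Hg Hb0 HM Hmin ltac:(lra)).
  set (A := head_sum b j y0) in *.
  assert (He := exp_y0_le y1 ltac:(lra)). fold y0 in He.
  set (p := (2 * S j)%nat) in *. set (P := INR p) in *.
  assert (HPp : 6 <= P).
  { unfold P, p. replace 6 with (INR 6) by (simpl; lra). apply le_INR. lia. }
  assert (Hq : 3 <= INR (S j)) by (unfold K in HK; lra).
  assert (Hn1 : K ^ 4 / 700 <= INR n).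
  { eapply Rle_trans; [|exact Hn]. assert (HK4 : 0 < K ^ 4) by (apply pow_lt; lra).
    assert (11 <= loglog K ^ 2) by nra. nra. }
  assert (Hn2 : K ^ 3 / 12 <= INR n ^ 2).
  { assert (H4 : K ^ 4 / 700 = K ^ 3 * (K / 700)) by field.
    assert (H3 : 1728 <= K ^ 3) by (replace 1728 with (12 ^ 3) by ring; apply pow_incr; lra).
    assert (29 <= K ^ 4 / 700) by nra.
    assert (K ^ 3 / 60 <= K ^ 4 / 700) by nra. nra. }
  assert (Hn3 : K <= INR n).
  { assert (H3 : 1728 <= K ^ 3) by (replace 1728 with (12 ^ 3) by ring; apply pow_incr; lra).
    assert (H4 : K ^ 4 / 700 = K * (K ^ 3 / 700)) by field. nra. }
  assert (Hn0 : 0 < INR n) by lra.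
  (* [p / (2 pi n)] is the height minimising Hecke's bound. *)
  assert (Hbn : Cmod (b n) <= 25 * y1 ^ (4 * S j) * INR n ^ p).
  { assert (Hh := height_bound_hecke p b g M (P / (2 * PI * INR n)) n (proj1 Hg) HM
       ltac:(apply Rdiv_lt_0_compat; nra)).
    replace (2 * PI * (P / (2 * PI * INR n)) * INR n) with P in Hh by (field; lra).
    replace (P / (2 * PI * INR n)) with (P / (2 * PI) * / INR n) in Hh by (field; lra).
    rewrite Rpow_mult_distr, pow_inv in Hh.
    set (W := (P / (2 * PI)) ^ p) in *.
    assert (HW : 0 < W) by (apply pow_lt, Rdiv_lt_0_compat; lra).
    assert (Hnp : 0 < INR n ^ p) by (apply pow_lt, Hn0).
    assert (HeP : exp (- P) * exp P = 1).
    { rewrite <- exp_plus. replace (- P + P) with 0 by ring. apply exp_0. }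
    apply Rmult_le_reg_r with (W * / INR n ^ p).
    { apply Rmult_lt_0_compat; [exact HW|apply Rinv_0_lt_compat, Hnp]. }
    eapply Rle_trans; [exact Hh|].
    apply Rle_trans with (1.03 * (A * (exp (2 * PI * y0) * (W * exp (- P)))) * exp P).
    { apply Rmult_le_compat_r; [left; apply exp_pos|exact HMA]. }
    replace (1.03 * (A * (exp (2 * PI * y0) * (W * exp (- P)))) * exp P)
      with (1.03 * W * (A * exp (2 * PI * y0)) * (exp (- P) * exp P)) by ring.
    rewrite HeP, Rmult_1_r.
    replace (25 * y1 ^ (4 * S j) * INR n ^ p * (W * / INR n ^ p)) with (W * (25 * y1 ^ (4 * S j))) by (field; lra).
    replace (1.03 * W * (A * exp (2 * PI * y0))) with (W * (1.03 * (A * exp (2 * PI * y0)))) by ring.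
    apply Rmult_le_compat_l; [lra|].
    assert (HA0 : 0 <= A) by apply head_sum_nonneg.
    assert (A * exp (2 * PI * y0) <= 4 * y1 ^ (4 * S j) * 6).
    { apply Rmult_le_compat; [exact HA0|left; apply exp_pos|exact HA|exact He]. }
    assert (0 < y1 ^ (4 * S j)) by (apply pow_lt; lra). lra. }
  assert (Hmt : (6 * e4_const) ^ S j * INR n ^ (4 * j + 3) <= 2 * INR (fact (4 * j + 3)) * e4pow j n).
  { apply e4pow_main_term.
    - rewrite mult_INR. replace (INR 4) with 4 by (simpl; ring). exact Hn2.
    - apply INR_le. eapply Rle_trans; [|exact Hn3]. unfold K.
      replace (INR (2 * j + 1)) with (2 * INR j + 1) by (rewrite plus_INR, mult_INR; simpl; ring).
      rewrite (S_INR j). assert (H0 := pos_INR j). lra. }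
  assert (Hnum := main_numeric j (6 * e4_const) (INR n) Hj e4_const_ge Hn).
  cbv zeta in Hnum. fold K in Hnum. fold y1 in Hnum.
  assert (Hf0 : 0 < INR (fact (4 * j + 3))) by apply INR_fact_lt_0.
  assert (Hnp : 0 < INR n ^ p) by (apply pow_lt, Hn0).
  apply Rmult_lt_compat_r with (r := INR n ^ p) in Hnum; [|exact Hnp].
  rewrite (Rmult_assoc ((6 * e4_const) ^ S j)), <- pow_add in Hnum.
  replace (2 * j + 1 + p)%nat with (4 * j + 3)%nat in Hnum by (unfold p; lia).
  assert (Hlt : 25 * y1 ^ (4 * S j) * INR n ^ p < e4pow j n).
  { apply Rmult_lt_reg_l with (2 * INR (fact (4 * j + 3))); [lra|]. lra. }
  assert (G := re_le_Cmod (b n)). unfold b at 1 in G. apply Rabs_le_between in G.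
  destruct (a n) as [r i]. simpl in *. lra.
Qed.

(** * Small weights, reality of the coefficients, and the theorem *)

Lemma e4pow_pos (j n : nat) : 0 < e4pow j n.
Proof.
  induction j as [|j IH].
  - destruct n as [|n]; [simpl; lra|]. change (0 < e4_const * sigma3 (S n)).
    apply Rmult_lt_0_compat; [apply e4_const_pos|].
    eapply Rlt_le_trans; [|apply sigma3_ge]. apply pow_lt, lt_0_INR. lia.
  - destruct n as [|n]; [rewrite e4pow_0; lra|].
    cbn [e4pow]. rewrite tech5, Nat.sub_diag.
    assert (0 <= sum_f_R0 (fun i => e4pow j i * e4 (S n - i)) n).
    { apply cond_pos_sum. intros i. apply Rmult_le_pos; [apply e4pow_nonneg|apply e4_nonneg]. }
    simpl (e4 0). lra.
Qed.

Lemma clim_conj (s : nat -> C) (l : C) : clim s l -> clim (fun n => Cconj (s n)) (Cconj l).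
Proof.
  intros H eps He. destruct (H eps He) as [N HN]. exists N. intros n Hn.
  rewrite <- Cminus_conj, Cmod_conj. apply HN, Hn.
Qed.

Lemma csumn_conj (u : nat -> C) (n : nat) : csumn (fun i => Cconj (u i)) n = Cconj (csumn u n).
Proof.
  induction n as [|n IH]; simpl.
  - unfold Cconj, RtoC; simpl. f_equal. ring.
  - rewrite IH, Cplus_conj. reflexivity.
Qed.

(** The reflection [z |-> - conj z] preserves the upper half-plane, conjugates the nome and commutes
    with inversion; its sign disappears in the power [4 q]. *)
Lemma qform_conj (q : nat) (a : nat -> C) (F : C -> C) :
  qform (4 * q) a F -> qform (4 * q) (fun n => Cconj (a n)) (fun z => Cconj (F (- Cconj z)%C)).
Proof.
  intros [H1 H2].
  assert (Hup : forall z, upper z -> upper (- Cconj z)%C).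
  { intros [x y] Hz. unfold upper in *. simpl in *. lra. }
  split.
  - intros z Hz.
    assert (Eq : qpar (- Cconj z)%C = Cconj (qpar z)).
    { destruct z as [x y]. unfold qpar, Cconj, Copp; simpl.
      rewrite Ropp_involutive. replace (2 * PI * - x) with (- (2 * PI * x)) by ring.
      rewrite cos_neg, sin_neg. f_equal. ring. }
    assert (H := clim_conj _ _ (H1 _ (Hup z Hz))).
    eapply clim_ext; [|exact H]. intros n. cbv beta. rewrite <- csumn_conj. apply csumn_ext.
    intros i _. rewrite Cmult_conj, Cpow_conj, Eq. rewrite Cconj_conj. reflexivity.
  - intros z Hz. assert (Hz0 := upper_neq_0 z Hz).
    replace (- Cconj (- / z))%C with (- / - Cconj z)%C.
    + rewrite H2 by (apply Hup, Hz). rewrite Cmult_conj, Cpow_conj. f_equal.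
      rewrite !Cpow_mult_r. f_equal. rewrite Copp_conj, Cconj_conj. simpl. ring.
    + rewrite Copp_conj, Cinv_conj by exact Hz0.
      assert (Hc : Cconj z <> RtoC 0).
      { intros E. apply Hz0. rewrite <- (Cconj_conj z), E. unfold Cconj, RtoC; simpl. f_equal. ring. }
      field. exact Hc.
Qed.

Lemma loglog_ge_1 (x : R) : 4 <= x -> 1 <= loglog x.
Proof.
  intros Hx. assert (He := exp_le_3). unfold loglog.
  assert (H1 : 1 <= ln x) by (apply ln_ge_exp; lra).
  assert (H2 : 0 <= ln (ln x)) by (rewrite <- ln_1; apply ln_le; lra). lra.
Qed.

(** Subtracting the conjugate form leaves coefficients [2 i Im (a n)]; these vanish up to [j], hence
    everywhere by [cusp_form_vanish]. *)
Lemma coefficients_real (j : nat) (a : nat -> C) (f : C -> C) :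
  qform (4 * S j) a f -> (forall n, (n <= j)%nat -> Im (a n) = 0) -> forall n, Im (a n) = 0.
Proof.
  intros Hf Ha n.
  assert (H := cusp_form_vanish j _ _ (qform_minus _ _ _ _ _ Hf (qform_conj (S j) a f Hf))).
  assert (Hn : (a n - Cconj (a n))%C = RtoC 0).
  { apply H. intros i Hi. specialize (Ha i Hi). destruct (a i) as [x y]. simpl in Ha. subst y.
    unfold Cconj, Cminus, Cplus, Copp, RtoC; simpl. f_equal; ring. }
  destruct (a n) as [x y]. apply (f_equal Im) in Hn. simpl in Hn. simpl. lra.
Qed.

Lemma modular_form_qform (k : nat) (f : C -> C) (a : nat -> C) :
  modular_form_with_coeffs k f a -> qform k a f.
Proof.
  intros [_ [Hw Hq]]. split.
  - intros z Hz. apply is_series_cseries, Hq, Hz.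
  - intros z Hz. assert (H := Hw 0%Z (-1)%Z 1%Z 0%Z z ltac:(reflexivity) Hz).
    assert (Hz0 := upper_neq_0 z Hz).
    unfold moeb, ZtoC in H.
    replace ((RtoC 0 * z + RtoC (-1)) / (RtoC 1 * z + RtoC 0))%C with (- / z)%C in H.
    + rewrite H. do 2 f_equal. ring.
    + replace (RtoC (-1)) with (- RtoC 1)%C by (rewrite <- RtoC_opp; f_equal; ring). field. exact Hz0.
Qed.

Theorem theorem3 (k : nat) (f : C -> C) (a : nat -> C) :
  (0 < k)%nat -> (k mod 4 = 0)%nat ->
  modular_form_with_coeffs k f a ->
  a 0%nat = RtoC 1 ->
  (forall n : nat, (1 <= n)%nat ->
     INR n <= INR k ^ 2 * (ln (INR k) + ln (ln (INR k))) ^ 2 ->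
     Im (a n) = 0 /\ 0 <= Re (a n)) ->
  forall n : nat,
    / 7316 * INR k ^ 4 * (ln (INR k) + ln (ln (INR k))) ^ 2 <= INR n ->
    Im (a n) = 0 /\ 0 < Re (a n).
Proof.
  intros Hk0 Hk4 Hf Ha0 Ha n Hn. apply modular_form_qform in Hf.
  apply Nat.Div0.mod_divides in Hk4. destruct Hk4 as [[|j] ->]; [lia|].
  fold (loglog (INR (4 * S j))) in Ha, Hn.
  replace (INR (4 * S j)) with (4 * INR (S j)) in Ha, Hn by (rewrite mult_INR; simpl; ring).
  split.
  (* The indices up to [j] lie in the assumed range because [loglog] is at least 1 from 4 on. *)
  - apply (coefficients_real j a f Hf). intros i Hi.
    destruct i as [|i]; [rewrite Ha0; reflexivity|]. apply Ha; [lia|].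
    assert (HK : INR (S i) <= INR (S j)) by (apply le_INR; lia).
    assert (Hj1 : 1 <= INR (S j)) by (replace 1 with (INR 1) by reflexivity; apply le_INR; lia).
    assert (Hl := loglog_ge_1 (4 * INR (S j)) ltac:(lra)).
    assert (1 <= loglog (4 * INR (S j)) ^ 2) by nra. nra.
  - destruct (le_lt_dec 2 j) as [Hj|Hj].
    + exact (coefficients_positive j a f Hj Hf Ha0 Ha n Hn).
    (* Weights 4 and 8: the difference from the power of [E4] vanishes, and that power has only
       positive coefficients. *)
    + assert (Hg := qform_minus _ _ _ _ _ Hf (E4pow_qform j)).
      assert (Hb0 : (a 0%nat - RtoC (e4pow j 0))%C = RtoC 0) by (rewrite Ha0, e4pow_0; ring).
      assert (Hb : forall m, (a m - RtoC (e4pow j m))%C = RtoC 0).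
      { assert (j = 0 \/ j = 1)%nat as [-> | ->] by lia.
        - apply (cusp_form_vanish 0 _ _ Hg). intros m Hm. replace m with 0%nat by lia. exact Hb0.
        - apply (cusp_form_weight_8 _ _ Hg Hb0). }
      replace (a n) with (RtoC (e4pow j n)).
      * apply e4pow_pos.
      * replace (a n) with (RtoC (e4pow j n) + (a n - RtoC (e4pow j n)))%C by ring. rewrite Hb. ring.
Qed.
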